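(* Let $\mathbb{K}$ be a field, let $\alpha,\beta$ be coprime positive integers, and let $R=\mathbb{K}[X,Y]$ be $\mathbb{Z}$-graded by $\deg X=\alpha$, $\deg Y=\beta$. Let $H=\sum_i h_it^i\in\mathbb{Z}(\!(t)\!)$ be a formal Laurent series which is the Hilbert series of some finitely generated graded $R$-module. Let $S=R/(X^\beta-Y^\alpha)$. Then the following statements are equivalent: (a) $H$ has positive Hilbert depth (over $R$). (b) For any finitely generated torsionfree graded $S$-module $N$, $\dfrac{H\cdot H_N}{H_R}\ge0$. (c) The inequality $\dfrac{H\cdot H_N}{H_R}\ge0$ holds for any finitely generated torsionfree graded $S$-module $N$ of rank $1$. (d) $\displaystyle\sum_{i\in I}h_{i+n}\le\sum_{j\in J}h_{j+n}$ for all $n\in\mathbb{Z}$ and all fundamental couples $[I,J]$ with respect to $\alpha$ and $\beta$.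
   Context: The Hilbert series of a finitely generated $\mathbb{Z}$-graded module $M$ is $H_M=\sum_{a\in\mathbb{Z}}(\dim_{\mathbb{K}}M_a)t^a$. A series $G$ satisfies $G\ge0$ if all its coefficients are nonnegative. The Hilbert depth of a series $H$ that is the Hilbert series of some finitely generated graded $R$-module is $\sup\{\operatorname{depth}(N)\mid N\text{ a finitely generated graded }R\text{-module with }H_N=H\}$, depth being taken with respect to $(X,Y)$. Let $\mathbb{N}$ contain $0$ and let $\langle\alpha,\beta\rangle\subseteq\mathbb{N}$ be the numerical semigroup generated by $\alpha$ and $\beta$. A fundamental couple (with respect to $\alpha,\beta$) is a pair $[I,J]$ of integer sequences $I=(i_k)_{k=0}^m$ and $J=(j_k)_{k=0}^m$ (for some $m\in\mathbb{N}$) such that: (0) $i_0=0$; (1) $i_1,\dots,i_m,j_1,\dots,j_{m-1}\in\mathbb{N}\setminus\langle\alpha,\beta\rangle$ and $j_0,j_m\le\alpha\beta$; (2) $i_k\equiv j_k \pmod\alpha$ and $i_k<j_k$ for $k=0,\dots,m$; $j_k\equiv i_{k+1}\pmod\beta$ and $j_k>i_{k+1}$ for $k=0,\dots,m-1$; $j_m\equiv i_0\pmod\beta$ and $j_m\ge i_0$; (3) $|i_k-i_\ell|\in\mathbb{N}\setminus\langle\alpha,\beta\rangle$ for $1\le k<\ell\le m$. *)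

(* Defs.v *)
From HB Require Import structures.
From mathcomp Require Import all_boot all_order all_algebra.
From mathcomp Require Import ring_quotient polyXY.
From mathcomp Require Import boolp classical_sets fsbigop constructive_ereal.

Set Implicit Arguments.
Unset Strict Implicit.
Unset Printing Implicit Defensive.

Import Order.TTheory GRing.Theory Num.Theory.
Local Open Scope classical_set_scope.
Local Open Scope ring_scope.

(** * Graded modules over a commutative ring [A] with homogeneous pieces [gA] *)

Record gradedModule (A : comNzRingType) (gA : int -> set A) := GradedModule {
  gmod_sort :> lmodType A;
  gmod_pc : int -> set gmod_sort;
  gmod_pc0 : forall a, gmod_pc a 0;
  gmod_pcB : forall a x y, gmod_pc a x -> gmod_pc a y -> gmod_pc a (x - y);
  gmod_pcZ : forall a b f x,
    gA a f -> gmod_pc b x -> gmod_pc (a + b) (f *: x);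
  gmod_span : forall x, exists (s : seq int) (c : int -> gmod_sort),
    (forall a, gmod_pc a (c a)) /\ x = \sum_(a <- s) c a;
  gmod_direct : forall (s : seq int) (c : int -> gmod_sort), uniq s ->
    (forall a, gmod_pc a (c a)) -> \sum_(a <- s) c a = 0 ->
    forall a, a \in s -> c a = 0 }.

Section ModuleNotions.
Variable A : comNzRingType.

Definition fin_gen (M : lmodType A) : Prop :=
  exists (n : nat) (g : 'I_n -> M), forall x, exists c : 'I_n -> A,
    x = \sum_(i < n) c i *: g i.

Definition torsionfree (M : lmodType A) : Prop :=
  forall (f : A) (x : M), GRing.lreg f -> f *: x = 0 -> x = 0.

Definition lin_indep (M : lmodType A) (n : nat) (v : 'I_n -> M) : Prop :=
  forall c : 'I_n -> A, \sum_(i < n) c i *: v i = 0 -> forall i, c i = 0.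

(* The rank of a module over an integral domain: the maximal number of linearly
   independent elements. *)
Definition has_rank (M : lmodType A) (r : nat) : Prop :=
  (exists v : 'I_r -> M, lin_indep v) /\
  (forall (n : nat) (v : 'I_n -> M), lin_indep v -> (n <= r)%N).

(* The submodule of [M] generated by the products [f *: x] with [f] in [F]:
   it is [I M] when [F] is an ideal [I] or a generating set of [I]. *)
Definition smul (F : set A) (M : lmodType A) : set M :=
  [set x | exists (n : nat) (f : 'I_n -> A) (y : 'I_n -> M),
     (forall i, F (f i)) /\ x = \sum_(i < n) f i *: y i].

Definition ideal_gen (F : set A) : set A := @smul F A^o.

Definition regular_seq (M : lmodType A) (s : seq A) : Prop :=
  (forall k, (k < size s)%N -> forall x : M,
     smul [set` take k s] (s`_k *: x) -> smul [set` take k s] x) /\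
  @smul [set` s] M <> setT.

(* The supremum of the lengths of the [M]-regular sequences in [I], with the
   usual convention that it is infinite when [I M = M] (e.g. when [M = 0]). *)
Definition depth (I : set A) (M : lmodType A) : \bar int :=
  if `[< @smul I M = setT >] then +oo%E
  else supremum -oo%E [set d | exists s : seq A,
    [/\ {in s, forall f, I f}, regular_seq M s & d = (Posz (size s))%:E]].

End ModuleNotions.

(** * Hilbert series, as functions [int -> int] giving the coefficients *)

Section HilbertSeries.
Variables (K : fieldType) (A : comNzRingType) (iota : K -> A).

(* [V] is a subspace of [M], viewed as a vector space through [iota]. *)
Definition has_dim (M : lmodType A) (V : set M) (d : nat) : Prop :=
  exists b : 'I_d -> M, (forall i, V (b i)) /\
    forall x, V x -> exists! c : 'rV[K]_d, x = \sum_(i < d) iota (c 0 i) *: b i.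

(* The value is 0 if [V] is infinite-dimensional. *)
Definition dimK (M : lmodType A) (V : set M) : nat := xget 0%N (has_dim V).

Definition hilb (M : lmodType A) (pc : int -> set M) : int -> int :=
  fun a => Posz (dimK (pc a)).

End HilbertSeries.

(** * Formal Laurent series with integer coefficients *)

Definition is_laurent (F : int -> int) : Prop :=
  exists b : int, forall n, n < b -> F n = 0.

Definition lmul (F G : int -> int) : int -> int :=
  fun n => \sum_(i \in [set: int]) F i * G (n - i).

(* [F / G >= 0], where [F / G] is the Laurent series [Q] with [Q * G = F]. *)
Definition ldiv_ge0 (F G : int -> int) : Prop :=
  exists Q : int -> int,
    [/\ is_laurent Q, lmul Q G = F & forall n, 0 <= Q n].

(** * The rings [R = K[X, Y]] and [S = R / (X^beta - Y^alpha)] *)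

Section Rings.
Variables (K : fieldType) (alpha beta : nat).

(* [f`_i`_j] is the coefficient of the monomial ['X^i * 'Y^j]. *)
Definition polyR : comNzRingType := {poly {poly K}}.

Definition iotaR (k : K) : polyR := k%:P%:P.

Definition pcR (a : int) : set polyR :=
  [set f : {poly {poly K}} | forall i j : nat,
     f`_i`_j != 0 -> Posz (alpha * i + beta * j)%N = a].

Definition cusp : polyR := 'X ^+ beta - 'Y ^+ alpha.

Definition cusp_ideal : {pred polyR} :=
  fun f => `[< exists g : polyR, f = g * cusp >].

Fact cusp11 : (cusp : {poly {poly K}}).[1, 1] = 0.
Proof.
rewrite /cusp -polyC_exp hornerD hornerN hornerXn hornerC -polyC_exp.
by rewrite !hornerE !expr1n subrr.
Qed.

Fact cusp_idealP : idealr_closed cusp_ideal.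
Proof.
split.
- by apply/asboolP; exists 0; rewrite mul0r.
- apply/asboolP => -[g] /(congr1 (fun f : {poly {poly K}} => f.[1, 1])).
  rewrite !hornerM cusp11 mulr0 !hornerC.
  by move/eqP; rewrite oner_eq0.
- move=> a u v /asboolP[g ->] /asboolP[h ->]; apply/asboolP.
  by exists (a * g + h); rewrite mulrDl mulrA.
Qed.

HB.instance Definition _ := isIdealr.Build polyR cusp_ideal cusp_idealP.

Definition cuspS : comNzRingType := {ideal_quot cusp_ideal}.

Definition toS (f : polyR) : cuspS := (\pi_{ideal_quot cusp_ideal} f)%qT.

Definition iotaS (k : K) : cuspS := toS (iotaR k).

Definition pcS (a : int) : set cuspS := toS @` pcR a.

Definition gmodR := gradedModule pcR.
Definition gmodS := gradedModule pcS.

Definition hilbR (M : gmodR) : int -> int := hilb iotaR (@gmod_pc _ _ M).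
Definition hilbS (N : gmodS) : int -> int := hilb iotaS (@gmod_pc _ _ N).

(* The Hilbert series [H_R] of [R], as a module over itself. *)
Definition hilb_polyR : int -> int := @hilb K polyR iotaR polyR^o pcR.

Definition maxXY : set polyR := ideal_gen [set f : polyR | f = 'X \/ f = 'Y].

Definition hilbert_depth (H : int -> int) : \bar int :=
  supremum -oo%E [set d | exists N : gmodR,
    [/\ fin_gen N, hilbR N = H & d = depth maxXY N]].

End Rings.

(** * Fundamental couples *)

Definition in_sgrp (alpha beta : nat) (x : int) : Prop :=
  exists a b : nat, x = Posz (a * alpha + b * beta)%N.

Definition gap (alpha beta : nat) (x : int) : Prop :=
  0 <= x /\ ~ in_sgrp alpha beta x.

Definition fundamental_couple (alpha beta : nat) (I J : seq int) : Prop :=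
  exists m : nat,
  [/\ size I = m.+1 /\ size J = m.+1,
      I`_0 = 0,
      [/\ forall k, (1 <= k <= m)%N -> gap alpha beta I`_k,
          forall k, (1 <= k < m)%N -> gap alpha beta J`_k,
          J`_0 <= Posz (alpha * beta)%N
        & J`_m <= Posz (alpha * beta)%N],
      [/\ forall k, (k <= m)%N ->
            (I`_k = J`_k %[mod (Posz alpha)])%Z /\ I`_k < J`_k,
          forall k, (k < m)%N ->
            (J`_k = I`_k.+1 %[mod (Posz beta)])%Z /\ I`_k.+1 < J`_k
        & (J`_m = I`_0 %[mod (Posz beta)])%Z /\ I`_0 <= J`_m]
    & forall k l, (1 <= k)%N -> (k < l)%N -> (l <= m)%N ->
        gap alpha beta `|I`_k - I`_l|].

(* Main.v *)
Require Import Defs.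
From HB Require Import structures.
From mathcomp Require Import all_boot all_order all_algebra.
From mathcomp Require Import ring_quotient polyXY.
From mathcomp Require Import boolp classical_sets fsbigop constructive_ereal.
From mathcomp Require Import zify ring.

Set Implicit Arguments.
Unset Strict Implicit.
Unset Printing Implicit Defensive.

Import Order.TTheory GRing.Theory Num.Theory.
Local Open Scope ring_scope.

(** Write R for the polynomial ring, S for its cuspidal quotient, and call
    (1 - t^alpha)(1 - t^beta) H the numerator of H; as H_R is the inverse of
    (1 - t^alpha)(1 - t^beta), the quotient by H_R of a Laurent series F is its
    product by that polynomial ([ldiv_ge0_delta], [delta_hilb_polyR]).

    From (a) to (b). On a module M of positive depth no nonzero element is
    killed by both variables. Let T be the part of M that is killed by powers of
    Y. Then X is injective on T and Y is injective on M / T, so that H = f + g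
    where f (1 - t^alpha) and g (1 - t^beta) have nonnegative coefficients
    ([hilb_split]). On a torsionfree S-module N both variables are regular, so
    H_N (1 - t^alpha) and H_N (1 - t^beta) have nonnegative coefficients too, and
    the product of H_N with the numerator is a sum of two products of nonnegative
    series ([delta_lmul_ge0]).

    Between (c) and (d) stand the staircases, the nondecreasing functions psi
    with psi (k + alpha) = psi k + beta. The integers c_k = alpha psi k - k beta,
    one in each residue class modulo alpha, are the greatest elements in their
    classes of a set closed under subtraction of alpha and of beta. The negative
    of this set consists of the exponents of a submodule of K[T, 1/T] over
    S = K[T^alpha, T^beta], torsionfree of rank 1, and (c) for this module says
    that the sum of h (n + c_k) - h (n + c_k - beta) over one period is
    nonnegative for every n ([staircase_inequality]). Where psi does not jump the
    terms cancel, and what remains is the difference of the two sides of (d) for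
    a couple [I, J]: a fundamental couple is the list of lower and upper corners
    of a staircase ([couple_sum], [breaks_couple]).

    From (d) to (a). The inequalities for all staircases say that the numerator
    has nonnegative mass on every lower set, that is, every set of integers closed
    under subtraction of alpha and of beta ([lower_mass_ge0], by summation by
    parts). The numerator has finite support, since a finitely generated module
    has a basis of standard monomials whose exponents form down-closed subsets of
    the quadrant ([delta_hilb_finite]). Let a be the lowest position of the
    support. Its coefficient is positive, and a unit there can be moved to
    a + alpha or to a + beta without making the mass of any lower set negative:
    otherwise two lower sets of mass zero would obstruct the two moves, and their
    intersection, with a removed, would be a lower set of negative mass
    ([move_unit]). Such a move subtracts from H the Hilbert series of K[Y](-a) or
    of K[X](-a). When all the negative coefficients have been filled, the rest of
    the numerator is a sum of monomials t^c, the numerators of the free modules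
    R(-c) ([realizable_nonneg_masses]). Hence H is the Hilbert series of a direct
    sum of modules on each of which X + Y is regular, and this sum has positive
    depth ([realizable_depth]). *)

(** * Linear algebra with finite lists of vectors *)

Section LinearAlgebra.
Variables (K : fieldType) (A : comNzRingType) (iota : {rmorphism K -> A}).
Variable M : lmodType A.
Implicit Types (s t : seq M) (x y v : M).

(** The recursive form makes a vector of a list redundant exactly when it lies
    in the span of the vectors after it, which is what [basis_of_list] tests. *)
Fixpoint span s x : Prop :=
  if s is v :: s' then exists k : K, span s' (x - iota k *: v) else x = 0.

Fixpoint free_list s : Prop :=
  if s is v :: s' then ~ span s' v /\ free_list s' else True.

Fixpoint basis_of_list s : seq M :=
  if s is v :: s' then
    if `[< span s' v >] then basis_of_list s' else v :: basis_of_list s'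
  else [::].

Lemma span0 s : span s 0.
Proof.
by elim: s => //= v s IH; exists 0; rewrite rmorph0 scale0r subr0.
Qed.

Lemma spanD s x y : span s x -> span s y -> span s (x + y).
Proof.
elim: s x y => /= [x y -> ->|v s IH x y [k hk] [l hl]]; first by rewrite addr0.
exists (k + l); rewrite rmorphD scalerDl opprD addrACA; exact: IH.
Qed.

Lemma spanZ s k x : span s x -> span s (iota k *: x).
Proof.
elim: s x => /= [x ->|v s IH x [l hl]]; first by rewrite scaler0.
exists (k * l); rewrite rmorphM -scalerA -scalerBr; exact: IH.
Qed.

Lemma spanN s x : span s x -> span s (- x).
Proof. by move/(spanZ (-1)); rewrite rmorphN1 scaleN1r. Qed.

Lemma span_sum (I : Type) (r : seq I) (P : pred I) (F : I -> M) s :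
  (forall i, P i -> span s (F i)) -> span s (\sum_(i <- r | P i) F i).
Proof. move=> h; apply: big_ind => //; [exact: span0|exact: spanD]. Qed.

Lemma span_consr v s x : span s x -> span (v :: s) x.
Proof. by move=> hx /=; exists 0; rewrite rmorph0 scale0r subr0. Qed.

Lemma span_mem s v : v \in s -> span s v.
Proof.
elim: s => //= w s IH; rewrite inE => /orP[/eqP->|/IH hv].
  by exists 1; rewrite rmorph1 scale1r subrr; apply: span0.
exact: span_consr.
Qed.

Lemma span_trans s t x : (forall v, v \in s -> span t v) -> span s x -> span t x.
Proof.
elim: s x => [x _ /= ->|v s IH x h /= [k /IH hk]]; first exact: span0.
rewrite -(subrK (iota k *: v) x); apply: spanD.
  by apply: hk => w hw; apply: h; rewrite inE hw orbT.
by apply/spanZ/h; rewrite mem_head.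
Qed.

Lemma span_scale s t f x :
  (forall v, v \in s -> span t (f *: v)) -> span s x -> span t (f *: x).
Proof.
elim: s x => [x _ /= ->|v s IH x h /= [k /IH hk]].
  by rewrite scaler0; exact: span0.
rewrite -(subrK (iota k *: v) x) scalerDr; apply: spanD.
  by apply: hk => w hw; apply: h; rewrite inE hw orbT.
by rewrite scalerA mulrC -scalerA; apply/spanZ/h; rewrite mem_head.
Qed.

Lemma span_sub s t x : {subset s <= t} -> span s x -> span t x.
Proof. by move=> h; apply: span_trans => v /h; apply: span_mem. Qed.

Lemma span_cons v s x : span s v -> span (v :: s) x -> span s x.
Proof.
move=> hv; apply: span_trans => w; rewrite inE => /orP[/eqP->//|].
exact: span_mem.
Qed.

Lemma basis_of_list_sub s : {subset basis_of_list s <= s}.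
Proof.
elim: s => //= v s IH w; case: ifP => _; rewrite !inE; last case/orP => [->//|].
  by move/IH->; rewrite orbT.
by move/IH->; rewrite orbT.
Qed.

Lemma span_basis_of_list s x : span (basis_of_list s) x <-> span s x.
Proof.
split; first exact/span_sub/basis_of_list_sub.
elim: s x => //= v s IH x; case: ifP => [/asboolP hv|_ [k hk]].
  by move=> hx; apply/IH/(span_cons hv).
by exists k; apply: IH.
Qed.

Lemma free_basis_of_list s : free_list (basis_of_list s).
Proof.
elim: s => //= v s IH; case: ifP => // /asboolP hv; split=> // h.
by apply: hv; apply/span_basis_of_list.
Qed.

Lemma span_cat s t x : span (s ++ t) x <->
  exists u w, [/\ span s u, span t w & x = u + w].
Proof.
split=> [|[u [w [hu hw ->]]]]; last first.
  apply: spanD; [apply: span_sub hu|apply: span_sub hw] => v hv.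
    by rewrite mem_cat hv.
  by rewrite mem_cat hv orbT.
elim: s x => /= [x hx|v s IH x [k /IH[u [w [hu hw e]]]]].
  by exists 0, x; rewrite add0r.
exists (u + iota k *: v), w; split=> //; first by exists k; rewrite addrK.
by rewrite addrAC -e subrK.
Qed.

Lemma span_map_scale s f x : span [seq f *: v | v <- s] x ->
  exists2 z, span s z & x = f *: z.
Proof.
elim: s x => /= [x ->|v s IH x [k /IH[z hz e]]]; first by exists 0; rewrite ?scaler0.
exists (z + iota k *: v); first by exists k; rewrite addrK.
by rewrite scalerDr -e scalerA mulrC -scalerA subrK.
Qed.

Lemma free_extend s t : free_list t -> exists s',
  free_list (s' ++ t) /\ forall x, span (s' ++ t) x <-> span (s ++ t) x.
Proof.
move=> ft; elim: s => [|v s [s' [fs' hs']]]; first by exists [::].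
case: (pselect (span (s' ++ t) v)) => hv.
  exists s'; split=> // x; rewrite hs'; split; first exact: span_consr.
  by apply: span_cons; apply/hs'.
by exists (v :: s'); split=> //= x; split=> -[k /hs' hk]; exists k.
Qed.

(** A relation among the vectors f v modulo the span of t' comes from an element
    of the span of s whose image under f lies in the span of t'. This compares
    the dimensions of two quotients without forming the quotient modules. *)
Lemma free_scale_cat s t t' f : free_list (s ++ t) -> free_list t' ->
  (forall z, span s z -> span t' (f *: z) -> span t z) ->
  free_list ([seq f *: v | v <- s] ++ t').
Proof.
move=> fs ft'; elim: s fs => //= v s IH [hv fs] h; split; last first.
  by apply: IH => // z /(span_consr v); apply: h.
move/span_cat => [u [w [/span_map_scale[z hz ->] hw e]]]; apply: hv.
apply/span_cat; exists z, (v - z); split=> //; last by rewrite addrC subrK.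
apply: h; last by rewrite scalerBr e addrAC subrr add0r.
by exists 1; rewrite rmorph1 scale1r addrAC subrr add0r; apply: spanN.
Qed.

(** It turns the length of a basis into a sum over indices: as ps is sorted, the
    vectors that come after v p in the list are those of t and the v q with r p q. *)
Lemma size_basis_of_list_cat (I : eqType) (r : rel I) (v : I -> M) ps t :
  (forall p, ~~ r p p) -> (forall p q, r p q -> ~~ r q p) -> pairwise r ps ->
  (size (basis_of_list ([seq v p | p <- ps] ++ t)) =
   size (basis_of_list t) +
   \sum_(p <- ps)
      ~~ `[< span ([seq v q | q <- ps & r p q] ++ t) (v p) >])%N.
Proof.
move=> irr asym; elim: ps => [|p ps IH] /=; first by rewrite big_nil addn0.
move=> /andP[/allP hp /IH {}IH]; rewrite big_cons (negbTE (irr p)).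
have -> : [seq q <- ps | r p q] = ps by apply/all_filterP/allP.
have -> : \sum_(q <- ps) (~~ `[< span ([seq v q0 | q0 <- (if r q p then
    p :: [seq x <- ps | r q x] else [seq x <- ps | r q x])] ++ t) (v q) >] : nat) =
  \sum_(q <- ps) (~~ `[< span ([seq v q0 | q0 <- ps & r q q0] ++ t) (v q) >] : nat).
  by rewrite !big_seq; apply: eq_bigr => q /hp /asym /negbTE ->.
case: ifP => /asboolP h; first by rewrite IH.
by rewrite /= IH add1n addnS.
Qed.

Definition lin_comb (n : nat) (b : 'I_n -> M) (c : 'rV[K]_n) : M :=
  \sum_(i < n) iota (c 0 i) *: b i.

Lemma span_lin_comb s x :
  span s x -> exists c, x = lin_comb (fun i : 'I_(size s) => s`_i) c.
Proof.
elim: s x => /= [x ->|v s IH x [k /IH[c hc]]].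
  by exists 0; rewrite /lin_comb big_ord0.
exists (\row_(i < (size s).+1) if unlift ord0 i is Some j then c 0 j else k).
rewrite /lin_comb big_ord_recl mxE unlift_none /=.
apply/eqP; rewrite addrC -subr_eq hc; apply/eqP/eq_bigr => i _.
by rewrite mxE liftK.
Qed.

Lemma lin_comb_span s n (b : 'I_n -> M) c :
  (forall i, span s (b i)) -> span s (lin_comb b c).
Proof. by move=> h; apply: span_sum => i _; apply/spanZ/h. Qed.

Lemma lin_combB n (b : 'I_n -> M) c c' :
  lin_comb b (c - c') = lin_comb b c - lin_comb b c'.
Proof.
rewrite /lin_comb -sumrB; apply: eq_bigr => i _.
by rewrite !mxE rmorphB scalerBl.
Qed.

Lemma free_lin_comb s (c : 'rV[K]_(size s)) :
  free_list s -> lin_comb (fun i : 'I_(size s) => s`_i) c = 0 -> c = 0.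
Proof.
elim: s c => [c _ _|v s IH c [hv hs]]; first by apply/rowP => -[].
rewrite /lin_comb big_ord_recl /= => h0.
pose c' := \row_(i < size s) c 0 (lift ord0 i).
have hc' : iota (c 0 ord0) *: v = - lin_comb (fun i : 'I_(size s) => s`_i) c'.
  move/eqP: h0; rewrite addr_eq0 => /eqP ->; congr (- _).
  by apply: eq_bigr => i _; rewrite mxE.
have k0 : c 0 ord0 = 0.
  apply/eqP/negP => /negP k0; apply: hv.
  rewrite -[v]scale1r -(rmorph1 iota) -(mulVf k0) rmorphM -scalerA hc'.
  apply/spanZ/spanN/lin_comb_span => i; exact/span_mem/mem_nth.
have /IH : lin_comb (fun i : 'I_(size s) => s`_i) c' = 0.
  by apply/eqP; rewrite -oppr_eq0 -hc' k0 rmorph0 scale0r.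
move=> /(_ hs) c'0; apply/rowP => i; rewrite mxE.
case: (unliftP ord0 i) => [j ->|->//].
by move/rowP/(_ j): c'0; rewrite !mxE.
Qed.

(** Steinitz: a relation among the rows of the matrix of coordinates would be
    a relation among the vectors. *)
Lemma indep_le_gen m n (b : 'I_n -> M) (b' : 'I_m -> M) :
  (forall i, exists c, b' i = lin_comb b c) ->
  (forall c, lin_comb b' c = 0 -> c = 0) -> (m <= n)%N.
Proof.
move=> /choice[C hC] hfree.
pose B := \matrix_(i < m, j < n) C i 0 j.
have kerB (u : 'rV_m) : u *m B = 0 -> u = 0.
  move=> uB; apply: hfree.
  transitivity (lin_comb b (u *m B)); last first.
    by rewrite uB /lin_comb big1 // => j _; rewrite mxE rmorph0 scale0r.
  rewrite /lin_comb; under eq_bigr do rewrite hC /lin_comb scaler_sumr.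
  rewrite exchange_big; apply: eq_bigr => j _ /=.
  rewrite mxE rmorph_sum scaler_suml; apply: eq_bigr => i _.
  by rewrite mxE rmorphM scalerA.
have : row_free B.
  rewrite -kermx_eq0; apply/eqP/row_matrixP => i; rewrite row0.
  by apply: kerB; apply/sub_kermxP; exact: row_sub.
by rewrite /row_free => /eqP <-; exact: rank_leq_col.
Qed.

Lemma free_le_span s t :
  free_list s -> (forall v, v \in s -> span t v) -> (size s <= size t)%N.
Proof.
move=> hs h; apply: (@indep_le_gen _ _ (fun i : 'I_(size t) => t`_i)
  (fun i : 'I_(size s) => s`_i)) => [i|c].
  exact/span_lin_comb/h/mem_nth.
exact: free_lin_comb.
Qed.

Lemma has_dim_free (V : set M) s :
  free_list s -> (forall x, V x <-> span s x) -> has_dim iota V (size s).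
Proof.
move=> hs hV; exists (fun i : 'I_(size s) => s`_i); split.
  by move=> i; apply/hV/span_mem/mem_nth.
move=> x /hV/span_lin_comb[c hc]; exists c; split=> // c' hc'.
apply/eqP; rewrite -subr_eq0; apply/eqP/(free_lin_comb hs).
by rewrite lin_combB -hc [X in _ - X]/lin_comb -hc' subrr.
Qed.

Lemma dimK_free (V : set M) s :
  free_list s -> (forall x, V x <-> span s x) -> dimK iota V = size s.
Proof.
move=> hs hV; have hd := has_dim_free hs hV.
rewrite /dimK; case: xgetP => [d _ hd'|/(_ _ hd)//].
case: hd hd' => b [hb ub] [b' [hb' ub']].
have V0 : V 0 by apply/hV; exact: span0.
have key m n (f : 'I_n -> M) (f' : 'I_m -> M) :
    (forall x, V x -> exists! c : 'rV_n, x = lin_comb f c) ->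
    (forall x, V x -> exists! c : 'rV_m, x = lin_comb f' c) ->
    (forall i, V (f' i)) -> (m <= n)%N.
  move=> uf uf' hf'; apply: (@indep_le_gen _ _ f f') => [i|c hc].
    by have [c [hc _]] := uf _ (hf' i); exists c.
  have [c0 [_ hc0]] := uf' _ V0.
  rewrite -(hc0 c) // -(hc0 0) //.
  by rewrite /lin_comb big1 // => i _; rewrite mxE rmorph0 scale0r.
apply/eqP; rewrite eqn_leq; apply/andP; split; first exact: (key _ _ b b').
exact: (key _ _ b' b).
Qed.

(** Take a free list of greatest length in the subspace. *)
Lemma subspace_basis (V : set M) t :
  V 0 -> (forall x y, V x -> V y -> V (x + y)) ->
  (forall k x, V x -> V (iota k *: x)) -> (forall x, V x -> span t x) ->
  exists s, free_list s /\ forall x, V x <-> span s x.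
Proof.
move=> V0 VD VZ Vt.
pose P n := `[< exists s, [/\ free_list s, size s = n & forall v, v \in s -> V v] >].
have exP : exists n, P n by exists 0%N; apply/asboolP; exists [::].
have leP n : P n -> (n <= size t)%N.
  move=> /asboolP[s [fs <- hs]]; apply: free_le_span => // v /hs; exact: Vt.
case: (ex_maxnP exP leP) => n /asboolP[s [fs sz hs]] mx.
have spV x : span s x -> V x.
  elim: s hs {fs sz} x => /= [_ x ->//|v s IH hs x [k hk]].
  rewrite -(subrK (iota k *: v) x); apply: VD.
    by apply: IH => // w hw; apply: hs; rewrite inE hw orbT.
  by apply/VZ/hs; rewrite mem_head.
exists s; split=> // x; split=> [Vx|]; last exact: spV.
apply: contrapT => nx; have : P n.+1.
  apply/asboolP; exists (x :: s); split=> //=; first by rewrite sz.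
  by move=> v; rewrite inE => /orP[/eqP->|/hs].
by move/mx; rewrite ltnn.
Qed.

End LinearAlgebra.

(** * Laurent series with integer coefficients *)

Section LaurentSeries.
Implicit Types (F G : int -> int) (a b n : int).

(** The product by 1 - t^c. *)
Definition dif (c : nat) F : int -> int := fun n => F n - F (n - c%:Z).

Lemma dif_laurent c F : is_laurent F -> is_laurent (dif c F).
Proof. by move=> [a ha]; exists a => n hn; rewrite /dif !ha //; lia. Qed.

(** The coefficients of F are determined by recursion from those of (1 - t^c) F,
    starting where both series vanish. *)
Lemma dif_inj c F G : (0 < c)%N -> is_laurent F -> is_laurent G ->
  (forall n, dif c F n = dif c G n) -> forall n, F n = G n.
Proof.
move=> c0 [a ha] [b hb] h n.
suff P m : forall n, (n < m%:Z + Num.min a b) -> F n = G n.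
  by apply: (P `|(n - Num.min a b)%R|%N.+1); lia.
elim: m => [|m IH] {}n hn; first by rewrite ha ?hb //; lia.
have := h n; rewrite /dif (IH (n - c%:Z)); last by lia.
by move/addIr.
Qed.

Lemma laurentB F G : is_laurent F -> is_laurent G ->
  is_laurent (fun n => F n - G n).
Proof.
move=> [a ha] [b hb]; exists (Num.min a b) => n hn.
by rewrite ha ?hb //; lia.
Qed.

(** The infinite sum that defines the product has only finitely many nonzero
    terms, and any longer range may be used in its place. *)
Lemma lmul_range F G a b n N :
  (forall i, i < a -> F i = 0) -> (forall i, i < b -> G i = 0) ->
  n - a - b < N%:Z ->
  lmul F G n = \sum_(k < N) F (a + k%:Z) * G (n - (a + k%:Z)).
Proof.
move=> ha hb hN; pose r := [seq a + k%:Z | k <- iota 0 N].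
rewrite /lmul (@fsbigE _ _ _ _ _ r) /=.
- rewrite -(big_mkord xpredT (fun k => F (a + k%:Z) * G (n - (a + k%:Z)))).
  rewrite /index_iota subn0 big_map; apply: eq_bigl => i.
  by rewrite in_setT.
- by rewrite map_inj_uniq ?iota_uniq // => x y; lia.
- by [].
move=> i _ hi; have [hia|hia] := ltrP i a; first by rewrite ha ?mul0r.
rewrite hb ?mulr0 //; rewrite ltNge; apply/negP => hib.
move/negP: hi; apply; apply/mapP; exists (`|(i - a)%R|%N); last by lia.
by rewrite mem_iota; lia.
Qed.

Lemma lmul_laurent F G : is_laurent F -> is_laurent G -> is_laurent (lmul F G).
Proof.
move=> [a ha] [b hb]; exists (a + b) => n hn.
by rewrite (lmul_range (N := 0) ha hb) ?big_ord0 //; lia.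
Qed.

Lemma lmulC F G n : is_laurent F -> is_laurent G -> lmul F G n = lmul G F n.
Proof.
move=> [a ha] [b hb]; pose N := `|(n - a - b)%R|%N.+1.
have [hn|hn] := ltrP (n - a - b) 0.
  by rewrite (lmul_range (N := 0) ha hb) ?(lmul_range (N := 0) hb ha) ?big_ord0 //; lia.
rewrite (lmul_range (N := N) ha hb) ?(lmul_range (N := N) hb ha); try lia.
rewrite (reindex_inj rev_ord_inj); apply: eq_bigr => k _ /=.
have := ltn_ord k => hk; rewrite mulrC; congr (G _ * F _); lia.
Qed.

Lemma dif_lmulr c F G n : is_laurent F -> is_laurent G ->
  dif c (lmul F G) n = lmul F (dif c G) n.
Proof.
move=> [a ha] [b hb]; rewrite /dif.
pose N := `|(n - a - b)%R|%N.+1.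
rewrite !(lmul_range (N := N) (a := a) (b := b)) //; try lia; last first.
  by move=> i hi; rewrite !hb //; lia.
rewrite -sumrB; apply: eq_bigr => k _; rewrite -mulrBr.
by congr (_ * (_ - G _)); lia.
Qed.

Lemma dif_lmull c F G n : is_laurent F -> is_laurent G ->
  dif c (lmul F G) n = lmul (dif c F) G n.
Proof.
move=> hF hG; have -> : dif c (lmul F G) n = dif c (lmul G F) n.
  by rewrite /dif !(@lmulC F G).
by rewrite dif_lmulr // lmulC //; apply: dif_laurent.
Qed.

Lemma lmulDl F F' G n : is_laurent F -> is_laurent F' -> is_laurent G ->
  lmul (fun m => F m + F' m) G n = lmul F G n + lmul F' G n.
Proof.
move=> [a ha] [a' ha'] [b hb]; pose a0 := Num.min a a'.
pose N := `|(n - a0 - b)%R|%N.+1.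
rewrite !(lmul_range (N := N) (a := a0) (b := b)) //; try lia.
- by rewrite -big_split; apply: eq_bigr => k _; rewrite mulrDl.
- by move=> i hi; apply: ha'; lia.
- by move=> i hi; apply: ha; lia.
- by move=> i hi; rewrite ha ?ha' //; lia.
Qed.

Lemma lmul_ge0 F G n : is_laurent F -> is_laurent G ->
  (forall m, 0 <= F m) -> (forall m, 0 <= G m) -> 0 <= lmul F G n.
Proof.
move=> [a ha] [b hb] F0 G0; pose N := `|(n - a - b)%R|%N.+1.
rewrite (lmul_range (N := N) ha hb); last by lia.
by apply: sumr_ge0 => k _; apply: mulr_ge0.
Qed.

Lemma lmul1 F G n : is_laurent F -> (forall m, G m = (m == 0)%:Z) ->
  lmul F G n = F n.
Proof.
move=> [a ha] hG; have hb i : i < 0 -> G i = 0 by rewrite hG; lia.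
have [hn|hn] := ltrP n a.
  by rewrite ha // (lmul_range (N := 0) ha hb) ?big_ord0 //; lia.
pose k := `|(n - a)%R|%N; rewrite (lmul_range (N := k.+1) ha hb); last by lia.
rewrite big_ord_recr /= big1 ?add0r => [|i _].
  rewrite hG; have -> : a + k%:Z = n by lia.
  by rewrite subrr mulr1.
by have := ltn_ord i => hi; rewrite hG; case: eqP => [|_]; [lia|rewrite mulr0].
Qed.

(** The product by (1 - t^alpha)(1 - t^beta), the inverse of the Hilbert series
    of the polynomial ring. *)
Definition delta (alpha beta : nat) F := dif alpha (dif beta F).

Lemma deltaB al be F G n :
  delta al be (fun m => F m - G m) n = delta al be F n - delta al be G n.
Proof. by rewrite /delta /dif; ring. Qed.

Lemma delta_shiftD al be F G c n :
  delta al be (fun m => F (m - c) + G m) n = delta al be F (n - c) + delta al be G n.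
Proof.
rewrite /delta /dif ![n - _ - c]addrAC [n - al%:Z - be%:Z - c]addrAC.
by rewrite [n - al%:Z - c]addrAC; ring.
Qed.

Lemma delta_inj al be F G : (0 < al)%N -> (0 < be)%N ->
  is_laurent F -> is_laurent G ->
  (forall n, delta al be F n = delta al be G n) -> forall n, F n = G n.
Proof.
move=> a0 b0 hF hG h; apply: (dif_inj b0) => //.
by apply: (dif_inj a0) => //; apply: dif_laurent.
Qed.

Lemma ldiv_ge0_delta al be F G : (0 < al)%N -> (0 < be)%N ->
  is_laurent F -> is_laurent G -> (forall n, delta al be G n = (n == 0)%:Z) ->
  ldiv_ge0 F G <-> forall n, 0 <= delta al be F n.
Proof.
move=> a0 b0 hF hG dG.
have dQ Q n : is_laurent Q -> delta al be (lmul Q G) n = Q n.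
  move=> hQ; rewrite /delta.
  have -> : dif be (lmul Q G) = lmul Q (dif be G).
    by apply: funext => m; apply: dif_lmulr.
  by rewrite dif_lmulr ?lmul1 //; apply: dif_laurent.
split=> [[Q [hQ <- Q0]] n|h]; first by rewrite dQ.
have hd : is_laurent (delta al be F) by do 2!apply: dif_laurent.
exists (delta al be F); split=> //; apply: funext.
by apply: (delta_inj a0 b0) => // [|n]; [exact: lmul_laurent|rewrite dQ].
Qed.

(** If h = f + g then (1 - t^alpha)(1 - t^beta) h G is the sum of
    (f (1 - t^alpha)) (G (1 - t^beta)) and (g (1 - t^beta)) (G (1 - t^alpha)). *)
Lemma delta_lmul_ge0 al be f g G :
  is_laurent f -> is_laurent g -> is_laurent G ->
  (forall n, 0 <= dif al f n) -> (forall n, 0 <= dif be g n) ->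
  (forall n, 0 <= dif al G n) -> (forall n, 0 <= dif be G n) ->
  forall n, 0 <= delta al be (lmul (fun m => f m + g m) G) n.
Proof.
move=> hf hg hG f0 g0 Ga Gb n; rewrite /delta.
have [lf lg] : is_laurent (dif al f) /\ is_laurent (dif be g) by split; exact: dif_laurent.
have [la lb] : is_laurent (dif al G) /\ is_laurent (dif be G) by split; exact: dif_laurent.
have -> : lmul (fun m => f m + g m) G = fun m => lmul f G m + lmul g G m.
  by apply: funext => m; apply: lmulDl.
have -> : dif be (fun m => lmul f G m + lmul g G m) =
          fun m => lmul f (dif be G) m + lmul (dif be g) G m.
  apply: funext => m; rewrite -(@dif_lmulr be f) // -(@dif_lmull be g) //.
  by rewrite /dif; ring.
have -> : dif al (fun m => lmul f (dif be G) m + lmul (dif be g) G m) n =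
          lmul (dif al f) (dif be G) n + lmul (dif be g) (dif al G) n.
  rewrite -(@dif_lmull al f) // -(@dif_lmulr al _ G) //.
  by rewrite /dif; ring.
by apply: addr_ge0; apply: lmul_ge0.
Qed.

End LaurentSeries.

(** * Homogeneous components *)

Section Components.
Variables (A : comNzRingType) (gA : int -> set A) (M : gradedModule gA).
Implicit Types (a b n : int) (z w : M).
Notation pc := (@gmod_pc _ _ M).

Lemma pcD a z w : pc a z -> pc a w -> pc a (z + w).
Proof.
move=> hz hw; rewrite -[w]opprK; apply: gmod_pcB => //.
rewrite -sub0r; apply: gmod_pcB => //; exact: gmod_pc0.
Qed.

Lemma pc_sum a (I : Type) (r : seq I) (P : pred I) (F : I -> M) :
  (forall i, P i -> pc a (F i)) -> pc a (\sum_(i <- r | P i) F i).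
Proof. by move=> h; apply: big_ind => //; [exact: gmod_pc0|exact: pcD]. Qed.

Lemma big_uniq_sub (s t : seq int) (c : int -> M) : uniq s -> uniq t ->
  {subset s <= t} -> (forall a, a \notin s -> c a = 0) ->
  \sum_(a <- t) c a = \sum_(a <- s) c a.
Proof.
move=> us ut st c0; rewrite (bigID (mem s)) /= addrC big1 => [|a /c0 //].
rewrite add0r -big_filter; apply: perm_big; apply: uniq_perm => //.
  exact: filter_uniq.
move=> a; rewrite mem_filter andbC; case: (boolP (a \in t)) => //= ha.
by apply/esym/negP => /st; apply/negP.
Qed.

Definition is_comp (c : int -> M) z := (forall a, pc a (c a)) /\
  exists s, [/\ uniq s, forall a, a \notin s -> c a = 0 & z = \sum_(a <- s) c a].

Lemma comp_ex z : exists c, is_comp c z.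
Proof.
have [s [c [hc ->]]] := gmod_span z.
exists (fun a => \sum_(b <- s | b == a) c b); split=> [a|].
  by apply: pc_sum => b /eqP ->.
exists (undup s); split; first exact: undup_uniq.
  move=> a; rewrite mem_undup => ha; rewrite big_seq_cond big1 // => b.
  by case/andP=> hb /eqP e; rewrite -e hb in ha.
rewrite (exchange_big_dep xpredT) //= [LHS]big_seq [RHS]big_seq.
apply: eq_bigr => b hb; under eq_bigl do rewrite eq_sym.
by rewrite -big_filter filter_pred1_uniq ?undup_uniq ?mem_undup // big_seq1.
Qed.

Lemma comp_unique z c c' : is_comp c z -> is_comp c' z -> c =1 c'.
Proof.
move=> [hc [s [us cs ez]]] [hc' [s' [us' cs' ez']]] a.
pose t := undup (a :: s ++ s').
have ut : uniq t by exact: undup_uniq.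
have h : \sum_(b <- t) (c b - c' b) = 0.
  rewrite sumrB (big_uniq_sub us ut) //; last first.
    by move=> b hb; rewrite mem_undup inE mem_cat hb orbT.
  rewrite (big_uniq_sub us' ut) // -?ez -?ez' ?subrr //.
  by move=> b hb; rewrite mem_undup inE mem_cat hb !orbT.
apply/eqP; rewrite -subr_eq0; apply/eqP.
apply: (gmod_direct ut _ h) => [b|]; first exact: gmod_pcB.
by rewrite mem_undup mem_head.
Qed.

Definition comp a z : M := sval (cid (comp_ex z)) a.

Lemma compP z : is_comp (comp^~ z) z.
Proof. exact: svalP (cid (comp_ex z)). Qed.

Lemma comp_eq z c : is_comp c z -> forall a, comp a z = c a.
Proof. by move=> hc a; apply: (comp_unique (compP z) hc). Qed.

Lemma comp_pc a z : pc a (comp a z).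
Proof. by have [] := compP z. Qed.

Lemma comp_sum z : exists s, z = \sum_(a <- s) comp a z.
Proof. by have [_ [s []]] := compP z; exists s. Qed.

Lemma compD a z w : comp a (z + w) = comp a z + comp a w.
Proof.
apply: (@comp_eq _ (fun a => comp a z + comp a w)); split=> [b|].
  by apply: pcD; exact: comp_pc.
have [_ [s [us cs ez]]] := compP z; have [_ [t [ut ct ew]]] := compP w.
have uu : uniq (undup (s ++ t)) by exact: undup_uniq.
exists (undup (s ++ t)); split=> //.
  by move=> b; rewrite mem_undup mem_cat => /norP[/cs -> /ct ->]; rewrite addr0.
rewrite big_split /= (big_uniq_sub us uu) // ?(big_uniq_sub ut uu) //.
- by rewrite -ez -ew.
- by move=> b; rewrite mem_undup mem_cat orbC => ->.
- by move=> b; rewrite mem_undup mem_cat => ->.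
Qed.

Lemma comp_hom a b z : pc b z -> comp a z = if a == b then z else 0.
Proof.
move=> hz; apply: (@comp_eq _ (fun a => if a == b then z else 0)); split.
  by move=> c; case: eqP => [->//|_]; exact: gmod_pc0.
exists [:: b]; split=> //; last by rewrite big_seq1 eqxx.
by move=> c; rewrite inE => /negbTE ->.
Qed.

Lemma comp0 a : comp a (0 : M) = 0.
Proof. by rewrite (comp_hom a (gmod_pc0 M a)); case: ifP. Qed.

Lemma comp_sumE a (I : Type) (r : seq I) (F : I -> M) :
  comp a (\sum_(i <- r) F i) = \sum_(i <- r) comp a (F i).
Proof. exact: (big_morph (comp a) (compD a) (comp0 a)). Qed.

Lemma comp_scale b f a z : gA b f -> comp (b + a) (f *: z) = f *: comp a z.
Proof.
move=> hf; have [s ez] := comp_sum z.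
rewrite [in LHS]ez [in RHS]ez scaler_sumr !comp_sumE scaler_sumr.
apply: eq_bigr => c _; rewrite (comp_hom _ (gmod_pcZ hf (comp_pc c z))).
rewrite (comp_hom _ (comp_pc c z)) (inj_eq (addrI b)).
by case: ifP => // _; rewrite scaler0.
Qed.

End Components.

(** * Monomials of a given degree *)

Section Monomials.
Variables (al be : nat).
Hypotheses (al0 : (0 < al)%N) (be0 : (0 < be)%N).

(** The solutions (i, j) of al i + be j = m. The order, by increasing i, is the
    monomial order with respect to which standard monomials are taken. *)
Definition monomials (m : int) : seq (nat * nat) :=
  if m is Posz m' then
    [seq (i, (m' - al * i) %/ be)%N |
      i <- iota 0 m'.+1 & (al * i <= m')%N && (be %| m' - al * i)%N]
  else [::].

Lemma mem_monomials m p :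
  (p \in monomials m) = (Posz (al * p.1 + be * p.2)%N == m).
Proof.
case: p m => i j [m|m] //; apply/mapP/idP => [[i']|/eqP[e]].
  rewrite mem_filter => /andP[/andP[h1 h2] _] [-> ->].
  by rewrite /= [(be * _)%N]mulnC divnK // subnKC.
have {}e : (al * i + be * j)%N = m by [].
exists i; first by rewrite mem_filter mem_iota -e leq_addr addKn dvdn_mulr //=; nia.
by rewrite -e addKn mulKn.
Qed.

Lemma monomials_sorted m :
  pairwise (fun p q : nat * nat => (p.1 < q.1)%N) (monomials m).
Proof.
case: m => [m|] //; rewrite /monomials pairwise_map; apply/pairwise_filter.
rewrite -(sorted_pairwise (leT := ltn)); last exact: ltn_trans.
exact: iota_ltn_sorted.
Qed.

Lemma monomials_uniq m : uniq (monomials m).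
Proof.
apply: (pairwise_uniq _ (monomials_sorted m)) => p; exact: ltnn.
Qed.

Definition weight_sum (w : nat * nat -> int) (m : int) : int :=
  \sum_(p <- monomials m) w p.

(** Difference in the first exponent, for the extension of w by 0 outside the
    quadrant: the weight by which 1 - t^alpha acts. *)
Definition difX (w : nat * nat -> int) (p : nat * nat) : int :=
  w p - (if (0 < p.1)%N then w (p.1.-1, p.2) else 0).
Definition difY (w : nat * nat -> int) (p : nat * nat) : int :=
  w p - (if (0 < p.2)%N then w (p.1, p.2.-1) else 0).

Lemma dif_weight_sumX w n : dif al (weight_sum w) n = weight_sum (difX w) n.
Proof.
rewrite /dif /weight_sum /difX sumrB; congr (_ - _).
rewrite -big_mkcond /= -[RHS]big_filter.
transitivity (\sum_(p <- [seq (p.1.+1, p.2) | p <- monomials (n - al%:Z)]) w (p.1.-1, p.2)).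
  by rewrite big_map; apply: eq_bigr => -[].
apply: perm_big.
apply: uniq_perm.
- by rewrite map_inj_uniq ?monomials_uniq // => -[i j] [i' j'] /= [-> ->].
- exact/filter_uniq/monomials_uniq.
move=> [i j]; rewrite mem_filter mem_monomials /=; apply/mapP/idP; last first.
  case/andP=> i0 /eqP e; exists (i.-1, j); last by rewrite /= prednK.
  by rewrite mem_monomials; apply/eqP => /=; nia.
case=> -[i' j']; rewrite mem_monomials => /eqP /= e [-> ->]; apply/andP.
by split=> //; apply/eqP; nia.
Qed.

Lemma dif_weight_sumY w n : dif be (weight_sum w) n = weight_sum (difY w) n.
Proof.
rewrite /dif /weight_sum /difY sumrB; congr (_ - _).
rewrite -big_mkcond /= -[RHS]big_filter.
transitivity (\sum_(p <- [seq (p.1, p.2.+1) | p <- monomials (n - be%:Z)]) w (p.1, p.2.-1)).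
  by rewrite big_map; apply: eq_bigr => -[].
apply: perm_big.
apply: uniq_perm.
- by rewrite map_inj_uniq ?monomials_uniq // => -[i j] [i' j'] /= [-> ->].
- exact/filter_uniq/monomials_uniq.
move=> [i j]; rewrite mem_filter mem_monomials /=; apply/mapP/idP; last first.
  case/andP=> i0 /eqP e; exists (i, j.-1); last by rewrite /= prednK.
  by rewrite mem_monomials; apply/eqP => /=; nia.
case=> -[i' j']; rewrite mem_monomials => /eqP /= e [-> ->]; apply/andP.
by split=> //; apply/eqP; nia.
Qed.

Lemma delta_weight_sum w n :
  delta al be (weight_sum w) n = weight_sum (difX (difY w)) n.
Proof.
rewrite /delta (_ : dif be _ = weight_sum (difY w)); first exact: dif_weight_sumX.
by apply: funext => m; apply: dif_weight_sumY.
Qed.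

(** The second difference of the constant weight 1 on the quadrant is
    concentrated in the origin. *)
Lemma delta_monomials n :
  delta al be (fun m => (size (monomials m))%:Z) n = (n == 0)%:Z.
Proof.
have -> : (fun m => (size (monomials m))%:Z) = weight_sum (fun=> 1).
  by apply: funext => m; rewrite /weight_sum big_const_seq count_predT iter_addr addr0 -natz.
rewrite delta_weight_sum /weight_sum.
rewrite (eq_bigr (fun p => (p == (0, 0)%N)%:Z)); last first.
  by move=> [[|i] [|j]] _; rewrite /difX /difY /=.
case: eqP => [->|n0].
  by rewrite /= sub0n muln0 dvdn0 /= big_seq1 /= div0n.
rewrite big_seq big1 // => p; rewrite mem_monomials => /eqP e.
by case: eqP => // ep; case: n0; rewrite -e ep /= !muln0.
Qed.

Definition down_closed (D : nat * nat -> Prop) :=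
  (forall i j, D (i.+1, j) -> D (i, j)) /\ (forall i j, D (i, j.+1) -> D (i, j)).

Lemma down_closed_le D i j i' j' : down_closed D ->
  (i <= i')%N -> (j <= j')%N -> D (i', j') -> D (i, j).
Proof.
move=> [h1 h2] /subnK <- /subnK <-.
elim: (i' - i)%N => [|k IH]; last by rewrite addSn => /h1.
by rewrite add0n; elim: (j' - j)%N => [|k IH]; rewrite ?addSn // => /h2.
Qed.

(** Among the pairs outside D choose one, (i0, j0), with j0 least: every column
    from i0 on then has height exactly j0. *)
Lemma down_closed_stableX D : down_closed D ->
  exists i0, forall i j, (i0 <= i)%N -> D (i, j) <-> D (i0, j).
Proof.
move=> dD; case: (pselect (exists j, `[< exists i, ~ D (i, j) >])) => [ex|nex].
  case: (ex_minnP ex) => j0 /asboolP[i0 h0] jmin; exists i0 => i j hi.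
  split; first exact: (down_closed_le dD).
  move=> h; apply: contrapT => hij.
  have : (j0 <= j)%N by apply: jmin; apply/asboolP; exists i.
  by move=> hj; apply: h0; apply: (down_closed_le dD (leqnn i0) hj).
have all i j : D (i, j).
  by apply: contrapT => h; apply: nex; exists j; apply/asboolP; exists i.
by exists 0%N.
Qed.

Lemma down_closed_stableY D : down_closed D ->
  exists j0, forall i j, (j0 <= j)%N -> D (i, j) <-> D (i, j0).
Proof.
move=> [h1 h2].
have [|j0 h] := @down_closed_stableX (fun p => D (p.2, p.1)); first by split=> i j /=; auto.
by exists j0 => i j /(h j i).
Qed.

(** The second difference of the indicator function of [D] vanishes outside
    the finite box that is cut out by the two stability bounds. *)
Lemma delta_down_closed D : down_closed D -> exists N : int, forall n, N < n ->
  delta al be (weight_sum (fun p => `[< D p >]%:Z)) n = 0.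
Proof.
move=> dD; have [i0 hi] := down_closed_stableX dD.
have [j0 hj] := down_closed_stableY dD.
exists (al * i0 + be * j0)%N%:Z => n hn; rewrite delta_weight_sum /weight_sum.
rewrite big_seq big1 // => -[i j]; rewrite mem_monomials /= => /eqP e.
have eD p q : (D p <-> D q) -> `[< D p >] = `[< D q >] by exact: asbool_equiv_eq.
case: (ltnP i0 i) => h.
  have eX j' : `[< D (i, j') >] = `[< D (i.-1, j') >].
    by apply/eD/(iff_trans (hi i j' _) (iff_sym (hi i.-1 j' _))); lia.
  have hi0 : (0 < i)%N by lia.
  by rewrite /difX /difY /= hi0 !eX subrr.
have {}h : (j0 < j)%N.
  rewrite ltnNge; apply/negP => hj'.
  have : (al * i + be * j <= al * i0 + be * j0)%N by rewrite leq_add ?leq_mul.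
  by rewrite -lez_nat e; lia.
have eY i' : `[< D (i', j) >] = `[< D (i', j.-1) >].
  by apply/eD/(iff_trans (hj i' j _) (iff_sym (hj i' j.-1 _))); lia.
have hj0 : (0 < j)%N by lia.
by rewrite /difX /difY /= hj0 !eY !subrr if_same.
Qed.

End Monomials.

Arguments monomials : simpl never.

(** * Finitely generated graded modules *)

Section FinGen.
Variables (K : fieldType) (A : comNzRingType) (iota : {rmorphism K -> A}).
Variables (gA : int -> set A) (al be : nat) (x y : A).
Hypotheses (al0 : (0 < al)%N) (be0 : (0 < be)%N).

Definition monomial (p : nat * nat) : A := x ^+ p.1 * y ^+ p.2.

(** The features of K[X, Y] and of its homogeneous quotients on which the
    theory of Hilbert functions rests. *)
Definition monomial_grading : Prop :=
  (forall k p, gA (al * p.1 + be * p.2)%N%:Z (iota k * monomial p)) /\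
  (forall f, exists s : seq (K * (nat * nat)),
     f = \sum_(c <- s) iota c.1 * monomial c.2).

Hypothesis gAP : monomial_grading.
Variable M : gradedModule gA.
Notation pc := (@gmod_pc _ _ M).
Notation span := (span iota).
Implicit Types (n : int) (z : M) (gs : seq (M * int)).

Lemma gA_const k : gA 0 (iota k).
Proof. by have := gAP.1 k (0, 0)%N; rewrite /monomial !muln0 !expr0 !mulr1. Qed.

Lemma gA_x : gA al x.
Proof.
have := gAP.1 1 (1, 0)%N.
by rewrite /monomial /= muln0 muln1 addn0 rmorph1 expr1 expr0 mul1r mulr1.
Qed.

Lemma gA_y : gA be y.
Proof.
have := gAP.1 1 (0, 1)%N.
by rewrite /monomial /= muln0 muln1 add0n rmorph1 expr1 expr0 !mul1r.
Qed.

Lemma pc_iota n k z : pc n z -> pc n (iota k *: z).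
Proof. by move=> hz; have := gmod_pcZ (gA_const k) hz; rewrite add0r. Qed.

Lemma pc_x n z : pc n z -> pc (n + al%:Z) (x *: z).
Proof. by rewrite addrC; apply: gmod_pcZ; exact: gA_x. Qed.

Lemma pc_y n z : pc n z -> pc (n + be%:Z) (y *: z).
Proof. by rewrite addrC; apply: gmod_pcZ; exact: gA_y. Qed.

Lemma pc_span n s z : (forall v, v \in s -> pc n v) -> span s z -> pc n z.
Proof.
elim: s z => [z _ /= ->|v s IH z h /= [k /IH hk]]; first exact: gmod_pc0.
rewrite -(subrK (iota k *: v) z); apply: pcD.
  by apply: hk => w hw; apply: h; rewrite inE hw orbT.
by apply/pc_iota/h; rewrite mem_head.
Qed.

(** Each element of gs comes with its degree, which the element 0 would not
    determine. *)
Fixpoint monomial_multiples n gs : seq M :=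
  if gs is e :: gs' then
    [seq monomial p *: e.1 | p <- monomials al be (n - e.2)] ++
    monomial_multiples n gs'
  else [::].

Definition homogeneous gs := forall e : M * int, e \in gs -> pc e.2 e.1.

Lemma mem_monomial_multiples n gs (e : M * int) p : e \in gs ->
  (al * p.1 + be * p.2)%N%:Z + e.2 = n -> monomial p *: e.1 \in monomial_multiples n gs.
Proof.
elim: gs => //= e' gs IH; rewrite inE => /orP[/eqP <-|he] h; rewrite mem_cat.
  apply/orP; left; apply/mapP; exists p => //.
  by rewrite mem_monomials // -h addrK.
by rewrite IH ?orbT.
Qed.

Lemma monomial_multiplesP n gs v : v \in monomial_multiples n gs ->
  exists (e : M * int) (p : nat * nat), [/\ e \in gs, (al * p.1 + be * p.2)%N%:Z + e.2 = n & v = monomial p *: e.1].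
Proof.
elim: gs => //= e gs IH; rewrite mem_cat => /orP[/mapP[p hp ->]|].
  exists e, p; split=> //; first exact: mem_head.
  by move: hp; rewrite mem_monomials // => /eqP ->; rewrite subrK.
by case/IH => e' [p [he h ->]]; exists e', p; rewrite inE he orbT.
Qed.

Lemma monomial_multiples_pc n gs v : homogeneous gs ->
  v \in monomial_multiples n gs -> pc n v.
Proof.
move=> hgs /monomial_multiplesP[e [p [/hgs he <- ->]]].
by apply: gmod_pcZ => //; have := gAP.1 1 p; rewrite rmorph1 mul1r.
Qed.

Lemma monomial_multiples_x n gs z : span (monomial_multiples n gs) z ->
  span (monomial_multiples (n + al%:Z) gs) (x *: z).
Proof.
apply: span_scale => v /monomial_multiplesP[e [p [he h ->]]].
rewrite scalerA mulrA -exprS -[_ * _]/(monomial (p.1.+1, p.2)).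
by apply/span_mem/mem_monomial_multiples => //=; rewrite -h mulnS; lia.
Qed.

Lemma monomial_multiples_y n gs z : span (monomial_multiples n gs) z ->
  span (monomial_multiples (n + be%:Z) gs) (y *: z).
Proof.
apply: span_scale => v /monomial_multiplesP[e [p [he h ->]]].
rewrite scalerA mulrCA -exprS -[_ * _]/(monomial (p.1, p.2.+1)).
by apply/span_mem/mem_monomial_multiples => //=; rewrite -h mulnS; lia.
Qed.

Lemma comp_monomial_multiples n gs (e : M * int) f : homogeneous gs -> e \in gs ->
  span (monomial_multiples n gs) (comp n (f *: e.1)).
Proof.
move=> hgs he; have [s ->] := gAP.2 f; rewrite scaler_suml comp_sumE.
apply: span_sum => -[k p] _ /=.
rewrite (comp_hom _ (gmod_pcZ (gAP.1 k p) (hgs _ he))).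
case: eqP => [e'|_]; last exact: span0.
by rewrite -scalerA; apply/spanZ/span_mem/mem_monomial_multiples.
Qed.

(** The homogeneous components of a finite system of generators. *)
Lemma homogeneous_generators : fin_gen M -> exists gs, homogeneous gs /\
  forall n z, pc n z <-> span (monomial_multiples n gs) z.
Proof.
move=> [m [g gP]]; have [s hs] := choice (fun i => comp_sum (g i)).
pose gs : seq (M * int) := flatten [seq [seq (comp a (g i), a) | a <- s i] | i <- enum 'I_m].
have hgs : homogeneous gs.
  by move=> e /flatten_mapP[i _ /mapP[a _ ->]]; exact: comp_pc.
exists gs; split=> // n z; split; last first.
  by apply: pc_span => v; exact: monomial_multiples_pc.
move=> hz; have [c ez] := gP z.
have -> : z = comp n z by rewrite (comp_hom _ hz) eqxx.
rewrite ez comp_sumE; apply: span_sum => i _.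
rewrite hs scaler_sumr comp_sumE big_seq; apply: span_sum => a ha.
apply: (comp_monomial_multiples _ _ (e := (comp a (g i), a)) hgs).
apply/flatten_mapP; exists i; first by rewrite mem_enum.
by apply/mapP; exists a.
Qed.

Lemma fin_gen_basis n : fin_gen M -> exists s,
  free_list iota s /\ forall z, pc n z <-> span s z.
Proof.
case/homogeneous_generators => gs [_ h].
exists (basis_of_list iota (monomial_multiples n gs)).
split; first exact: free_basis_of_list.
by move=> z; rewrite h; split=> /span_basis_of_list.
Qed.

Lemma hilb_basis n s : free_list iota s -> (forall z, pc n z <-> span s z) ->
  hilb iota pc n = (size s)%:Z.
Proof. by move=> fs hs; rewrite /hilb (dimK_free fs hs). Qed.

Lemma hilb_generators gs n : (forall n z, pc n z <-> span (monomial_multiples n gs) z) ->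
  hilb iota pc n = (size (basis_of_list iota (monomial_multiples n gs)))%:Z.
Proof.
move=> h; apply: hilb_basis; first exact: free_basis_of_list.
by move=> z; rewrite h; split=> /span_basis_of_list.
Qed.

Lemma monomial_multiples_laurent gs :
  exists b : int, forall n, n < b -> monomial_multiples n gs = [::].
Proof.
elim: gs => [|e gs [b IH]]; first by exists 0.
exists (Num.min b e.2) => n hn /=; rewrite IH; last by lia.
by have : n - e.2 < 0 by [lia]; case: (n - e.2).
Qed.

Lemma fin_gen_laurent : fin_gen M -> exists b : int, forall n, n < b ->
  forall z, pc n z -> z = 0.
Proof.
case/homogeneous_generators => gs [_ h].
have [b hb] := monomial_multiples_laurent gs.
by exists b => n /hb e z /h; rewrite e.
Qed.

Lemma hilb_laurent : fin_gen M -> is_laurent (hilb iota pc).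
Proof.
case/homogeneous_generators => gs [_ h].
have [b hb] := monomial_multiples_laurent gs.
by exists b => n /hb e; rewrite (hilb_generators n h) e.
Qed.

(** The exponents of the standard monomials of the generator e: a monomial comes
    later if it has a larger exponent of x or belongs to a generator further down
    the list. *)
Definition standard (e : M * int) gs (p : nat * nat) : Prop :=
  let d := (al * p.1 + be * p.2)%N%:Z in
  ~ span ([seq monomial q *: e.1 | q <- monomials al be d & (p.1 < q.1)%N] ++
          monomial_multiples (d + e.2) gs) (monomial p *: e.1).

(** A combination of later monomials remains one after multiplication by x or y,
    so the multiples of a nonstandard monomial are nonstandard. *)
Lemma standard_down e gs : down_closed (standard e gs).
Proof.
split=> i j; rewrite /standard /= => h h'; apply: h.
- have e1 : (al * i.+1 + be * j)%N%:Z = (al * i + be * j)%N%:Z + al%:Z.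
    by rewrite mulnS; lia.
  have -> : monomial (i.+1, j) *: e.1 = x *: (monomial (i, j) *: e.1).
    by rewrite scalerA mulrA -exprS.
  apply: span_scale h' => v; rewrite mem_cat => /orP[/mapP[q]|hv].
    rewrite mem_filter mem_monomials //= => /andP[hi /eqP hq] ->.
    rewrite scalerA mulrA -exprS -[_ * _]/(monomial (q.1.+1, q.2)).
    apply/span_mem; rewrite mem_cat; apply/orP; left; apply/mapP.
    exists (q.1.+1, q.2) => //; rewrite mem_filter mem_monomials //=.
    by rewrite ltnS hi; apply/eqP; rewrite e1 -hq mulnS; lia.
  apply: (span_sub (s := monomial_multiples ((al * i + be * j)%N%:Z + e.2 + al%:Z) gs)).
    by move=> w hw; rewrite mem_cat /= e1 addrAC hw orbT.
  exact/monomial_multiples_x/span_mem.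
have e1 : (al * i + be * j.+1)%N%:Z = (al * i + be * j)%N%:Z + be%:Z.
  by rewrite mulnS; lia.
have -> : monomial (i, j.+1) *: e.1 = y *: (monomial (i, j) *: e.1).
  by rewrite scalerA mulrCA -exprS.
apply: span_scale h' => v; rewrite mem_cat => /orP[/mapP[q]|hv].
  rewrite mem_filter mem_monomials //= => /andP[hi /eqP hq] ->.
  rewrite scalerA mulrCA -exprS -[_ * _]/(monomial (q.1, q.2.+1)).
  apply/span_mem; rewrite mem_cat; apply/orP; left; apply/mapP.
  exists (q.1, q.2.+1) => //; rewrite mem_filter mem_monomials //=.
  by rewrite hi; apply/eqP; rewrite e1 -hq mulnS; lia.
apply: (span_sub (s := monomial_multiples ((al * i + be * j)%N%:Z + e.2 + be%:Z) gs)).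
  by move=> w hw; rewrite mem_cat /= e1 addrAC hw orbT.
exact/monomial_multiples_y/span_mem.
Qed.

Lemma size_basis_monomial_multiples e gs n :
  (size (basis_of_list iota (monomial_multiples n (e :: gs))))%:Z =
  weight_sum al be (fun p => `[< standard e gs p >]%:Z) (n - e.2) +
  (size (basis_of_list iota (monomial_multiples n gs)))%:Z.
Proof.
rewrite /= (@size_basis_of_list_cat _ _ iota _ _ (fun p q : nat * nat => (p.1 < q.1)%N)).
- rewrite PoszD addrC; congr (_ + _).
  rewrite /weight_sum (big_morph Posz PoszD (erefl _)) [LHS]big_seq [RHS]big_seq.
  apply: eq_bigr => p; rewrite mem_monomials // => /eqP hp.
  by rewrite /standard hp subrK asbool_neg.
- by move=> p; rewrite ltnn.
- by move=> p q h; rewrite -leqNgt ltnW.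
exact: monomials_sorted.
Qed.

(** The Hilbert series is a sum, over the homogeneous generators, of shifted
    generating functions of their down-closed sets of standard monomials. *)
Lemma delta_hilb_finite : fin_gen M -> exists N : int, forall n, N < n ->
  delta al be (hilb iota pc) n = 0.
Proof.
case/homogeneous_generators => gs [_ h].
have -> : hilb iota pc =
    fun n => (size (basis_of_list iota (monomial_multiples n gs)))%:Z.
  by apply: funext => n; apply: hilb_generators.
elim: gs {h} => [|e gs [N IH]]; first by exists 0 => n _; rewrite /delta /dif /= !subrr.
have [N' hN'] := delta_down_closed al0 be0 (standard_down e gs).
exists (Num.max N (N' + e.2)) => n hn.
under eq_fun do rewrite size_basis_monomial_multiples.
by rewrite delta_shiftD IH ?hN' //; lia.
Qed.

End FinGen.

(** * The polynomial ring in two variables and its quotient *)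

Section PolyRing.
Variables (K : fieldType) (al be : nat).
Hypotheses (al0 : (0 < al)%N) (be0 : (0 < be)%N).
Notation R := (polyR K).
Notation S := (cuspS K al be).

Fact iotaR_zmod : zmod_morphism (@iotaR K).
Proof. by move=> k l; rewrite /iotaR !rmorphB. Qed.
Fact iotaR_monoid : monoid_morphism (@iotaR K).
Proof. by split=> [|k l]; rewrite /iotaR ?rmorphM. Qed.
HB.instance Definition _ := GRing.isZmodMorphism.Build K R (@iotaR K) iotaR_zmod.
HB.instance Definition _ := GRing.isMonoidMorphism.Build K R (@iotaR K) iotaR_monoid.

Fact toS_zmod : zmod_morphism (@toS K al be).
Proof. by move=> f g; rewrite /toS rmorphB. Qed.
Fact toS_monoid : monoid_morphism (@toS K al be).
Proof. by split=> [|f g]; rewrite /toS ?rmorph1 ?rmorphM. Qed.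
HB.instance Definition _ := GRing.isZmodMorphism.Build R S (@toS K al be) toS_zmod.
HB.instance Definition _ := GRing.isMonoidMorphism.Build R S (@toS K al be) toS_monoid.
HB.instance Definition _ := GRing.RMorphism.copy (@iotaS K al be) (@toS K al be \o @iotaR K).

Lemma toS_surj (s : S) : exists f, s = toS al be f.
Proof. by exists (repr s); rewrite /toS reprK. Qed.

Lemma toS_eq0 (f : R) : toS al be f = 0 <-> exists g : R, f = g * cusp K al be.
Proof.
have -> : toS al be f = 0 <-> f \in (cusp_ideal al be : {pred R}).
  rewrite -(rmorph0 (toS al be)) /toS.
  split=> [/eqP|h]; first by rewrite -Quotient.idealrBE subr0.
  by apply/eqP; rewrite -Quotient.idealrBE subr0.
by split=> [/asboolP|h]; last exact/asboolP.
Qed.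

Definition varX : R := ('X : {poly {poly K}}).
Definition varY : R := ('Y : {poly {poly K}}).

Lemma coef_monomial (k : K) p i j :
  (iotaR k * monomial varX varY p : {poly {poly K}})`_i`_j =
  k *+ ((i == p.1) && (j == p.2)).
Proof.
rewrite /iotaR /monomial /varX /varY coefCM coefCM -mulnb mulrnA.
rewrite -rmorphXn /= coefMC coefXn; case: (i == p.1).
  by rewrite mul1r coefXn; case: (j == p.2); rewrite ?mulr1 ?mulr0.
by rewrite mul0r coef0 mulr0 !mul0rn.
Qed.

Lemma polyR_monomials (f : R) : f = \sum_(c <- [seq ((f : {poly {poly K}})`_i`_j, (i, j)) |
   i <- iota 0 (size (f : {poly {poly K}})),
   j <- iota 0 (size (f : {poly {poly K}})`_i)]) iotaR c.1 * monomial varX varY c.2.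
Proof.
rewrite big_allpairs_dep /=; set g : {poly {poly K}} := f.
rewrite -[LHS](coefK g) poly_def -(big_mkord xpredT (fun i => g`_i *: 'X^i)).
rewrite /index_iota subn0; apply: eq_bigr => i _.
rewrite -[X in X *: _](coefK (g`_i)) poly_def -(big_mkord xpredT (fun j => g`_i`_j *: 'X^j)).
rewrite /index_iota subn0 scaler_suml; apply: eq_bigr => j _.
by rewrite /monomial /varX /varY /= /iotaR -!mul_polyC rmorphM /= rmorphXn /= -mulrA [_ * 'X^i]mulrC.
Qed.

Lemma monomial_gradingR : monomial_grading (@iotaR K) (@pcR K al be) al be varX varY.
Proof.
split=> [k p i j|f]; last first.
  by eexists; exact: polyR_monomials.
rewrite coef_monomial; case: (i =P p.1) => [->|_]; last by rewrite eqxx.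
by case: (j =P p.2) => [->|_]; last by rewrite eqxx.
Qed.

Lemma monomial_gradingS : monomial_grading (@iotaS K al be) (@pcS K al be) al be
  (toS al be varX) (toS al be varY).
Proof.
have [h1 h2] := monomial_gradingR.
have e p : monomial (toS al be varX) (toS al be varY) p = toS al be (monomial varX varY p).
  by rewrite /monomial rmorphM !rmorphXn.
split=> [k p|f]; first by
  rewrite e; exists (iotaR k * monomial varX varY p); [exact: h1|exact: rmorphM].
have [g ->] := toS_surj f; have [s ->] := h2 g; exists s.
by rewrite rmorph_sum; apply: eq_bigr => c _; rewrite rmorphM e.
Qed.

(** The constant coefficient of c is regular, so X divides g. *)
Lemma dvd_cancelX (c f g : {poly {poly K}}) : c`_0 != 0 -> 'X * f = g * c ->
  exists g', f = g' * c.
Proof.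
move=> c0 e; have /factor_theorem[q eq] : root g 0.
  rewrite rootE horner_coef0; have /(congr1 (fun p : {poly _} => p`_0)) := e.
  rewrite mulrC coefMX coef0M /= => /esym/eqP.
  by rewrite mulf_eq0 (negbTE c0) orbF.
exists q; apply: (@mulfI _ 'X); first by rewrite polyX_eq0.
by rewrite e eq subr0 mulrA [q * 'X]mulrC.
Qed.

Lemma toS_X_reg (z : S) : toS al be varX * z = 0 -> z = 0.
Proof.
have [f ->] := toS_surj z; rewrite -rmorphM => /toS_eq0[g e].
apply/toS_eq0; apply: (dvd_cancelX _ e).
rewrite coefB coefXn (ltn_eqF be0) -rmorphXn /= coefC /= sub0r oppr_eq0.
by rewrite expf_neq0 ?polyX_eq0.
Qed.

(** Exchanging the two variables reduces this to the argument for X. *)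
Lemma toS_Y_reg (z : S) : toS al be varY * z = 0 -> z = 0.
Proof.
have [f ->] := toS_surj z; rewrite -rmorphM => /toS_eq0[g e].
apply/toS_eq0; have [||h eh] := @dvd_cancelX (swapXY (cusp K al be)) (swapXY f) (swapXY g).
- rewrite rmorphB !rmorphXn /= swapXY_X swapXY_Y coefB coefXn (ltn_eqF al0).
  by rewrite -rmorphXn /= coefC /= subr0 expf_neq0 ?polyX_eq0.
- by rewrite -rmorphM -e rmorphM /= swapXY_Y.
by exists (swapXY h); apply: (can_inj (@swapXYK K)); rewrite rmorphM /= swapXYK.
Qed.

Lemma span_monomials_coef ps (f : R^o) p :
  span (@iotaR K) [seq monomial varX varY q : R^o | q <- ps] f -> p \notin ps ->
  (f : {poly {poly K}})`_p.1`_p.2 = 0.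
Proof.
elim: ps f => [f /= -> _|q ps IH f /= [k /IH h]]; first by rewrite !coef0.
rewrite inE => /norP[pq /h].
rewrite coefB coefB -[_ *: _]/(iotaR k * monomial varX varY q) coef_monomial.
by rewrite -xpair_eqE -!surjective_pairing (negbTE pq) subr0.
Qed.

Lemma free_monomials ps : uniq ps ->
  free_list (@iotaR K) [seq monomial varX varY q : R^o | q <- ps].
Proof.
elim: ps => //= p ps IH /andP[hp /IH]; split=> // h.
have := coef_monomial 1 p p.1 p.2.
rewrite (rmorph1 (@iotaR K)) mul1r (span_monomials_coef h hp) !eqxx => /eqP.
by rewrite eq_sym oner_eq0.
Qed.

Lemma pcR_span n (f : R^o) : @pcR K al be n f <->
  span (@iotaR K) [seq monomial varX varY q : R^o | q <- monomials al be n] f.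
Proof.
split=> [hf|h i j hij]; last first.
  have : (i, j) \in monomials al be n.
    by apply/negP => /negP /(span_monomials_coef h) /= e; rewrite e eqxx in hij.
  by rewrite mem_monomials // => /eqP.
rewrite [f]polyR_monomials big_seq; apply: span_sum => c /allpairsPdep[i [j [_ _ ->]]] /=.
case: (eqVneq (f : {poly {poly K}})`_i`_j 0) => [->|hij].
  by rewrite rmorph0 mul0r; exact: span0.
apply: (spanZ (M := R^o)); apply: span_mem; apply/mapP; exists (i, j) => //.
by rewrite mem_monomials //=; apply/eqP/hf.
Qed.

Lemma hilb_polyRE n : hilb_polyR K al be n = (size (monomials al be n))%:Z.
Proof.
rewrite /hilb_polyR /hilb; congr Posz.
rewrite -(size_map (fun q => monomial varX varY q : R^o)).
by apply: dimK_free; [exact/free_monomials/monomials_uniq|exact: pcR_span].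
Qed.

Lemma delta_hilb_polyR n : delta al be (hilb_polyR K al be) n = (n == 0)%:Z.
Proof. by rewrite -(delta_monomials al0 be0); congr delta; apply: funext => m; apply: hilb_polyRE. Qed.

Lemma hilb_polyR_laurent : is_laurent (hilb_polyR K al be).
Proof. by exists 0 => n hn; rewrite hilb_polyRE; case: n hn. Qed.

End PolyRing.

(** * Positive depth *)

(** A set of extended integers that has a finite upper bound and a finite element
    has a greatest element, so the supremum is attained or infinite. *)
Lemma supremum_gt0 (S : set (\bar int)) :
  (0 < supremum -oo S)%E <-> exists d, S d /\ (0 < d)%E.
Proof.
split=> [|[d [Sd d0]]].
  rewrite /supremum; case: ifP => // _; case: xgetP => // m -> [_ lb] m0.
  apply: contrapT => h; have /lb : ubound S 0%E.
    by move=> d Sd; rewrite leNgt; apply/negP => d0; apply: h; exists d.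
  by rewrite leNgt m0.
suff [m hm] : exists m, supremums S m.
  have := @ge_supremum_Nmem _ _ (-oo%E) S d (ex_intro _ m hm) Sd.
  exact: lt_le_trans.
case: (pselect (exists b : int, forall d, S d -> (d <= b%:E)%E)) => [[b hb]|nb].
  pose P k := `[< S (b - k%:Z)%:E >].
  have [k0 dk] : exists k : nat, d = (b - k%:Z)%:E.
    move: d0 (hb _ Sd); case: d {Sd} => [d _|_|]; [|by rewrite leye_eq|by rewrite ltNge leNye].
    rewrite lee_fin => h; by exists `|(b - d)%R|%N; congr EFin; lia.
  have exP : exists k, P k by exists k0; apply/asboolP; rewrite -dk.
  case: (ex_minnP exP) => k /asboolP Sk kmin; exists (b - k%:Z)%:E; split.
    move=> e Se; case: e Se (hb _ Se) => [e Se|_|_ _]; [|by rewrite leye_eq|exact: leNye].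
    rewrite !lee_fin => h.
    have : (k <= `|(b - e)%R|)%N; last by lia.
    apply: kmin; apply/asboolP; congr (S _): Se; congr EFin; lia.
  by move=> u; apply.
exists +oo%E; split=> [e _|u hu]; first exact: leey.
case: u hu => [u hu|_|hu]; [by case: nb; exists u|exact: leey|].
by have := hu _ Sd; rewrite leNgt (lt_trans _ d0).
Qed.

Section Depth.
Variables (A : comNzRingType) (M : lmodType A).

Lemma smul_nil (x : M) : smul [set` [::]] x <-> x = 0.
Proof.
split=> [[n [f [y [h ->]]]]|->]; first by rewrite big1 // => i _; have := h i.
by exists 0%N, (fun=> 0), (fun=> 0); split=> [[]|] //; rewrite big_ord0.
Qed.

Lemma smul_subset (F G : set A) (x : M) :
  (forall f, F f -> G f) -> smul F x -> smul G x.
Proof. by move=> FG [n [f [y [h ->]]]]; exists n, f, y; split=> // i; apply/FG/h. Qed.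

(** The first element of a regular sequence acts injectively; the alternative
    I M = M corresponds to infinite depth. *)
Lemma depth_gt0 (I : set A) : (0 < depth I M)%E <->
  @smul _ I M = setT \/ exists2 f, I f & forall x : M, f *: x = 0 -> x = 0.
Proof.
rewrite /depth; case: ifP => /asboolP hI; first by split=> // _; left.
rewrite supremum_gt0; split.
  move=> [d [[[|f s] [sI [reg _] ->]]]] // _; right; exists f.
    by apply: sI; rewrite mem_head.
  move=> x fx; have /= := reg 0%N isT x.
  by rewrite fx => h; apply/smul_nil/h/smul_nil.
case=> // -[f If hf]; exists 1%E; split=> //.
exists [:: f]; split=> //; first by move=> g; rewrite inE => /eqP ->.
split=> [[|k] //= _ x /smul_nil/hf ->|h]; first exact/smul_nil.
apply: hI; rewrite -subTset -h => x; apply: smul_subset => g /=.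
by rewrite inE => /eqP ->.
Qed.

End Depth.

Section PolyDepth.
Variables (K : fieldType) (al be : nat).
Hypotheses (al0 : (0 < al)%N) (be0 : (0 < be)%N).
Notation X := (varX K).
Notation Y := (varY K).

Lemma smul_maxXY (M : lmodType (polyR K)) (x : M) : smul (@maxXY K) x ->
  exists u w, x = X *: u + Y *: w.
Proof.
have add0 (I : Type) (r : seq I) (F : I -> M) :
    (forall i, exists u w, F i = X *: u + Y *: w) ->
    exists u w, \sum_(i <- r) F i = X *: u + Y *: w.
  move=> h; apply: (big_ind (fun z => exists u w, z = X *: u + Y *: w)) => //.
    by exists 0, 0; rewrite !scaler0 addr0.
  move=> _ _ [u [w ->]] [u' [w' ->]]; exists (u + u'), (w + w').
  by rewrite !scalerDr addrACA.
case=> n [f [y [hf ->]]]; apply: (add0 _ _ (fun i => f i *: y i)) => i.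
have [m [g [h [hg ->]]]] := hf i; rewrite scaler_suml; apply: (add0 _ _ (fun j => (g j *: h j) *: y i)) => j.
have -> : (g j *: h j) *: y i = g j *: (h j *: y i) by rewrite scalerA.
by case: (hg j) => ->; [exists (h j *: y i), 0|exists 0, (h j *: y i)];
  rewrite scaler0 ?addr0 ?add0r.
Qed.

(** Graded Nakayama, by induction on the degree: z = X u + Y w depends only on
    components of u and w of lower degree than z. *)
Lemma smul_maxXY_full (M : gmodR K al be) : fin_gen M ->
  @smul _ (@maxXY K) M = setT -> forall x : M, x = 0.
Proof.
move=> fg hT.
have [b hb] := fin_gen_laurent al0 be0 (monomial_gradingR K al be) fg.
suff P m : forall n z, n < b + m%:Z -> @gmod_pc _ _ M n z -> z = 0.
  move=> x; have [s ->] := comp_sum x; rewrite big1 // => a _.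
  by apply: (P `|(a - b)%R|.+1%N a) (comp_pc _ _); lia.
elim: m => [|m IH] n z hn hz; first by apply: hb hz; lia.
have [|u [w ez]] := @smul_maxXY M z; first by rewrite hT.
have -> : z = comp n z by rewrite (comp_hom _ hz) eqxx.
have gX := gA_x (monomial_gradingR K al be).
have gY := gA_y (monomial_gradingR K al be).
have := comp_scale (n - al%:Z) u gX; have := comp_scale (n - be%:Z) w gY.
rewrite ![_ + (n - _)]addrC !subrK ez compD => -> ->.
rewrite (IH _ _ _ (comp_pc (n - al%:Z) u)) ?(IH _ _ _ (comp_pc (n - be%:Z) w)); try lia.
by rewrite !scaler0 addr0.
Qed.

Lemma maxXY_X : @maxXY K X.
Proof.
exists 1%N, (fun=> X), (fun=> 1); split; first by left.
by rewrite big_ord1 /GRing.scale /= mulr1.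
Qed.

Lemma depth_maxXY_inj (M : gmodR K al be) : fin_gen M ->
  (0 < depth (@maxXY K) M)%E ->
  forall x : M, X *: x = 0 -> Y *: x = 0 -> x = 0.
Proof.
move=> fg /depth_gt0[hT x _ _|[f If hf] x Xx Yx]; first exact: smul_maxXY_full.
apply: hf; have : @smul _ (@maxXY K) (polyR K)^o f.
  exists 1%N, (fun=> f), (fun=> 1); split=> //.
  by rewrite big_ord1 /GRing.scale /= mulr1.
case/smul_maxXY => u [w ->].
rewrite scalerDl -[X *: u]/(X * u) -[Y *: w]/(Y * w).
by rewrite [X * u]mulrC [Y * w]mulrC -!scalerA Xx Yx !scaler0 addr0.
Qed.

Lemma maxXY_XY : @maxXY K (X + Y).
Proof.
have [n [f [g [hf e]]]] := maxXY_X.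
exists 2%N, (fun i => if i == ord0 then X else Y), (fun=> 1); split.
  by move=> i; case: ifP => _; [left|right].
by rewrite !big_ord_recl big_ord0 /= /GRing.scale /= !mulr1 addr0.
Qed.

End PolyDepth.

Section Split.
Variables (K : fieldType) (A : comNzRingType) (iota : {rmorphism K -> A}).
Variables (gA : int -> set A) (al be : nat) (x y : A).
Hypotheses (al0 : (0 < al)%N) (be0 : (0 < be)%N).
Hypothesis gAP : monomial_grading iota gA al be x y.
Variable M : gradedModule gA.
Hypothesis fgM : fin_gen M.
Notation pc := (@gmod_pc _ _ M).
Notation span := (span iota).
Notation hilbM := (hilb iota pc).

(** The inequality dim (M_m / V) <= dim (M_n / W), as multiplication by f maps
    M_m to M_n and the preimage of W is contained in V: the image of a complement
    of V remains free beside a basis of W. *)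
Lemma dim_scale_le m n (V W : set M) f :
  (forall z, V z -> pc m z) -> (forall z, W z -> pc n z) ->
  V 0 -> (forall z w, V z -> V w -> V (z + w)) ->
  (forall k z, V z -> V (iota k *: z)) ->
  W 0 -> (forall z w, W z -> W w -> W (z + w)) ->
  (forall k z, W z -> W (iota k *: z)) ->
  (forall z, pc m z -> pc n (f *: z)) ->
  (forall z, pc m z -> W (f *: z) -> V z) ->
  hilbM m - hilb iota (fun=> V) 0 <= hilbM n - hilb iota (fun=> W) 0.
Proof.
move=> Vm Wn V0 VD VZ W0 WD WZ fmn fWV.
have [s [fs hs]] := fin_gen_basis al0 be0 gAP m fgM.
have [t [ft ht]] := fin_gen_basis al0 be0 gAP n fgM.
have [v [fv hv]] : exists v, free_list iota v /\ forall z, V z <-> span v z.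
  by apply: (subspace_basis (t := s)) => // z /Vm/hs.
have [w [fw hw]] : exists w, free_list iota w /\ forall z, W z <-> span w z.
  by apply: (subspace_basis (t := t)) => // z /Wn/ht.
have [s' [fs' hs']] := free_extend s fv.
have hm z : pc m z <-> span (s' ++ v) z.
  rewrite hs' hs; split=> [h|].
    by apply: span_sub h => u hu; rewrite mem_cat hu.
  by apply: span_trans => u; rewrite mem_cat => /orP[/span_mem//|/span_mem/hv/Vm/hs].
rewrite (hilb_basis fs' hm) (hilb_basis ft ht) /hilb (dimK_free fv hv) (dimK_free fw hw).
have h : (size s' + size w <= size t)%N.
  rewrite -(size_map (fun z : M => f *: z) s') -size_cat.
  apply: (@free_le_span _ _ iota).
    apply: (free_scale_cat (t := v)) => // z hz /hw; rewrite -hv; apply: fWV.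
    by apply/hm/span_cat; exists z, 0; split=> //; rewrite ?addr0 //; exact: span0.
  move=> u; rewrite mem_cat => /orP[/mapP[z hz ->]|hu]; apply/ht.
    by apply/fmn/hm/span_mem; rewrite mem_cat hz.
  exact/Wn/hw/span_mem.
by rewrite size_cat; lia.
Qed.

Lemma hilb_zero : hilb iota (fun _ : int => [set (0 : M)]%classic) 0 = 0.
Proof.
by rewrite /hilb (@dimK_free _ _ iota _ _ [::]).
Qed.

Lemma dif_hilb_ge0 f (c : nat) : gA c%:Z f -> (forall z : M, f *: z = 0 -> z = 0) ->
  forall n, 0 <= dif c hilbM n.
Proof.
move=> hf reg n; rewrite /dif subr_ge0.
have := @dim_scale_le (n - c%:Z) n [set 0]%classic [set 0]%classic f.
rewrite hilb_zero !subr0; apply=> //.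
- by move=> z ->; exact: gmod_pc0.
- by move=> z ->; exact: gmod_pc0.
- by move=> z w -> ->; rewrite addr0.
- by move=> k z ->; rewrite scaler0.
- by move=> z w -> ->; rewrite addr0.
- by move=> k z ->; rewrite scaler0.
- by move=> z hz; have := gmod_pcZ hf hz; rewrite addrC subrK.
by move=> z _ /reg.
Qed.

(** Split off the y-torsion T of the module: no element is killed by x and y,
    so x is injective on T, while y is injective modulo T. *)
Lemma hilb_split :
  (forall z : M, x *: z = 0 -> y *: z = 0 -> z = 0) ->
  exists f g, [/\ is_laurent f, is_laurent g, hilbM = fun n => f n + g n,
    forall n, 0 <= dif al f n & forall n, 0 <= dif be g n].
Proof.
move=> reg.
pose T n : set M := [set z | pc n z /\ exists k, y ^+ k *: z = 0]%classic.
have T0 n : T n 0 by split; [exact: gmod_pc0|exists 0%N; rewrite scaler0].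
have TD n z w : T n z -> T n w -> T n (z + w).
  move=> [hz [k ek]] [hw [l el]]; split; first exact: pcD.
  exists (k + l)%N; rewrite scalerDr exprD -[in X in X + _]mulrC -!scalerA ek el.
  by rewrite !scaler0 addr0.
have TZ n k z : T n z -> T n (iota k *: z).
  move=> [hz [l el]]; split; first exact: (pc_iota gAP).
  by exists l; rewrite scalerA mulrC -scalerA el scaler0.
have Tpc n z : T n z -> pc n z by case.
have Tx n z : T n z -> T (n + al%:Z) (x *: z).
  move=> [hz [k ek]]; split; first exact: (pc_x gAP).
  by exists k; rewrite scalerA mulrC -scalerA ek scaler0.
have xT n z : T n z -> x *: z = 0 -> z = 0.
  move=> [_ [k]]; elim: k => [|k IH]; first by rewrite expr0 scale1r.
  rewrite exprS -scalerA => h xz; apply: IH => //; apply: reg => //.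
  by rewrite scalerA mulrC -scalerA xz scaler0.
pose f n := hilb iota (fun=> T n) 0.
have basisT n : exists s, free_list iota s /\ forall z, T n z <-> span s z.
  have [s [fs hs]] := fin_gen_basis al0 be0 gAP n fgM.
  by apply: (subspace_basis (t := s) (T0 n) (@TD n) (@TZ n)) => z /Tpc/hs.
have lf : is_laurent f.
  have [b hb] := fin_gen_laurent al0 be0 gAP fgM; exists b => n hn.
  rewrite /f /hilb (@dimK_free _ _ iota _ _ [::]) // => z; split=> [/Tpc/hb|/= ->//].
  exact.
have lh := hilb_laurent al0 be0 gAP fgM.
exists f, (fun n => hilbM n - f n); split=> //.
- exact: laurentB.
- by apply: funext => n; rewrite addrC subrK.
- move=> n; rewrite /dif subr_ge0 /f /hilb.
  have [s [fs hs]] := basisT (n - al%:Z); have [t [ft ht]] := basisT n.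
  rewrite (dimK_free fs hs) (dimK_free ft ht) lez_nat -(size_map (fun z => x *: z)).
  apply: (@free_le_span _ _ iota).
    rewrite -[X in free_list _ X]cats0; apply: (free_scale_cat (t := [::])) => //=.
      by rewrite cats0.
    by move=> z /hs hz; apply: xT hz.
  move=> u /mapP[z /span_mem/hs/Tx hz ->]; apply/ht.
  by rewrite subrK in hz.
move=> n; rewrite /dif subr_ge0; apply: (dim_scale_le (@Tpc _) (@Tpc n) (T0 _) (@TD _) (@TZ _) (T0 n) (@TD n) (@TZ n) (f := y)).
  by move=> z /(pc_y gAP); rewrite subrK.
by move=> z hz [_ [k]]; rewrite scalerA -exprSr => h; split=> //; exists k.+1.
Qed.

End Split.

(** * Torsionfree modules over the quotient ring *)

Section PositiveDepth.
Variables (K : fieldType) (al be : nat).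
Hypotheses (al0 : (0 < al)%N) (be0 : (0 < be)%N).

Lemma torsionfree_reg (N : gmodS K al be) (f : cuspS K al be) :
  torsionfree N -> (forall z, f * z = 0 -> z = 0) ->
  forall w : N, f *: w = 0 -> w = 0.
Proof.
move=> tf reg w; apply: tf => u v e; apply/eqP; rewrite -subr_eq0; apply/eqP.
by apply: reg; rewrite mulrBr e subrr.
Qed.

Lemma ldiv_ge0_deltaR F : is_laurent F ->
  ldiv_ge0 F (hilb_polyR K al be) <-> forall n, 0 <= delta al be F n.
Proof.
move=> hF; apply: ldiv_ge0_delta => //; first exact: hilb_polyR_laurent.
exact: delta_hilb_polyR.
Qed.

Lemma hilbS_laurent (N : gmodS K al be) : fin_gen N -> is_laurent (hilbS N).
Proof. exact: (hilb_laurent al0 be0 (monomial_gradingS K al be)). Qed.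

Lemma hilbert_depth_gt0 H : (0 < hilbert_depth K al be H)%E <->
  exists N : gmodR K al be,
    [/\ fin_gen N, hilbR N = H & (0 < depth (@maxXY K) N)%E].
Proof.
rewrite supremum_gt0; split=> [[d [[N [fg e ->]] d0]]|[N [fg e d0]]].
  by exists N.
by exists (depth (@maxXY K) N); split=> //; exists N.
Qed.

(** Apply [delta_lmul_ge0] to the splitting of H and to the Hilbert series of N,
    whose coefficients do not decrease along multiplication by X or by Y, both
    regular on the torsionfree module N. *)
Lemma positive_depth_ldiv_ge0 H : (0 < hilbert_depth K al be H)%E ->
  forall N : gmodS K al be, fin_gen N -> torsionfree N ->
    ldiv_ge0 (lmul H (hilbS N)) (hilb_polyR K al be).
Proof.
case/hilbert_depth_gt0 => M [fgM eH d0] N fgN tf.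
have lN := hilbS_laurent fgN.
have [|f [g [lf lg e hf hg]]] := hilb_split al0 be0 (monomial_gradingR K al be) fgM.
  exact: depth_maxXY_inj.
have gS := monomial_gradingS K al be.
rewrite -eH ldiv_ge0_deltaR; last first.
  apply: lmul_laurent => //; exact: (hilb_laurent al0 be0 (monomial_gradingR K al be)).
rewrite /hilbR e; apply: delta_lmul_ge0 => //.
  apply: (dif_hilb_ge0 al0 be0 gS fgN (gA_x gS)).
  by apply: torsionfree_reg => // z; exact: toS_X_reg.
apply: (dif_hilb_ge0 al0 be0 gS fgN (gA_y gS)).
by apply: torsionfree_reg => // z; exact: toS_Y_reg.
Qed.

End PositiveDepth.

(** * Modules of polynomials in one variable with prescribed exponents *)

Section PolyOn.
Variable (K : fieldType).
Implicit Types (D : nat -> Prop) (p : {poly K}).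

Definition supported D : {pred {poly K}} :=
  fun p => `[< forall n, p`_n != 0 -> D n >].

Lemma supportedP D p : reflect (forall n, p`_n != 0 -> D n) (p \in supported D).
Proof. exact: asboolP. Qed.

Fact supported_zmod D : zmod_closed (supported D).
Proof.
split=> [|p q /supportedP hp /supportedP hq]; apply/supportedP => n.
  by rewrite coef0 eqxx.
rewrite coefB; case: (eqVneq p`_n 0) => [->|/hp //].
by rewrite sub0r oppr_eq0 => /hq.
Qed.
HB.instance Definition _ D := GRing.isZmodClosed.Build {poly K} (supported D) (supported_zmod D).

Record poly_on D := PolyOn { poly_val : {poly K}; _ : poly_val \in supported D }.
HB.instance Definition _ D := [isSub for @poly_val D].
HB.instance Definition _ D := [Choice of poly_on D by <:].
HB.instance Definition _ D := [SubChoice_isSubZmodule of poly_on D by <:].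

Definition restrict D (P : pred nat) (z : poly_on D) : {poly K} :=
  \poly_(i < size (val z)) (if P i then (val z)`_i else 0).

Lemma coef_restrict D P (z : poly_on D) n :
  (restrict P z)`_n = if P n then (val z)`_n else 0.
Proof.
rewrite coef_poly; case: ltnP => // h.
by rewrite [(val z)`_n]nth_default ?if_same.
Qed.

Fact restrict_supported D P (z : poly_on D) : restrict P z \in supported D.
Proof.
apply/supportedP => n; rewrite coef_restrict; case: ifP => _; last by rewrite eqxx.
exact: (supportedP _ _ (valP z)).
Qed.

Fact monom_supported D n (k : K) : D n -> k *: 'X^n \in supported D.
Proof.
move=> Dn; apply/supportedP => m; rewrite coefZ coefXn.
by case: (m =P n) => [->//|_]; rewrite mulr0 eqxx.
Qed.

End PolyOn.

Section PolyOnModule.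
Variables (K : fieldType) (A : comNzRingType) (iota : {rmorphism K -> A}).
Variables (gA : int -> set A) (al be : nat) (x y : A).
Variables (sg : {rmorphism A -> {poly K}}) (c d : K).

(** A grading-preserving action of the ring on K[T], in which x and y act as
    multiples of powers of T. *)
Record monomial_action : Prop := MonomialAction {
  act_iota : forall k, sg (iota k) = k%:P;
  act_x : sg x = c *: 'X^al;
  act_y : sg y = d *: 'X^be;
  act_span : forall f, exists s : seq (K * (nat * nat)),
    f = \sum_(t <- s) iota t.1 * monomial x y t.2;
  act_homogeneous : forall a f, gA a f -> exists s : seq (K * (nat * nat)),
    f = \sum_(t <- s) iota t.1 * monomial x y t.2 /\
    forall t, t \in s -> (al * t.2.1 + be * t.2.2)%N%:Z = a }.

Definition action_stable (D : nat -> Prop) : Prop :=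
  (c != 0 -> forall n, D n -> D (n + al)%N) /\
  (d != 0 -> forall n, D n -> D (n + be)%N).

Hypothesis sgP : monomial_action.
Variables (D : nat -> Prop) (Dst : action_stable D) (s0 : int).

Lemma act_monomial k p : sg (iota k * monomial x y p) =
  (k * (c ^+ p.1 * d ^+ p.2)) *: 'X^(al * p.1 + be * p.2).
Proof.
rewrite rmorphM (act_iota sgP) /monomial rmorphM !rmorphXn /= (act_x sgP) (act_y sgP).
by rewrite !exprZn mul_polyC -scalerAl -scalerAr !scalerA -!exprM -exprD mulrA.
Qed.

Lemma action_stable_monomial i j n : c ^+ i * d ^+ j != 0 -> D n ->
  D (al * i + be * j + n)%N.
Proof.
have [hc hd] := Dst.
rewrite mulf_eq0 negb_or => /andP[ci dj] Dn.
elim: i ci => [_|i IH].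
  rewrite muln0 add0n; elim: j dj => [|j IH]; first by rewrite muln0.
  rewrite exprSr mulf_eq0 negb_or => /andP[/IH h d0].
  by rewrite mulnS [(be + _)%N]addnC addnAC; apply: hd.
rewrite exprSr mulf_eq0 negb_or => /andP[/IH h c0].
by rewrite mulnS [(al + _)%N]addnC !(addnAC _ al); apply: hc.
Qed.

Fact action_supported f (z : poly_on K D) : sg f * val z \in supported D.
Proof.
have [s ->] := act_span sgP f; rewrite rmorph_sum mulr_suml; apply: rpred_sum => t _.
rewrite act_monomial; apply/supportedP => n.
rewrite -scalerAl coefZ coefXnM; case: ltnP => h; first by rewrite mulr0 eqxx.
rewrite mulf_eq0 negb_or => /andP[h1 /(supportedP _ _ (valP z)) Dn].
move: h1; rewrite mulf_eq0 negb_or => /andP[_ h1].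
by have := action_stable_monomial h1 Dn; rewrite subnKC.
Qed.

(** The proofs sgP and Dst occur in the type so that the module structure, which
    depends on them, can be inferred from it. *)
Definition action_module : Type := let _ := Dst in let _ := sgP in poly_on K D.
HB.instance Definition _ := GRing.Zmodule.on action_module.

Definition act_scale (f : A) (z : action_module) : action_module :=
  PolyOn (action_supported f z).

Fact act_scaleA f g z : act_scale f (act_scale g z) = act_scale (f * g) z.
Proof. by apply: val_inj; rewrite /= rmorphM mulrA. Qed.
Fact act_scale1 : left_id 1 act_scale.
Proof. by move=> z; apply: val_inj; rewrite /= rmorph1 mul1r. Qed.
Fact act_scaleDr : right_distributive act_scale +%R.
Proof. by move=> f z w; apply: val_inj; rewrite /= mulrDr. Qed.
Fact act_scaleDl z : {morph act_scale^~ z : f g / f + g}.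
Proof. by move=> f g; apply: val_inj; rewrite /= rmorphD mulrDl. Qed.
HB.instance Definition _ := GRing.Zmodule_isLmodule.Build A action_module
  act_scaleA act_scale1 act_scaleDr act_scaleDl.

Definition act_pc (a : int) : set action_module :=
  [set z : action_module | forall n : nat, (val z)`_n != 0 -> n%:Z + s0 = a]%classic.

Lemma val_scale f (z : action_module) : val (f *: z) = sg f * val z.
Proof. by []. Qed.

Lemma val_sum (I : Type) (r : seq I) (F : I -> action_module) :
  val (\sum_(i <- r) F i) = \sum_(i <- r) val (F i).
Proof. by apply: (big_morph (fun z : action_module => val z)). Qed.

Fact act_pc0 a : act_pc a 0.
Proof. by move=> n; rewrite coef0 eqxx. Qed.

Fact act_pcB a z w : act_pc a z -> act_pc a w -> act_pc a (z - w).
Proof.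
move=> hz hw n; rewrite [val _]/(val z - val w) coefB.
case: (eqVneq (val z)`_n 0) => [->|/hz //].
by rewrite sub0r oppr_eq0 => /hw.
Qed.

Fact act_pcZ a b f z : gA a f -> act_pc b z -> act_pc (a + b) (f *: z).
Proof.
move=> /(act_homogeneous sgP)[s [-> hs]] hz n.
rewrite val_scale rmorph_sum mulr_suml coef_sum => h.
have [t ht] : exists2 t, t \in s &
    (sg (iota t.1 * monomial x y t.2) * val z)`_n != 0.
  apply: contrapT => h'; move/negP: h; apply; rewrite big_seq big1 // => t ht.
  by apply/eqP/negP => /negP h; apply: h'; exists t.
rewrite act_monomial -scalerAl coefZ coefXnM; case: ltnP => hn; first by rewrite mulr0 eqxx.
rewrite mulf_eq0 negb_or => /andP[_ /hz <-].
by rewrite -(hs _ ht) addrA -PoszD subnKC.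
Qed.

Fact act_span_pc (z : action_module) : exists (s : seq int) (e : int -> action_module),
  (forall a, act_pc a (e a)) /\ z = \sum_(a <- s) e a.
Proof.
pose e a : action_module := PolyOn (restrict_supported (fun i : nat => i%:Z + s0 == a) z).
exists [seq n%:Z + s0 | n <- seq.iota 0 (size (val z))], e; split.
  by move=> a n; rewrite coef_restrict; case: ifP => [/eqP //|_]; rewrite eqxx.
apply: val_inj; rewrite val_sum; apply/polyP => n; rewrite coef_sum big_map.
rewrite (eq_bigr (fun i => if i == n then (val z)`_n else 0)); last first.
  move=> i _; rewrite coef_restrict (inj_eq (addIr s0)) eqz_nat eq_sym.
  by case: eqP => // ->.
rewrite -big_mkcond /=; case: (ltnP n (size (val z))) => h.
  by rewrite -big_filter filter_pred1_uniq ?iota_uniq ?mem_iota // big_seq1.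
by rewrite nth_default // big1.
Qed.

Fact act_direct (s : seq int) (e : int -> action_module) : uniq s ->
  (forall a, act_pc a (e a)) -> \sum_(a <- s) e a = 0 -> forall a, a \in s -> e a = 0.
Proof.
move=> us he h a ha; apply: val_inj; apply/polyP => n; rewrite coef0.
apply/eqP/negP => /negP hn; have ea := he _ _ hn.
move/(congr1 val): h; rewrite val_sum => /polyP/(_ n).
rewrite coef_sum coef0 (bigD1_seq a) //= big1 ?addr0 => [e0|b hb].
  by rewrite e0 eqxx in hn.
by apply/eqP/negP => /negP/he; rewrite ea => e'; rewrite e' eqxx in hb.
Qed.

Definition action_gmod : gradedModule gA := @GradedModule A gA action_module
  act_pc act_pc0 act_pcB act_pcZ act_span_pc act_direct.

(** A homogeneous piece is spanned by a power of T if the exponent belongs to D,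
    and is zero otherwise. *)
Lemma hilb_action_gmod n :
  hilb iota act_pc n = `[< exists m : nat, D m /\ m%:Z + s0 = n >]%:Z.
Proof.
rewrite /hilb; congr Posz; case: asboolP => [[m [Dm em]]|no].
  pose v : action_module := PolyOn (monom_supported 1 Dm).
  have vE k : (val (iota k *: v) : {poly K}) = k *: 'X^m.
    by rewrite val_scale (act_iota sgP) mul_polyC /= scale1r.
  apply: (@dimK_free _ _ iota action_module _ [:: v]) => /=.
    split=> // /(congr1 val) /= /polyP /(_ m).
    by rewrite coefZ coefXn eqxx mulr1 coef0 => /eqP; rewrite oner_eq0.
  move=> z; split=> [hz|[k /eqP]]; last first.
    rewrite subr_eq0 => /eqP -> i; rewrite vE coefZ coefXn.
    by case: (i =P m) => [->|_]; rewrite ?em // mulr0 eqxx.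
  exists (val z)`_m; apply/eqP; rewrite subr_eq0; apply/eqP/val_inj; rewrite vE.
  apply/polyP => i; rewrite coefZ coefXn.
  case: (i =P m) => [->|im]; first by rewrite mulr1.
  rewrite mulr0; apply/eqP/negP => /negP/hz; lia.
apply: (@dimK_free _ _ iota action_module _ [::]) => //= z; split=> [hz|->]; last exact: act_pc0.
apply: val_inj; apply/polyP => i; rewrite coef0; apply/eqP/negP => /negP hi.
by apply: no; exists i; split; [exact: (supportedP _ _ (valP z))|exact: hz].
Qed.

Lemma fin_gen_action (N : nat) :
  (forall n, D n -> exists m f, [/\ (m < N)%N, D m, (m <= n)%N & sg f = 'X^(n - m)]) ->
  fin_gen action_module.
Proof.
move=> hN.
have ex n : exists p : nat * A, D n ->
    [/\ (p.1 < N)%N, D p.1, (p.1 <= n)%N & sg p.2 = 'X^(n - p.1)].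
  case: (pselect (D n)) => [/hN[m [f h]]|nD]; first by exists (m, f).
  by exists (0%N, 0).
have [w hw] := choice ex.
pose g (i : 'I_N) : action_module :=
  if pselect (D i) is left h then PolyOn (monom_supported 1 h) else 0.
exists N, g => z.
exists (fun i : 'I_N => \sum_(n < size (val z) | ((val z)`_n != 0) && ((w n).1 == i :> nat))
  iota (val z)`_n * (w n).2).
apply: val_inj; rewrite val_sum.
rewrite (eq_bigr (fun i : 'I_N => \sum_(n < size (val z) |
   ((val z)`_n != 0) && ((w n).1 == i :> nat)) (val z)`_n *: 'X^n)); last first.
  move=> i _; rewrite val_scale rmorph_sum mulr_suml.
  apply: eq_bigr => n /andP[/(supportedP _ _ (valP z)) Dn /eqP wi].
  have [h1 h2 h3 h4] := hw _ Dn; rewrite rmorphM (act_iota sgP) h4 mul_polyC.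
  rewrite /g; case: pselect => [h|[]]; last by rewrite -wi.
  by rewrite /= scale1r -scalerAl -exprD -wi subnK.
rewrite -[LHS]coefK poly_def (bigID (fun n : 'I_(size (val z)) => (val z)`_n != 0)) /=.
rewrite [X in _ + X]big1 => [|n /negPn/eqP ->]; last by rewrite scale0r.
rewrite addr0 (exchange_big_dep (fun n : 'I_(size (val z)) => (val z)`_n != 0)) /=.
  apply: eq_bigr => n hn; have [h1 _ _ _] := hw _ (supportedP _ _ (valP z) _ hn).
  rewrite (eq_bigl (pred1 (Ordinal h1))) ?big_pred1_eq // => i.
  by rewrite hn /= eq_sym.
by move=> i n _ /andP[].
Qed.

End PolyOnModule.

(** * Direct sums and shifts of the polynomial ring *)

Section DirectSum.
Variables (K : fieldType) (A : comNzRingType) (iota : {rmorphism K -> A}).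
Variables (gA : int -> set A) (M N : gradedModule gA).
Notation MN := (M * N)%type.

Definition sum_pc (a : int) : set MN :=
  [set z : MN | gmod_pc a z.1 /\ gmod_pc a z.2]%classic.

Lemma fst_sum (I : Type) (r : seq I) (F : I -> MN) :
  (\sum_(i <- r) F i).1 = \sum_(i <- r) (F i).1.
Proof. exact: (big_morph (fun z : MN => z.1)). Qed.

Lemma snd_sum (I : Type) (r : seq I) (F : I -> MN) :
  (\sum_(i <- r) F i).2 = \sum_(i <- r) (F i).2.
Proof. exact: (big_morph (fun z : MN => z.2)). Qed.

Lemma pair_ext (z w : MN) : z.1 = w.1 -> z.2 = w.2 -> z = w.
Proof. by case: z w => [z1 z2] [w1 w2] /= -> ->. Qed.

Fact sum_pc0 a : sum_pc a 0.
Proof. by split; exact: gmod_pc0. Qed.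

Fact sum_pcB a z w : sum_pc a z -> sum_pc a w -> sum_pc a (z - w).
Proof. by move=> [h1 h2] [h3 h4]; split; exact: gmod_pcB. Qed.

Fact sum_pcZ a b f z : gA a f -> sum_pc b z -> sum_pc (a + b) (f *: z).
Proof. by move=> hf [h1 h2]; split; exact: gmod_pcZ. Qed.

Fact sum_span z : exists (s : seq int) (c : int -> MN),
  (forall a, sum_pc a (c a)) /\ z = \sum_(a <- s) c a.
Proof.
have [_ [s [us cs es]]] := compP z.1; have [_ [t [ut ct et]]] := compP z.2.
exists (undup (s ++ t)), (fun a => (comp a z.1, comp a z.2)).
split=> [a|]; first by split; exact: comp_pc.
apply: pair_ext; rewrite ?fst_sum ?snd_sum /=.
  rewrite (big_uniq_sub us) ?undup_uniq // => a ha.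
  by rewrite mem_undup mem_cat ha.
rewrite (big_uniq_sub ut) ?undup_uniq // => a ha.
by rewrite mem_undup mem_cat ha orbT.
Qed.

Fact sum_direct (s : seq int) (c : int -> MN) : uniq s ->
  (forall a, sum_pc a (c a)) -> \sum_(a <- s) c a = 0 -> forall a, a \in s -> c a = 0.
Proof.
move=> us hc h a ha; apply: pair_ext.
  apply: (gmod_direct us (c := fun a => (c a).1)) ha => [b|]; first by have [] := hc b.
  by rewrite -fst_sum h.
apply: (gmod_direct us (c := fun a => (c a).2)) ha => [b|]; first by have [] := hc b.
by rewrite -snd_sum h.
Qed.

Definition sum_gmod : gradedModule gA := @GradedModule A gA MN
  sum_pc sum_pc0 sum_pcB sum_pcZ sum_span sum_direct.

Lemma fin_gen_sum : fin_gen M -> fin_gen N -> fin_gen MN.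
Proof.
move=> [m [g hg]] [n [h hh]].
exists (m + n)%N, (fun i => match split i with inl j => (g j, 0) | inr j => (0, h j) end).
move=> z; have [c ec] := hg z.1; have [d ed] := hh z.2.
exists (fun i => match split i with inl j => c j | inr j => d j end).
rewrite big_split_ord /=.
rewrite (eq_bigr (fun j => (c j *: g j, 0) : MN)); last first.
  by move=> j _; rewrite (unsplitK (inl j)); apply: pair_ext; rewrite /= ?scaler0.
rewrite [X in _ + X](eq_bigr (fun j => (0, d j *: h j) : MN)); last first.
  by move=> j _; rewrite (unsplitK (inr j)); apply: pair_ext; rewrite /= ?scaler0.
apply: pair_ext; rewrite /= ?fst_sum ?snd_sum /=.
  by rewrite [X in _ + X]big1 ?addr0.
by rewrite [X in X + _]big1 ?add0r.
Qed.

Lemma span_inl (s : seq M) (z : MN) :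
  span iota [seq (v, 0) : MN | v <- s] z <-> span iota s z.1 /\ z.2 = 0.
Proof.
elim: s z => [[z w]|v s IH [z w]] /=.
  by split=> [[-> ->]|[-> ->]].
split=> [[k /IH [h1 h2]]|[[k hk] e]].
  split; first by exists k.
  by move: h2; rewrite /= scaler0 subr0.
by exists k; apply/IH; split=> //=; rewrite e scaler0 subr0.
Qed.

Lemma span_inr (t : seq N) (z : MN) :
  span iota [seq (0, v) : MN | v <- t] z <-> z.1 = 0 /\ span iota t z.2.
Proof.
elim: t z => [[z w]|v s IH [z w]] /=.
  by split=> [[-> ->]|[-> ->]].
split=> [[k /IH [h1 h2]]|[e [k hk]]].
  split; last by exists k.
  by move: h1; rewrite /= scaler0 subr0.
by exists k; apply/IH; split=> //=; rewrite e scaler0 subr0.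
Qed.

Lemma span_sum_list (s : seq M) (t : seq N) (z : MN) :
  span iota ([seq (v, 0) : MN | v <- s] ++ [seq (0, v) : MN | v <- t]) z <->
  span iota s z.1 /\ span iota t z.2.
Proof.
rewrite span_cat; split=> [[u [w [/span_inl[h1 h2] /span_inr[h3 h4] ->]]]|[h1 h2]].
  by rewrite /= h3 h2 addr0 add0r.
exists (z.1, 0), (0, z.2); split; [exact/span_inl|exact/span_inr|].
by apply: pair_ext; rewrite /= ?addr0 ?add0r.
Qed.

Lemma free_sum_list (s : seq M) (t : seq N) : free_list iota s -> free_list iota t ->
  free_list iota ([seq (v, 0) : MN | v <- s] ++ [seq (0, v) : MN | v <- t]).
Proof.
elim: s => /= [_|v s IH [hv fs] ft]; last first.
  by split; [case/span_sum_list|exact: IH].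
by elim: t => //= v t IH [hv ft]; split; [case/span_inr|exact: IH].
Qed.

Lemma hilb_sum n : (exists s, free_list iota s /\ forall z : M, gmod_pc n z <-> span iota s z) ->
  (exists s, free_list iota s /\ forall z : N, gmod_pc n z <-> span iota s z) ->
  hilb iota sum_pc n = hilb iota (@gmod_pc _ _ M) n + hilb iota (@gmod_pc _ _ N) n.
Proof.
move=> [s [fs hs]] [t [ft ht]].
rewrite /hilb (dimK_free fs hs) (dimK_free ft ht).
rewrite (dimK_free (free_sum_list fs ft)) ?size_cat ?size_map ?PoszD // => z.
by rewrite span_sum_list -hs -ht.
Qed.

End DirectSum.

Section ShiftedRing.
Variables (K : fieldType) (al be : nat) (s0 : int).
Hypotheses (al0 : (0 < al)%N) (be0 : (0 < be)%N).
Notation R := (polyR K).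

Definition shift_pc (a : int) : set R^o := fun f => pcR al be (a - s0) f.

Fact shift_pc0 a : shift_pc a 0.
Proof. by move=> i j; rewrite !coef0 eqxx. Qed.

Fact shift_pcB a f g : shift_pc a f -> shift_pc a g -> shift_pc a (f - g).
Proof.
move=> hf hg i j; rewrite !coefB.
case: (eqVneq (f : {poly {poly K}})`_i`_j 0) => [->|/hf //].
by rewrite sub0r oppr_eq0 => /hg.
Qed.

Lemma polyR_monomials_homogeneous a (f : R) : pcR al be a f ->
  exists s : seq (K * (nat * nat)),
    f = \sum_(t <- s) iotaR t.1 * monomial (varX K) (varY K) t.2 /\
    forall t, t \in s -> (al * t.2.1 + be * t.2.2)%N%:Z = a.
Proof.
move=> hf; have := polyR_monomials f; set s := [seq _ | _ <- _, _ <- _] => e.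
exists [seq t <- s | t.1 != 0]; split=> [|t].
  rewrite big_filter [LHS]e (bigID (fun t : K * (nat * nat) => t.1 != 0)) /=.
  rewrite [X in _ + X]big1 ?addr0 // => t /negPn/eqP ->.
  by rewrite rmorph0 mul0r.
by rewrite mem_filter => /andP[h /allpairsPdep[i [j [_ _ et]]]]; rewrite et in h *; apply: hf.
Qed.

Fact shift_pcZ a b f g : pcR al be a f -> shift_pc b g -> shift_pc (a + b) (f *: g).
Proof.
move=> /polyR_monomials_homogeneous[s [-> hs]] /polyR_monomials_homogeneous[t [-> ht]].
rewrite /shift_pc -[_ *: _]/(_ * _) mulr_suml => i j; rewrite !coef_sum => h.
have [p hp] : exists2 p, p \in s & ((iotaR p.1 * monomial (varX K) (varY K) p.2 *
     (\sum_(q <- t) iotaR q.1 * monomial (varX K) (varY K) q.2) : {poly {poly K}}))`_i`_j != 0.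
  apply: contrapT => h'; move/negP: h; apply; rewrite big_seq big1 // => p hp.
  by apply/eqP/negP => /negP h; apply: h'; exists p.
rewrite mulr_sumr !coef_sum => {}h.
have [q hq] : exists2 q, q \in t & ((iotaR p.1 * monomial (varX K) (varY K) p.2 *
     (iotaR q.1 * monomial (varX K) (varY K) q.2) : {poly {poly K}}))`_i`_j != 0.
  apply: contrapT => h'; move/negP: h; apply; rewrite big_seq big1 // => q hq.
  by apply/eqP/negP => /negP h; apply: h'; exists q.
rewrite mulrACA -rmorphM (_ : monomial _ _ _ * _ =
  monomial (varX K) (varY K) (p.2.1 + q.2.1, p.2.2 + q.2.2)%N); last first.
  by rewrite /monomial /= !exprD mulrACA.
rewrite coef_monomial; case: (i =P _) => [->|_]; last by rewrite eqxx.
case: (j =P _) => [-> _|_]; last by rewrite /= eqxx.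
rewrite -(hs _ hp) /= -addrA -(ht _ hq).
by rewrite -PoszD !mulnDr addnACA.
Qed.

Fact shift_span (f : R^o) : exists (s : seq int) (c : int -> R^o),
  (forall a, shift_pc a (c a)) /\ f = \sum_(a <- s) c a.
Proof.
have := polyR_monomials f; set s := [seq _ | _ <- _, _ <- _] => ef.
pose deg (t : K * (nat * nat)) : int := (al * t.2.1 + be * t.2.2)%N%:Z + s0.
pose c a : R^o := \sum_(t <- s | deg t == a) iotaR t.1 * monomial (varX K) (varY K) t.2.
exists (undup (map deg s)), c; split=> [a|].
  apply: big_ind => [|g h hg hh|t /eqP et]; first exact: shift_pc0.
    move=> i j; rewrite !coefD.
    case: (eqVneq (g : {poly {poly K}})`_i`_j 0) => [->|/hg //].
    by rewrite add0r => /hh.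
  move=> i j; rewrite coef_monomial -et /deg addrK.
  case: (i =P _) => [->|_]; last by rewrite eqxx.
  by case: (j =P _) => [->|_]; last by rewrite /= eqxx.
rewrite {1}ef /c (exchange_big_dep xpredT) //= [LHS]big_seq [RHS]big_seq.
apply: eq_bigr => t ht; under eq_bigl do rewrite eq_sym.
by rewrite -big_filter filter_pred1_uniq ?undup_uniq ?mem_undup ?map_f // big_seq1.
Qed.

Fact shift_direct (s : seq int) (c : int -> R^o) : uniq s ->
  (forall a, shift_pc a (c a)) -> \sum_(a <- s) c a = 0 -> forall a, a \in s -> c a = 0.
Proof.
move=> us hc h a ha; apply/polyP => i; apply/polyP => j; rewrite !coef0.
apply/eqP/negP => /negP hn; have ea := hc _ _ _ hn.
have /(congr1 (fun f : {poly {poly K}} => f`_i`_j)) := h.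
rewrite !coef_sum !coef0 (bigD1_seq a) //= big1 ?addr0 => [e0|b hb].
  by rewrite e0 eqxx in hn.
apply/eqP/negP => /negP/hc; rewrite ea => /addIr e'.
by rewrite e' eqxx in hb.
Qed.

Definition shift_gmod : gmodR K al be := @GradedModule R (@pcR K al be) R^o
  shift_pc shift_pc0 shift_pcB shift_pcZ shift_span shift_direct.

Lemma fin_gen_shift : fin_gen R^o.
Proof.
exists 1%N, (fun=> 1) => f; exists (fun=> f).
by rewrite big_ord1 /GRing.scale /= mulr1.
Qed.

Lemma hilb_shift n : hilbR shift_gmod n = (size (monomials al be (n - s0)))%:Z.
Proof. by rewrite -(hilb_polyRE K al0 be0). Qed.

End ShiftedRing.

(** * Actions of the two rings on polynomials in one variable *)

Section CoprimeDecomposition.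
Variables (al be : nat).
Hypotheses (be0 : (0 < be)%N) (co : coprime al be).

Lemma coprime_mod_inj i i' : (i < be)%N -> (i' < be)%N ->
  al * i = al * i' %[mod be] -> i = i'.
Proof.
wlog le : i i' / (i <= i')%N.
  move=> h hi hi' e; case: (leqP i i') => [le|/ltnW le]; first exact: h.
  by apply/esym/h.
move=> hi hi' /esym/eqP; rewrite eqn_mod_dvd ?leq_mul2l ?le ?orbT //.
rewrite -mulnBr Gauss_dvdr; last by rewrite coprime_sym.
case: (posnP (i' - i)%N) => [|h /(dvdn_leq h)]; lia.
Qed.

Lemma coprime_decomposition (n : int) :
  exists (i : nat) (j : int), (i < be)%N /\ n = al%:Z * i%:Z + be%:Z * j.
Proof.
have : coprimez al be by rewrite coprimezE.
case/coprimezP => -[u v] /= e.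
exists `|(n * u %% be)%Z|%N, (n * v + al%:Z * (n * u %/ be)%Z).
have b0 : be%:Z != 0 by lia.
have h0 := modz_ge0 (n * u) b0.
split.
  have := ltz_mod (n * u) b0; lia.
rewrite gez0_abs //; have e2 := divz_eq (n * u) be.
transitivity (al%:Z * (n * u) + be%:Z * (n * v)).
  by rewrite -[LHS]mulr1 -e; ring.
by rewrite {1}e2; ring.
Qed.

End CoprimeDecomposition.

Section Evaluation.
Variables (K : fieldType) (al be : nat).
Hypotheses (al0 : (0 < al)%N) (be0 : (0 < be)%N).
Notation R := (polyR K).
Notation S := (cuspS K al be).

(** The substitution of c T^alpha for X and d T^beta for Y. With (c, d) equal to
    (1, 0), (0, 1) and (1, 1) its images are K[T^alpha], K[T^beta] and the
    coordinate ring of the cusp. *)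
Definition evR (c d : K) (f : R) : {poly K} :=
  horner_eval (c *: 'X^al) (map_poly (comp_poly (d *: 'X^be)) f).
HB.instance Definition _ c d := GRing.RMorphism.copy (evR c d)
  (horner_eval (c *: 'X^al) \o map_poly (comp_poly (d *: 'X^be))).

Lemma evR_action c d : monomial_action (@iotaR K) (@pcR K al be) al be
  (varX K) (varY K) (evR c d) c d.
Proof.
split.
- move=> k; change ((map_poly (comp_poly (d *: 'X^be)) k%:P%:P).[c *: 'X^al] = k%:P).
  by rewrite map_polyC /= comp_polyC hornerC.
- change ((map_poly (comp_poly (d *: 'X^be)) 'X).[c *: 'X^al] = c *: 'X^al).
  by rewrite map_polyX hornerX.
- change ((map_poly (comp_poly (d *: 'X^be)) 'X%:P).[c *: 'X^al] = d *: 'X^be).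
  by rewrite map_polyC /= comp_polyX hornerC.
- by move=> f; eexists; exact: polyR_monomials.
by move=> a f; exact: polyR_monomials_homogeneous.
Qed.

Lemma evR_cusp : evR 1 1 (cusp K al be) = 0.
Proof.
have [_ hX hY _ _] := evR_action 1 1.
rewrite /cusp rmorphB !rmorphXn /= -[evR 1 1 'X]/(evR 1 1 (varX K)) hX.
by rewrite -[evR 1 1 _%:P]/(evR 1 1 (varY K)) hY !scale1r -!exprM mulnC subrr.
Qed.

(** Modulo the monic cusp polynomial every element is represented by an f of
    degree less than beta in X, and evaluation is injective on those: when
    alpha and beta are coprime, al i + be j determines the pair (i, j) with
    i < beta. *)
Lemma evR_eq0 f : coprime al be -> evR 1 1 f = 0 -> toS al be f = 0.
Proof.
move=> co; pose q : {poly {poly K}} := cusp K al be.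
have szq : size q = be.+1.
  rewrite /q /cusp size_polyDl size_polyXn // size_polyN -rmorphXn /=.
  by apply: leq_ltn_trans (size_polyC_leq1 _) _.
have mq : q \is monic.
  rewrite monicE /lead_coef szq /= coefB coefXn eqxx -rmorphXn /= coefC.
  by rewrite (gtn_eqF be0) subr0.
have := Pdiv.RingMonic.rdivp_eq mq (f : {poly {poly K}}).
have := Pdiv.Ring.ltn_rmodpN0 (f : {poly {poly K}}) (monic_neq0 mq).
set r := Pdiv.Ring.rmodp _ _; set g := Pdiv.Ring.rdivp _ _ => szr ef e.
suff r0 : r = 0 by apply/toS_eq0; exists g; rewrite ef r0 addr0.
have er : evR 1 1 (r : R) = 0.
  have : evR 1 1 (g * q + r : R) = 0 by rewrite -ef.
  by rewrite rmorphD rmorphM /= evR_cusp mulr0 add0r.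
apply/polyP => i; apply/polyP => j; rewrite !coef0.
case: (ltnP i (size r)) => hi; last by rewrite [r`_i]nth_default // coef0.
have := polyR_monomials (r : R); set s := [seq _ | _ <- _, _ <- _] => es.
move: er; rewrite {1}es rmorph_sum => /polyP/(_ (al * i + be * j)%N) h.
rewrite coef0 coef_sum in h; rewrite -[RHS]h es !coef_sum.
rewrite !big_seq; apply: eq_bigr => t /allpairsPdep[i' [j' [hi' _ ->]]].
rewrite (act_monomial (evR_action 1 1)) !expr1n !mulr1 coefZ coefXn coef_monomial /=.
rewrite mulr_natr; congr (_ *+ _); congr nat_of_bool; apply/andP/eqP => [[/eqP -> /eqP ->]//|e'].
rewrite mem_iota /= add0n in hi'; rewrite szq ltnS in szr.
have ii : i = i'.
  have : (al * i = al * i' %[mod be])%N.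
    by have := congr1 (modn^~ be) e'; rewrite /= ![(_ + be * _)%N]addnC ![(be * _)%N]mulnC !modnMDl.
  exact: (coprime_mod_inj be0 co (leq_trans hi szr) (leq_trans hi' szr)).
by move: e'; rewrite ii => /addnI/eqP; rewrite eqn_pmul2l // => /eqP ->.
Qed.

Definition evS (f : S) : {poly K} := evR 1 1 (repr f).

Lemma evS_toS f : evS (toS al be f) = evR 1 1 f.
Proof.
apply/eqP; rewrite -subr_eq0 -rmorphB; apply/eqP.
have [g ->] : exists g : R, repr (toS al be f) - f = g * cusp K al be.
  by apply/toS_eq0; rewrite rmorphB /= {1}/toS reprK subrr.
by rewrite rmorphM /= evR_cusp mulr0.
Qed.

Fact evS_zmod : zmod_morphism evS.
Proof.
move=> u v; have [f ->] := toS_surj u; have [g ->] := toS_surj v.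
by rewrite -rmorphB !evS_toS rmorphB.
Qed.
Fact evS_monoid : monoid_morphism evS.
Proof.
split=> [|u v]; first by rewrite -(rmorph1 (toS al be)) evS_toS rmorph1.
have [f ->] := toS_surj u; have [g ->] := toS_surj v.
by rewrite -rmorphM !evS_toS rmorphM.
Qed.
HB.instance Definition _ := GRing.isZmodMorphism.Build S {poly K} evS evS_zmod.
HB.instance Definition _ := GRing.isMonoidMorphism.Build S {poly K} evS evS_monoid.

Lemma toS_monomial p : toS al be (monomial (varX K) (varY K) p) =
  monomial (toS al be (varX K)) (toS al be (varY K)) p.
Proof. by rewrite /monomial rmorphM !rmorphXn. Qed.

Lemma evS_action : monomial_action (@iotaS K al be) (@pcS K al be) al be
  (toS al be (varX K)) (toS al be (varY K)) evS 1 1.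
Proof.
have [hi hX hY hs hh] := evR_action 1 1.
have tS (s : seq (K * (nat * nat))) :
  toS al be (\sum_(t <- s) iotaR t.1 * monomial (varX K) (varY K) t.2) =
  \sum_(t <- s) iotaS al be t.1 * monomial (toS al be (varX K)) (toS al be (varY K)) t.2.
  by rewrite rmorph_sum; apply: eq_bigr => t _; rewrite rmorphM -toS_monomial.
split.
- by move=> k; exact: etrans (evS_toS _) (hi k).
- exact: etrans (evS_toS _) hX.
- exact: etrans (evS_toS _) hY.
- by move=> f; have [g ->] := toS_surj f; have [s ->] := hs g; exists s; rewrite tS.
by move=> a _ [g hg <-]; have [s [-> h]] := hh a g hg; exists s; rewrite tS.
Qed.

Lemma evS_inj f : coprime al be -> evS f = 0 -> f = 0.
Proof. by move=> co; have [g ->] := toS_surj f; rewrite evS_toS; exact: evR_eq0. Qed.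

Lemma evS_monomial i j : evS (toS al be (monomial (varX K) (varY K) (i, j))) =
  'X^(al * i + be * j).
Proof.
rewrite evS_toS -[monomial _ _ _]mul1r -(rmorph1 (@iotaR K)).
by rewrite (act_monomial (evR_action 1 1)) !expr1n !mulr1 scale1r.
Qed.

(** The semigroup generated by alpha and beta contains all the integers from
    alpha beta on: in n = alpha i + beta j with 0 <= i < beta, the coefficient j
    cannot be negative. *)
Lemma evS_powers n : coprime al be -> (al * be <= n)%N -> exists f, evS f = 'X^n.
Proof.
move=> co hn; have [i [j [hi e]]] := coprime_decomposition be0 co n%:Z.
exists (toS al be (monomial (varX K) (varY K) (i, `|j|%N))).
rewrite evS_monomial; congr ('X^_); have : (al * i <= al * be)%N by rewrite leq_mul2l ltnW ?orbT.
nia.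
Qed.

Lemma evS_image p : coprime al be -> exists f, evS f = 'X^(al * be) * p.
Proof.
move=> co; rewrite -[p]coefK poly_def mulr_sumr.
apply: (big_ind (fun r => exists f, evS f = r)) => [|r r' [f <-] [g <-]|i _].
- by exists 0; rewrite rmorph0.
- by exists (f + g); rewrite rmorphD.
have [f ef] := evS_powers co (leq_addr i (al * be)%N).
exists (iotaS al be p`_i * f); rewrite rmorphM (act_iota evS_action) /= ef.
by rewrite mul_polyC exprD -scalerAr.
Qed.

Section ActionModuleS.
Variables (D : nat -> Prop) (Dst : action_stable al be (1 : K) 1 D).
Notation N := (action_module evS_action Dst).

Lemma torsionfree_action : coprime al be -> torsionfree N.
Proof.
move=> co f z reg /(congr1 val) /= /eqP; rewrite mulf_eq0 => /orP[/eqP/(evS_inj co) f0|].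
  by have /eqP := reg 1 0 (etrans (congr1 (fun g => g * 1) f0) (etrans (mul0r _) (esym (mulr0 _)))); rewrite oner_eq0.
by move=> /eqP z0; apply: val_inj.
Qed.

(** Two elements p and q are dependent, because a power of T times q and a
    power of T times - p both belong to the image of the ring. *)
Lemma rank1_action : coprime al be -> (exists n, D n) -> has_rank N 1.
Proof.
move=> co [m Dm]; split.
  pose v : N := PolyOn (monom_supported 1 Dm).
  exists (fun=> v) => c; rewrite big_ord1 => /(congr1 val) /= /eqP.
  rewrite scale1r mulf_eq0 expf_eq0 polyX_eq0 andbF orbF => /eqP/(evS_inj co) c0 i.
  by rewrite (ord1 i).
move=> n v hv; rewrite leqNgt; apply/negP => n1.
have n0 : (0 < n)%N by exact: ltnW.
pose i0 := Ordinal n0; pose i1 := Ordinal n1.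
have [f ef] := evS_image (val (v i1)) co; have [g eg] := evS_image (- val (v i0)) co.
pose c (i : 'I_n) := if i == i0 then f else if i == i1 then g else 0.
have hc : \sum_(i < n) c i *: v i = 0.
  rewrite (bigD1 i0) //= (bigD1 i1) //= big1 ?addr0 => [|i /andP[h0 h1]]; last first.
    by rewrite /c (negbTE h0) (negbTE h1) scale0r.
  apply: val_inj; transitivity (evS (c i0) * val (v i0) + evS (c i1) * val (v i1)) => //.
  rewrite /c !eqxx (_ : (i1 == i0) = false) // ef eg.
  by apply: (etrans (y := 0)) => //; ring.
have := hv c hc i0; rewrite /c eqxx => f0.
move: ef; rewrite f0 rmorph0 => /esym/eqP.
rewrite mulf_eq0 expf_eq0 polyX_eq0 andbF /= => /eqP v1.
suff /eqP : 1 = 0 :> S by rewrite oner_eq0.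
have := hv (fun i => if i == i1 then 1 else 0) _ i1; apply.
rewrite (bigD1 i1) //= scale1r big1 ?addr0; first exact: val_inj.
by move=> i /negbTE ->; rewrite scale0r.
Qed.

End ActionModuleS.
End Evaluation.

(** * Hilbert series realized in positive depth *)

Section Realizable.
Variables (K : fieldType) (al be : nat).
Hypotheses (al0 : (0 < al)%N) (be0 : (0 < be)%N).

(** The element X + Y acts injectively on K[X], on K[Y] and on the ring itself,
    so that a single condition serves for all the summands used below. *)
Definition realizable (H : int -> int) : Prop := exists M : gmodR K al be,
  [/\ fin_gen M, hilbR M = H
    & forall x : M, (varX K + varY K) *: x = 0 -> x = 0].

Lemma realizable_depth H : realizable H -> (0 < hilbert_depth K al be H)%E.
Proof.
case=> M [fg e reg]; apply/hilbert_depth_gt0; exists M; split=> //.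
by apply/depth_gt0; right; exists (varX K + varY K) => //; exact: maxXY_XY.
Qed.

Lemma realizable_add F G : realizable F -> realizable G ->
  realizable (fun n => F n + G n).
Proof.
case=> [M [fgM <- hM]] [N [fgN <- hN]]; exists (sum_gmod M N); split.
- exact: fin_gen_sum.
- apply: funext => n; apply: hilb_sum.
    exact: (fin_gen_basis al0 be0 (monomial_gradingR K al be)).
  exact: (fin_gen_basis al0 be0 (monomial_gradingR K al be)).
by move=> [z w] /pair_equal_spec[/hM /= -> /hN /= ->].
Qed.

(** K[T^alpha] and K[T^beta], with the other variable acting by 0. *)
Lemma realizable_action c d (D : nat -> Prop) (Dst : action_stable al be c d D) s0 :
  (forall n, D n -> exists f, evR al be c d f = 'X^n) -> D 0%N ->
  c *: 'X^al + d *: 'X^be != 0 :> {poly K} ->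
  realizable (fun n => `[< exists m : nat, D m /\ m%:Z + s0 = n >]%:Z).
Proof.
move=> hD D0 reg; exists (action_gmod (@evR_action K al be c d) Dst s0); split.
- apply: (fin_gen_action _ Dst (N := 1)) => n /hD[f hf]; exists 0%N, f.
  by rewrite subn0.
- by apply: funext => n; exact: hilb_action_gmod.
move=> z /(congr1 val) /= /eqP; rewrite mulf_eq0 => /orP[|/eqP z0]; last exact: val_inj.
rewrite rmorphD /= (act_x (@evR_action K al be c d)) (act_y (@evR_action K al be c d)).
by rewrite (negbTE reg).
Qed.

Lemma realizable_X a :
  realizable (fun n => `[< exists k : nat, n = a + (al * k)%N%:Z >]%:Z).
Proof.
have st : action_stable al be (1 : K) 0 (fun n => exists k, n = al * k)%N.
  split=> [_ _ [k ->]|]; last by rewrite eqxx.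
  by exists k.+1; rewrite mulnS addnC.
have -> : (fun n : int => `[< exists k : nat, n = a + (al * k)%N%:Z >]%:Z) =
    (fun n : int => `[< exists m : nat, (exists k, m = al * k)%N /\ m%:Z + a = n >]%:Z).
  apply: funext => n; congr Posz; congr nat_of_bool; apply: asbool_equiv_eq.
  split=> [[k ->]|[_ [[k ->] <-]]]; last by exists k; rewrite addrC.
  by exists (al * k)%N; split; [exists k|rewrite addrC].
apply: (realizable_action st).
- move=> _ [k ->]; exists (varX K ^+ k); rewrite rmorphXn /=.
  by rewrite (act_x (@evR_action K al be 1 0)) scale1r exprM.
- by exists 0%N; rewrite muln0.
by rewrite scale0r addr0 scale1r expf_neq0 ?polyX_eq0.
Qed.

Lemma realizable_Y a :
  realizable (fun n => `[< exists k : nat, n = a + (be * k)%N%:Z >]%:Z).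
Proof.
have st : action_stable al be (0 : K) 1 (fun n => exists k, n = be * k)%N.
  split=> [|_ _ [k ->]]; first by rewrite eqxx.
  by exists k.+1; rewrite mulnS addnC.
have -> : (fun n : int => `[< exists k : nat, n = a + (be * k)%N%:Z >]%:Z) =
    (fun n : int => `[< exists m : nat, (exists k, m = be * k)%N /\ m%:Z + a = n >]%:Z).
  apply: funext => n; congr Posz; congr nat_of_bool; apply: asbool_equiv_eq.
  split=> [[k ->]|[_ [[k ->] <-]]]; last by exists k; rewrite addrC.
  by exists (be * k)%N; split; [exists k|rewrite addrC].
apply: (realizable_action st).
- move=> _ [k ->]; exists (varY K ^+ k); rewrite rmorphXn /=.
  by rewrite (act_y (@evR_action K al be 0 1)) scale1r exprM.
- by exists 0%N; rewrite muln0.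
by rewrite scale0r add0r scale1r expf_neq0 ?polyX_eq0.
Qed.

Lemma realizable0 : realizable (fun=> 0).
Proof.
have st : action_stable al be (1 : K) 0 (fun=> False) by [].
exists (action_gmod (@evR_action K al be 1 0) st 0); split.
- by apply: (fin_gen_action _ st (N := 0)).
- apply: funext => n; rewrite [LHS]hilb_action_gmod asboolF // => -[m []//].
move=> z _; apply: val_inj; apply/polyP => n; rewrite coef0; apply/eqP/negP => /negP.
by move/(supportedP _ _ (valP z)).
Qed.

Lemma realizable_R c : realizable (fun n => (size (monomials al be (n - c)))%:Z).
Proof.
exists (shift_gmod K al be c); split; first exact: fin_gen_shift.
  by apply: funext => n; exact: hilb_shift.
move=> f /eqP; rewrite [_ *: _]/(_ * f) mulf_eq0 => /orP[|/eqP //].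
rewrite addrC => /eqP/(congr1 (fun g : {poly {poly K}} => g`_1`_0)).
rewrite coefD coefX coefC /= add0r coefC coef0 => /eqP.
by rewrite !coef0 oner_eq0.
Qed.

End Realizable.

(** * Modules attached to staircases *)

Section StaircaseModules.
Variables (K : fieldType) (al be : nat).
Hypotheses (al0 : (0 < al)%N) (be0 : (0 < be)%N) (co : coprime al be).

Lemma lmul_delta F G c n : is_laurent F -> (forall m, G m = (m + c == 0)%:Z) ->
  lmul F G n = F (n + c).
Proof.
move=> hF hG; rewrite -(@lmul1 F (fun m => (m == 0)%:Z)) //.
by rewrite /lmul; apply: eq_fsbigr => i _; rewrite hG addrAC.
Qed.

Lemma lmul_deltas F (cs : seq int) n : is_laurent F ->
  lmul F (fun m => \sum_(c <- cs) (m + c == 0)%:Z) n = \sum_(c <- cs) F (n + c).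
Proof.
have lau s : is_laurent (fun m => \sum_(c <- s) (m + c == 0)%:Z : int).
  elim: s => [|c s [b hb]]; first by exists 0 => m _; rewrite big_nil.
  exists (Num.min b (- c)) => m hm; rewrite big_cons hb; last by lia.
  by case: eqP => // e; lia.
move=> hF; elim: cs => [|c cs IH].
  have [a ha] := hF; rewrite big_nil (lmul_range (a := a) (b := 0) (N := `|(n - a)%R|%N.+1)) //; try lia.
    by rewrite big1 // => k _; rewrite big_nil mulr0.
  by move=> i _; rewrite big_nil.
rewrite big_cons -IH -(@lmul_delta F (fun m => (m + c == 0)%:Z)) //.
have l1 : is_laurent (fun m => (m + c == 0)%:Z).
  by exists (- c) => m hm; case: eqP => // e; lia.
rewrite lmulC // [X in X + _]lmulC // [X in _ + X]lmulC // -lmulDl //.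
by congr lmul; apply: funext => m; rewrite big_cons.
Qed.

(** A staircase records, for a set of integers closed under subtraction of al and
    be, the greatest element in each residue class modulo al: the class of
    - k be contributes the corner al psi k - k be. *)
Definition staircase (psi : nat -> int) : Prop :=
  (forall k, psi k <= psi k.+1) /\ (forall k, psi (k + al)%N = psi k + be%:Z).

Definition corner (psi : nat -> int) (k : nat) : int :=
  al%:Z * psi k - k%:Z * be%:Z.

Lemma corner_per psi k : staircase psi -> corner psi (k + al)%N = corner psi k.
Proof. by move=> [_ per]; rewrite /corner per PoszD; ring. Qed.

Lemma corner_modn psi k : staircase psi -> corner psi (k %% al)%N = corner psi k.
Proof.
move=> st; rewrite [in RHS](divn_eq k al) addnC.
elim: (k %/ al)%N => [|q IH]; first by rewrite mul0n addn0.
by rewrite mulSn addnCA addnC corner_per.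
Qed.

Lemma corner_mod_inj psi k l (w : int) : (k < al)%N -> (l < al)%N ->
  corner psi k = corner psi l + al%:Z * w -> k = l.
Proof.
rewrite /corner => hk hl e.
have : (al%:Z %| (k%:Z - l%:Z) * be%:Z)%Z.
  by apply/dvdzP; exists (psi k - psi l - w); rewrite mulrBl; lia.
rewrite Gauss_dvdzl ?coprimezE // => /dvdzP[q eq].
have q1 : q * al%:Z < 1%:Z * al%:Z by lia.
have q2 : (- 1%:Z) * al%:Z < q * al%:Z by lia.
move: q1 q2; rewrite !ltr_pM2r ?ltz_nat // => q1 q2.
have q0 : q = 0 by lia.
by move: eq; rewrite q0 mul0r; lia.
Qed.

Lemma nat_bound (f : nat -> int) N : exists b : int, forall k, (k < N)%N -> f k <= b.
Proof.
elim: N => [|N [b hb]]; first by exists 0.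
exists (Num.max b (f N)) => k; rewrite ltnS leq_eqVlt => /orP[/eqP ->|/hb]; lia.
Qed.

Section StaircaseModule.
Variables (psi : nat -> int) (st : staircase psi) (s0 : int).
Hypothesis s0_le : forall k, (k < al)%N -> s0 <= - corner psi k.

(** The exponents m + s0 run through the negatives of the integers that lie below
    some corner in its class modulo al; the shift by s0 makes them nonnegative,
    so that K[T] can replace K[T, 1/T]. *)
Definition staircase_exponents (m : nat) : Prop :=
  exists k u : nat, m%:Z + s0 + corner psi k = al%:Z * u%:Z.

Lemma staircase_stable : action_stable al be (1 : K) 1 staircase_exponents.
Proof.
split=> _ m [k [u e]]; first by exists k, u.+1; rewrite PoszD; lia.
have [h _] := st; have := h k => hk.
have [v ev] : exists v : nat, psi k.+1 = psi k + v%:Z.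
  by exists `|(psi k.+1 - psi k)%R|%N; lia.
by exists k.+1, (u + v)%N; move: e; rewrite /corner ev; lia.
Qed.

Notation N := (action_gmod (evS_action K al be) staircase_stable s0).

(** Distinct corners lie in distinct classes modulo al, so at most one term of the
    sum is nonzero. *)
Lemma hilb_staircase n : hilbS N n =
  \sum_(k <- iota 0 al) `[< exists u : nat, n + corner psi k = al%:Z * u%:Z >]%:Z.
Proof.
rewrite [LHS]hilb_action_gmod; case: asboolP => [[m [[k0 [u e]] em]]|no].
  pose k := (k0 %% al)%N; have hk : (k < al)%N by rewrite ltn_mod.
  have {}e : n + corner psi k = al%:Z * u%:Z by rewrite corner_modn // -em.
  rewrite (bigD1_seq k) ?iota_uniq ?mem_iota //= big_seq_cond big1.
    by rewrite addr0 asboolT //; exists u.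
  move=> l /andP[]; rewrite mem_iota => /= hl lk; rewrite asboolF // => -[v ev].
  case/eqP: lk; apply: (@corner_mod_inj psi _ _ (v%:Z - u%:Z)) => //; lia.
rewrite big_seq big1 // => k; rewrite mem_iota => /= hk; rewrite asboolF // => -[u e].
have := s0_le hk => hs; apply: no; exists `|(n - s0)%R|%N; split; last by lia.
by exists k, u; lia.
Qed.

Lemma dif_hilb_staircase n : dif al (hilbS N) n =
  \sum_(c <- [seq corner psi k | k <- iota 0 al]) (n + c == 0)%:Z.
Proof.
rewrite /dif !hilb_staircase -sumrB big_map; apply: eq_bigr => k _.
case: asboolP => [[u e]|h1]; case: asboolP => [[v e']|h2].
- case: eqP => [e0|]; lia.
- case: eqP => [e0|n0]; first by lia.
  case: h2; exists u.-1; case: u e => [|u] e; lia.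
- by case: h1; exists v.+1; lia.
case: eqP => // e0; case: h1; exists 0%N; lia.
Qed.

Lemma staircase_fin_gen : fin_gen N.
Proof.
have [b hb] := nat_bound (fun k => - (s0 + corner psi k)) al.
apply: (fin_gen_action _ staircase_stable (N := `|b|%N.+1)) => n [k0 [u e]].
pose k := (k0 %% al)%N; have hk : (k < al)%N by rewrite ltn_mod.
have {}e : n%:Z + s0 + corner psi k = al%:Z * u%:Z by rewrite corner_modn.
have := hb _ hk; have := s0_le hk => h1 h2.
exists (n - al * u)%N, (toS al be (varX K) ^+ u); split; try lia.
  by exists k, 0%N; lia.
rewrite rmorphXn /= (act_x (evS_action K al be)) scale1r -exprM.
by congr ('X^_); lia.
Qed.

Lemma staircase_nonempty : exists m, staircase_exponents m.
Proof.
by have := s0_le al0 => h; exists `|(- s0 - corner psi 0)%R|%N, 0%N, 0%N; lia.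
Qed.

End StaircaseModule.

(** This is the hypothesis for the module of the staircase, whose Hilbert series
    times 1 - t^alpha is the sum of t^(-c) over the corners c in one period. *)
Lemma staircase_inequality H : is_laurent H ->
  (forall N : gmodS K al be, fin_gen N -> torsionfree N -> has_rank N 1%N ->
     ldiv_ge0 (lmul H (hilbS N)) (hilb_polyR K al be)) ->
  forall psi, staircase psi -> forall n,
    0 <= \sum_(k <- iota 0 al) dif be H (n + corner psi k).
Proof.
move=> lH hN psi st n.
have [b hb] := nat_bound (corner psi) al.
have s0_le k : (k < al)%N -> - b <= - corner psi k by rewrite lerN2 => /hb.
have fg := staircase_fin_gen st s0_le.
have := hN _ fg (torsionfree_action be0 co)
  (rank1_action al0 be0 _ co (staircase_nonempty s0_le)).
have lN := hilbS_laurent al0 be0 fg.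
rewrite (ldiv_ge0_deltaR K al0 be0); last exact: lmul_laurent.
move/(_ n); rewrite /delta.
set G := hilbS _.
have -> : dif be (lmul H G) = lmul (dif be H) G.
  by apply: funext => m; apply: dif_lmull.
rewrite dif_lmulr //; last exact: dif_laurent.
have -> : dif al G = fun m => \sum_(c <- [seq corner psi k | k <- iota 0 al]) (m + c == 0)%:Z.
  by apply: funext => m; apply: dif_hilb_staircase.
by rewrite lmul_deltas ?big_map //; apply: dif_laurent.
Qed.

End StaircaseModules.

(** * From fundamental couples to staircases *)

Lemma multiple_lt1 (v : int) (d : nat) : (0 < d)%N -> v * d%:Z < d%:Z -> v <= 0.
Proof.
by move=> d0 h; have : v * d%:Z < 1 * d%:Z; [lia|rewrite ltr_pM2r ?ltz_nat //; lia].
Qed.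

Lemma multiple_gtN1 (v : int) (d : nat) : (0 < d)%N -> - d%:Z < v * d%:Z -> 0 <= v.
Proof.
by move=> d0 h; have : (-1) * d%:Z < v * d%:Z; [lia|rewrite ltr_pM2r ?ltz_nat //; lia].
Qed.

Section CoupleToStaircase.
Variables (al be : nat).
Hypotheses (al0 : (0 < al)%N) (be0 : (0 < be)%N) (co : coprime al be).

Lemma dvd_coprimel (z w : int) : z * al%:Z = w * be%:Z -> exists v, z = v * be%:Z.
Proof.
move=> e; apply/dvdzP; rewrite -(@Gauss_dvdzl be z al); last by rewrite coprimezE coprime_sym.
by apply/dvdzP; exists w.
Qed.

Lemma dvd_coprimer (z w : int) : z * be%:Z = w * al%:Z -> exists v, z = v * al%:Z.
Proof.
move=> e; apply/dvdzP; rewrite -(@Gauss_dvdzl al z be) ?coprimezE //.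
by apply/dvdzP; exists w.
Qed.

(** In the decomposition x = al i + be j with 0 <= i < be the coefficient j is
    negative, as x is not in the semigroup; take a = be - i and b = - j. *)
Lemma gap_repr x : gap al be x -> exists a b : nat,
  [/\ (0 < a < be)%N, (0 < b < al)%N &
      x = al%:Z * be%:Z - a%:Z * al%:Z - b%:Z * be%:Z].
Proof.
move=> [x0 nx]; have [i [j [hi e]]] := coprime_decomposition be0 co x.
have j0 : j < 0.
  rewrite ltNge; apply/negP => j0; apply: nx; exists i, `|j|%N.
  by rewrite PoszD !PoszM gez0_abs // e; ring.
have e' : x = al%:Z * be%:Z - (be - i)%N%:Z * al%:Z - `|j|%N%:Z * be%:Z.
  by rewrite e -subzn ?(ltnW hi) // ltz0_abs //; ring.
have hb : (`|j|%N < al)%N.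
  rewrite -ltz_nat -(@ltr_pM2r _ be%:Z) ?ltz_nat //.
  have : 0 < (be - i)%N%:Z * al%:Z by rewrite pmulr_lgt0 ?ltz_nat ?subn_gt0.
  by lia.
have ha : ((be - i)%N < be)%N.
  rewrite -ltz_nat -(@ltr_pM2r _ al%:Z) ?ltz_nat //.
  have : 0 < `|j|%N%:Z * be%:Z by rewrite pmulr_lgt0 ?ltz_nat //; lia.
  by lia.
by exists (be - i)%N, `|j|%N; split=> //; apply/andP; split; lia.
Qed.

(** Coordinates a, b of the elements al be - a al - b be of a couple: the
    members of I are the lower corners, those of J the upper corners, of a
    lattice path from (be, 0) to (0, al). *)
Lemma couple_coordinates I J m : size I = m.+1 -> size J = m.+1 ->
  fundamental_couple al be I J -> exists a b : nat -> nat,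
  [/\ [/\ a 0%N = be, b 0%N = 0%N, a m.+1 = 0%N & b m.+1 = al],
      forall k, (k <= m)%N -> (a k.+1 < a k)%N /\ (b k < b k.+1)%N,
      forall k, (k <= m)%N -> I`_k = al%:Z * be%:Z - (a k)%:Z * al%:Z - (b k)%:Z * be%:Z
    & forall k, (k <= m)%N -> J`_k = al%:Z * be%:Z - (a k.+1)%:Z * al%:Z - (b k)%:Z * be%:Z].
Proof.
move=> sI sJ [m' [[sI' _] I0 [gI gJ J0 Jm] [c1 c2 [c3 c3']] _]].
have em : m' = m by move: sI'; rewrite sI => -[].
rewrite {}em in gI gJ Jm c1 c2 c3 c3' => {sI'}.
have ex k : exists p : nat * nat,
    [/\ k = 0%N -> p = (be, 0%N), k = m.+1 -> p = (0%N, al) & (0 < k <= m)%N ->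
      [/\ (0 < p.1 < be)%N, (0 < p.2 < al)%N &
        I`_k = al%:Z * be%:Z - p.1%:Z * al%:Z - p.2%:Z * be%:Z]].
  case: (posnP k) => [->|k0]; first by exists (be, 0%N); split=> //; lia.
  case: (ltnP m k) => hk; first by exists (0%N, al); split=> //; lia.
  have hk' : (0 < k <= m)%N by rewrite k0.
  have [a [b h]] := gap_repr (gI k hk').
  by exists (a, b); split=> //; lia.
have [p hp] := choice ex.
pose a k := (p k).1; pose b k := (p k).2.
have p0 : p 0%N = (be, 0%N) by have [h _ _] := hp 0%N; apply: h.
have pm : p m.+1 = (0%N, al) by have [_ h _] := hp m.+1; apply: h.
have hI k : (k <= m)%N -> I`_k = al%:Z * be%:Z - (a k)%:Z * al%:Z - (b k)%:Z * be%:Z.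
  case: (posnP k) => [-> _|k0 hk]; first by rewrite /a /b p0 I0 /=; lia.
  by have [_ _ h] := hp k; have [|_ _ ->] := h _; first by rewrite k0.
have bk k : (k <= m)%N -> (b k < al)%N.
  case: (posnP k) => [-> _|k0 hk]; first by rewrite /b p0.
  by have [_ _ h] := hp k; have [|_ /andP[]] := h _; first by rewrite k0.
have ak k : (k <= m)%N -> (a k.+1 < be)%N.
  rewrite leq_eqVlt => /orP[/eqP ->|hk]; first by rewrite /a pm.
  by have [_ _ h] := hp k.+1; have [|/andP[]] := h _; first exact: hk.
have ak0 k : (k <= m)%N -> (a k <= be)%N.
  by case: k => [|k] hk; [rewrite /a p0|apply/ltnW/ak/ltnW].
(* J`_k is congruent to I`_k modulo al, so it has the same coordinate b; the
   upper bounds on J make its other coordinate a' nonnegative, and then the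
   congruence modulo be identifies a' with the coordinate a of the next point *)
have key k : (k <= m)%N -> exists a' : int,
    [/\ J`_k = al%:Z * be%:Z - a' * al%:Z - (b k)%:Z * be%:Z, a' < (a k)%:Z &
      0 <= a' -> a' = (a k.+1)%:Z /\ (b k < b k.+1)%N].
  move=> hk; have [/eqP] := c1 k hk; rewrite eqz_mod_dvd => /dvdzP[w ew] IJ.
  exists ((a k)%:Z + w).
  have e1 : J`_k = al%:Z * be%:Z - ((a k)%:Z + w) * al%:Z - (b k)%:Z * be%:Z.
    by rewrite mulrDl -ew hI //; ring.
  have w0 : w < 0.
    by rewrite -(@ltr_pM2r _ al%:Z) ?ltz_nat // -ew mul0r subr_lt0.
  split=> //; first by lia.
  set a' := (a k)%:Z + w => a'0.
  (* for k = m this is 0, the value of I`_0 that closes the cycle *)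
  pose i' := al%:Z * be%:Z - (a k.+1)%:Z * al%:Z - (b k.+1)%:Z * be%:Z.
  have [q [eq Ji]] : exists q, J`_k - i' = q * be%:Z /\ i' <= J`_k.
    move: hk; rewrite leq_eqVlt => /orP[/eqP hk|hk].
      have i'0 : i' = 0 by rewrite /i' hk /a /b pm /=; lia.
      have /dvdzP[q eq] : (be %| J`_m - I`_0)%Z by rewrite -eqz_mod_dvd; apply/eqP.
      by exists q; rewrite i'0 hk; split; [rewrite -eq I0|move: c3'; rewrite I0].
    have [/eqP] := c2 k hk; rewrite eqz_mod_dvd hI // => /dvdzP[q eq] /ltW h.
    by exists q; split=> //; rewrite /i' -hI.
  have [v ev] : exists v, (a k.+1)%:Z - a' = v * be%:Z.
    apply: (@dvd_coprimel _ (q + (b k)%:Z - (b k.+1)%:Z)).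
    by rewrite !mulrBl !mulrDl -eq e1 /i'; ring.
  have ha1 := ak _ hk; have ha0 := ak0 _ hk.
  have v0 : v = 0.
    by have := @multiple_lt1 v be be0; have := @multiple_gtN1 v be be0; lia.
  have ea : a' = (a k.+1)%:Z by rewrite v0 mul0r in ev; lia.
  split=> //; move: hk; rewrite leq_eqVlt => /orP[/eqP hk|hk].
    by rewrite {2}/b hk pm; apply: bk.
  have [_] := c2 k hk; rewrite hI // e1 -/a' ea => h.
  rewrite -ltz_nat -(@ltr_pM2r _ be%:Z) ?ltz_nat //; lia.
have a'0 k : (k <= m)%N -> J`_k <= al%:Z * be%:Z - (b k)%:Z * be%:Z.
  move=> hk; have [a' [e1 h1 _]] := key k hk.
  case: (posnP k) => [k0|k0]; first by rewrite k0 /b p0 mul0r subr0 -PoszM.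
  have b1 := bk _ hk.
  move: hk; rewrite leq_eqVlt => /orP[/eqP hk|hk]; last first.
    have hk' : (0 < k < m)%N by rewrite k0.
    have [a2 [b2 [h2 h3 e2]]] := gap_repr (gJ k hk').
    have [v ev] : exists v, b2%:Z - (b k)%:Z = v * al%:Z.
      apply: (@dvd_coprimer _ (a' - a2%:Z)).
      by move: e2; rewrite e1 !mulrBl; lia.
    have v0 : 0 <= v by have := @multiple_gtN1 v al al0; lia.
    have : (b k)%:Z * be%:Z <= b2%:Z * be%:Z.
      rewrite ler_pM2r ?ltz_nat //; have : 0 <= v * al%:Z by rewrite mulr_ge0.
      lia.
    have : 0 <= a2%:Z * al%:Z by []; lia.
  have [z ez] : exists z, J`_m = z * be%:Z.
    by move/eqP: c3; rewrite eqz_mod_dvd I0 subr0 => /dvdzP.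
  have [v ev] : exists v, a' = v * be%:Z.
    apply: (@dvd_coprimel _ (al%:Z - (b k)%:Z - z)).
    by rewrite !mulrBl -ez -hk e1; ring.
  have : 0 <= v.
    rewrite leNgt; apply/negP => v0.
    have h2 : a' <= - be%:Z.
      have := @multiple_gtN1 v be be0; rewrite -ev; lia.
    have h3 : be%:Z * al%:Z <= - a' * al%:Z by rewrite ler_pM2r ?ltz_nat //; lia.
    have h4 : (b k)%:Z * be%:Z < al%:Z * be%:Z by rewrite ltr_pM2r ?ltz_nat.
    by move: Jm; rewrite -hk e1; lia.
  move=> v0; have : 0 <= a' * al%:Z by rewrite ev !mulr_ge0.
  by rewrite e1; lia.
have key' k : (k <= m)%N -> [/\ J`_k = al%:Z * be%:Z - (a k.+1)%:Z * al%:Z - (b k)%:Z * be%:Z,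
    (a k.+1 < a k)%N & (b k < b k.+1)%N].
  move=> hk; have [a' [e1 h1 h2]] := key k hk.
  have := a'0 k hk; rewrite e1 => h3.
  have : 0 * al%:Z <= a' * al%:Z by lia.
  rewrite ler_pM2r ?ltz_nat // => /h2[ea hb].
  by split=> //; rewrite -?ea //; move: h1; rewrite ea; lia.
exists a, b; split=> //.
- by rewrite /a /b p0 pm.
- by move=> k /key'[].
by move=> k /key'[].
Qed.

(** On the period from 0 to al take the step function with value be - a (k+1)
    between b k and b (k+1). Its last value is be, and its first value is at least
    0, so the periodic extension is nondecreasing across the end of a period. *)
Lemma step_function (a b : nat -> nat) m :
  a 0%N = be -> b 0%N = 0%N -> a m.+1 = 0%N -> b m.+1 = al ->
  (forall k, (k <= m)%N -> (a k.+1 < a k)%N /\ (b k < b k.+1)%N) ->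
  exists psi, staircase al be psi /\ forall k x, (k <= m)%N ->
    (b k <= x < b k.+1)%N -> psi x = be%:Z - (a k.+1)%:Z.
Proof.
move=> a0 b0 am bm hab.
have bmono k l : (k <= l <= m.+1)%N -> (b k <= b l)%N.
  elim: l => [|l IH]; first by rewrite leqn0 andbC => /andP[_ /eqP ->].
  case/andP; rewrite leq_eqVlt => /orP[/eqP -> //|kl hl].
  by apply: leq_trans (ltnW (hab l _).2) => //; apply: IH; lia.
have amono k l : (k <= l <= m.+1)%N -> (a l <= a k)%N.
  elim: l => [|l IH]; first by rewrite leqn0 andbC => /andP[_ /eqP ->].
  case/andP; rewrite leq_eqVlt => /orP[/eqP -> //|kl hl].
  by apply: leq_trans (ltnW (hab l _).1) _ => //; apply: IH; lia.
have ex x : exists k, (x < al)%N -> (k <= m)%N /\ (b k <= x < b k.+1)%N.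
  case: (ltnP x al) => hx; last by exists 0%N.
  pose P k := (k <= m)%N && (b k <= x)%N.
  have P0 : exists k, P k by exists 0%N; rewrite /P b0.
  have Pm k : P k -> (k <= m)%N by case/andP.
  case: (ex_maxnP P0 Pm) => k /andP[km bk] kmax; exists k => _; split=> //.
  rewrite bk ltnNge; apply/negP => bk1.
  have : (k < m)%N.
    rewrite ltn_neqAle km andbT; apply/eqP => e; move: bk1; rewrite e bm; lia.
  by move=> km'; have := kmax k.+1; rewrite /P km' bk1 => /(_ isT); rewrite ltnn.
have [kk hkk] := choice ex.
pose f x : int := be%:Z - (a (kk x).+1)%:Z.
have fE k x : (k <= m)%N -> (b k <= x < b k.+1)%N -> f x = be%:Z - (a k.+1)%:Z.
  move=> km /andP[h1 h2]; have xal : (x < al)%N.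
    by apply: leq_trans h2 _; rewrite -bm; apply: bmono; lia.
  have [h3 /andP[h4 h5]] := hkk x xal; rewrite /f; congr (_ - (a _.+1)%:Z).
  apply/eqP; rewrite eqn_leq; apply/andP; split; rewrite leqNgt; apply/negP => h.
    by have := bmono k.+1 (kk x); lia.
  by have := bmono (kk x).+1 k; lia.
pose psi x : int := f (x %% al)%N + (x %/ al)%N%:Z * be%:Z.
have fm x : (x.+1 < al)%N -> f x <= f x.+1.
  move=> hx; have [h3 h4] := hkk x (ltnW hx); have [h5 h6] := hkk x.+1 hx.
  have hk : (kk x <= kk x.+1)%N.
    rewrite leqNgt; apply/negP => h; have := bmono (kk x.+1).+1 (kk x); lia.
  by have := amono (kk x).+1 (kk x.+1).+1; rewrite /f; lia.
have abe k : (k <= m.+1)%N -> (a k <= be)%N by move=> hk; rewrite -a0; apply: amono; lia.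
exists psi; split; last first.
  move=> k x km hx; have xal : (x < al)%N.
    by case/andP: hx => _ h2; apply: leq_trans h2 _; rewrite -bm; apply: bmono; lia.
  by rewrite /psi modn_small // divn_small // mul0r addr0; apply: fE.
split=> x; last by rewrite /psi modnDr divnDr // divnn al0 PoszD mulrDl mul1r addrA.
rewrite /psi; have hx := ltn_pmod x al0; have ex' := divn_eq x al.
case: (ltnP (x %% al).+1 al) => h.
  have -> : x.+1 = (x %/ al * al + (x %% al).+1)%N by lia.
  rewrite modnMDl divnMDl // (modn_small h) (divn_small h) addn0 lerD2r.
  exact: fm.
have -> : x.+1 = ((x %/ al).+1 * al)%N by rewrite mulSn; lia.
rewrite modnMl mulnK // -[(x %/ al).+1]addn1 PoszD mulrDl mul1r.
have [h3 _] := hkk _ hx; have [h5 _] := hkk _ al0.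
have := abe (kk 0%N).+1; rewrite /f; lia.
Qed.

(** On the k-th step the corners decrease by be, starting from j_k, so the sum of
    the differences telescopes to H (j_k + n) - H (i_(k+1) + n). *)
Lemma couple_sum H I J : is_laurent H -> fundamental_couple al be I J ->
  exists2 psi, staircase al be psi & forall n,
    \sum_(k <- iota 0 al) dif be H (n + corner al be psi k) =
    \sum_(j <- J) H (j + n) - \sum_(i <- I) H (i + n).
Proof.
move=> lH hc; have [m [[sI sJ] _ _ _ _]] := hc.
have [a [b [[a0 b0 am bm] hab hI hJ]]] := couple_coordinates sI sJ hc.
have [psi [st hpsi]] := step_function a0 b0 am bm hab.
exists psi => // n.
pose i' k := al%:Z * be%:Z - (a k)%:Z * al%:Z - (b k)%:Z * be%:Z.
have bl k : (k <= m)%N -> forall d, (b k + d <= b k.+1)%N ->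
    \sum_(0 <= x < b k + d) dif be H (n + corner al be psi x) =
    \sum_(0 <= x < b k) dif be H (n + corner al be psi x) +
    (H (J`_k + n) - H (J`_k - d%:Z * be%:Z + n)).
  move=> km; elim=> [|d IH] hd; first by rewrite addn0 mul0r subr0 subrr addr0.
  rewrite addnS big_nat_recr //= IH; last by lia.
  rewrite -addrA; congr (_ + _).
  rewrite /dif /corner (hpsi k) //; last by lia.
  have -> : n + (al%:Z * (be%:Z - (a k.+1)%:Z) - (b k + d)%N%:Z * be%:Z) = J`_k - d%:Z * be%:Z + n.
    by rewrite hJ // PoszD; ring.
  have -> : J`_k - d%:Z * be%:Z + n - be%:Z = J`_k - d.+1%:Z * be%:Z + n.
    by rewrite -addn1 PoszD; ring.
  by rewrite addrA subrK.
have tot k : (k <= m.+1)%N ->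
    \sum_(0 <= x < b k) dif be H (n + corner al be psi x) =
    \sum_(0 <= l < k) (H (J`_l + n) - H (i' l.+1 + n)).
  elim: k => [|k IH] hk; first by rewrite b0 !big_geq.
  have [_ hb] := hab k hk.
  rewrite big_nat_recr //= -IH; last exact: ltnW.
  have := bl k hk (b k.+1 - b k)%N; rewrite subnKC ?leqnn; last exact: ltnW.
  move=> /(_ isT) ->; congr (_ + (_ - H (_ + n))).
  by rewrite hJ // /i' -subzn ?(ltnW hb) //; ring.
have eJ : \sum_(j <- J) H (j + n) = \sum_(0 <= l < m.+1) H (J`_l + n).
  by rewrite (big_nth 0) sJ.
have eI : \sum_(i <- I) H (i + n) = \sum_(0 <= l < m.+1) H (I`_l + n).
  by rewrite (big_nth 0) sI.
have := tot m.+1 (leqnn _); rewrite bm {1}/index_iota subn0 => ->.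
rewrite sumrB eJ eI; congr (_ - _); rewrite big_nat_recr //= big_nat_recl //=.
have -> : i' m.+1 = I`_0 by rewrite hI // /i' am bm a0 b0; ring.
rewrite addrC; congr (_ + _); rewrite !big_nat; apply: eq_bigr => l /andP[_ hl].
by rewrite hI.
Qed.

End CoupleToStaircase.

(** * From staircases to fundamental couples *)

Section StaircaseToCouple.
Variables (al be : nat).
Hypotheses (al0 : (0 < al)%N) (be0 : (0 < be)%N) (co : coprime al be).
Notation corner := (corner al be).
Notation staircase := (staircase al be).

Lemma staircase_mono psi k l : staircase psi -> (k <= l)%N -> psi k <= psi l.
Proof.
move=> [h _] /subnK <-; elim: (l - k)%N => [|d IH]; first by rewrite add0n.
by rewrite addSn; apply: le_trans IH (h _).
Qed.

Lemma staircase_perM psi k q : staircase psi ->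
  psi (k + q * al)%N = psi k + q%:Z * be%:Z.
Proof.
move=> [_ per]; elim: q => [|q IH]; first by rewrite mul0n addn0 mul0r addr0.
by rewrite mulSn addnCA addnC per IH -addn1 PoszD; ring.
Qed.

Section Normalized.
Variable psi : nat -> int.
Hypotheses (st : staircase psi) (psi0 : psi 0%N = 0).
Hypothesis corner_ge0 : forall k, (k < al)%N -> 0 <= corner psi k.

Let brk k := psi k < psi k.+1.
Let breaks := [seq k <- iota 0 al | brk k].
Let low k := corner psi k.
Let up k := al%:Z * psi k.+1 - k%:Z * be%:Z.

Lemma psi_al : psi al = be%:Z.
Proof. by have [_ per] := st; rewrite -[al]add0n per psi0 add0r. Qed.

(** An equation low p = low q + a al + b be forces psi to be constant from p to
    p + b, by periodicity. *)
Lemma low_gap p q : (p < al)%N -> (q < al)%N -> p <> q -> brk p ->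
  ~ in_sgrp al be (low p - low q).
Proof.
move=> hp hq pq bp [a [b e]]; rewrite /low /corner in e.
have [v ev] : exists v, (p + b)%N%:Z - q%:Z = v * al%:Z.
  by apply: (dvd_coprimer co (w := psi p - psi q - a%:Z)); lia.
have v0 : 0 <= v.
  by apply: (multiple_gtN1 al0); rewrite -ev; lia.
have ep : (p + b = q + `|v| * al)%N.
  by apply/eqP; rewrite -eqz_nat [X in _ == X]PoszD PoszM gez0_abs // -ev; lia.
have hpb : psi (p + b)%N = psi p - a%:Z.
  rewrite ep (staircase_perM _ _ st) gez0_abs //.
  apply: (@mulIf _ al%:Z); first by lia.
  have : (p%:Z + b%:Z - q%:Z) * be%:Z = v * al%:Z * be%:Z by rewrite -ev PoszD.
  lia.
case: (posnP b) => [b0|b0].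
  move: ep; rewrite b0 addn0 => ep.
  have v00 : (`|v| = 0)%N by case: (`|v|)%N ep => // n; rewrite mulSn; lia.
  by apply: pq; rewrite ep v00 mul0n addn0.
have : psi p.+1 <= psi (p + b)%N by apply: staircase_mono => //; lia.
by move: bp; rewrite /brk hpb; lia.
Qed.

(** An equation up p = a al + b be would give psi (p + b) <= psi (p + 1) where
    p + b is a positive multiple of al, against the jump at p' between them. *)
Lemma up_gap p p' : (0 < p)%N -> (p < p')%N -> (p' < al)%N -> brk p' ->
  ~ in_sgrp al be (up p).
Proof.
move=> p0 hp hp' bp' [a [b e]]; rewrite /up in e.
have [v ev] : exists v, (p + b)%N%:Z = v * al%:Z.
  by apply: (dvd_coprimer co (w := psi p.+1 - a%:Z)); lia.
have v1 : 0 < v.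
  by rewrite -(@ltr_pM2r _ al%:Z) ?ltz_nat // mul0r -ev; lia.
have e1 : psi p.+1 = a%:Z + v * be%:Z.
  apply: (@mulIf _ al%:Z); first by lia.
  have : (p%:Z + b%:Z) * be%:Z = v * al%:Z * be%:Z by rewrite -ev PoszD.
  lia.
have h1 : psi p.+1 <= psi p' by apply: staircase_mono.
have h2 : psi p'.+1 <= psi al by apply: staircase_mono.
have h3 : 1 * be%:Z <= v * be%:Z by rewrite ler_pM2r ?ltz_nat //; lia.
by move: bp' h2; rewrite /brk psi_al; lia.
Qed.

Lemma psi_const p q : (p <= q)%N -> (forall x, (p <= x < q)%N -> ~~ brk x) ->
  psi p = psi q.
Proof.
move=> /subnK <-; elim: (q - p)%N => [|d IH] h; first by rewrite add0n.
rewrite addSn IH => [|x hx]; last by apply: h; lia.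
have := h (d + p)%N; rewrite /brk -leNgt => h'.
by apply/eqP; rewrite eq_le (st.1 _) h' //; lia.
Qed.

Lemma brk0 : brk 0%N.
Proof.
rewrite /brk psi0; case: (ltnP 1 al) => h.
  have := corner_ge0 h; rewrite /corner => h1.
  by rewrite -(@ltr_pM2l _ al%:Z) ?ltz_nat // mulr0; lia.
have -> : 1%N = al by lia.
by rewrite psi_al.
Qed.

Let b k := nth 0%N breaks k.

Lemma mem_breaks x : (x \in breaks) = (x < al)%N && brk x.
Proof. by rewrite mem_filter mem_iota /= andbC. Qed.

Lemma breaks_mono k l : (k < size breaks)%N -> (l < size breaks)%N ->
  (b k < b l)%N = (k < l)%N.
Proof.
move=> hk hl; have srt : sorted ltn breaks by apply: sorted_filter (iota_ltn_sorted _ _); exact: ltn_trans.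
have mono i j : (i < size breaks)%N -> (j < size breaks)%N -> (i < j)%N -> (b i < b j)%N.
  by move=> hi hj; apply: (sorted_ltn_nth ltn_trans 0%N srt).
case: (ltngtP k l) => h; first by rewrite mono.
  by apply/negbTE; rewrite -leqNgt ltnW // mono.
by rewrite h ltnn.
Qed.

Lemma breaks0 : b 0%N = 0%N.
Proof.
by rewrite /b /breaks -(prednK al0) /= brk0.
Qed.

Lemma breaks_gt0 : (0 < size breaks)%N.
Proof. by rewrite /breaks -(prednK al0) /= brk0. Qed.

Lemma break_nth k : (k < size breaks)%N -> (b k < al)%N /\ brk (b k).
Proof. by move=> /(mem_nth 0%N); rewrite mem_breaks => /andP[]. Qed.

Lemma psi_next k : (k.+1 < size breaks)%N -> psi (b k).+1 = psi (b k.+1).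
Proof.
move=> hk; apply: psi_const; first by rewrite breaks_mono //; lia.
move=> x /andP[h1 h2]; apply/negP => bx.
have xin : x \in breaks by rewrite mem_breaks bx andbT; have [h _] := break_nth hk; lia.
have ix : (index x breaks < size breaks)%N by rewrite index_mem.
have ex : b (index x breaks) = x by rewrite /b nth_index.
have := breaks_mono ix hk; have := breaks_mono (ltnW hk) ix; rewrite ex; lia.
Qed.

Lemma psi_last m : size breaks = m.+1 -> psi (b m).+1 = be%:Z.
Proof.
move=> sz; rewrite -psi_al; have hm : (m < size breaks)%N by rewrite sz.
apply: psi_const; first by have [] := break_nth hm.
move=> x /andP[h1 h2]; apply/negP => bx.
have xin : x \in breaks by rewrite mem_breaks bx h2.
have ix : (index x breaks < size breaks)%N by rewrite index_mem.
have ex : b (index x breaks) = x by rewrite /b nth_index.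
have := breaks_mono hm ix; rewrite ex; lia.
Qed.

(** Consecutive breaks are joined by an interval on which psi is constant; this is
    where the congruences modulo be come from. *)
Lemma breaks_couple : fundamental_couple al be (map low breaks) (map up breaks).
Proof.
have sz0 := breaks_gt0; pose m := (size breaks).-1.
have sz : size breaks = m.+1 by rewrite prednK.
have eI k : (k <= m)%N -> (map low breaks)`_k = low (b k).
  by move=> hk; rewrite (nth_map 0%N) // sz.
have eJ k : (k <= m)%N -> (map up breaks)`_k = up (b k).
  by move=> hk; rewrite (nth_map 0%N) // sz.
have low0 : low 0%N = 0 by rewrite /low /corner psi0; lia.
have low_ge0 k : (k <= m)%N -> 0 <= low (b k).
  by move=> hk; apply: corner_ge0; have [|] := @break_nth k; rewrite ?sz.
have bpos k : (0 < k <= m)%N -> (0 < b k)%N.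
  by move=> /andP[k0 hk]; rewrite -breaks0 breaks_mono ?sz.
have lowup k : (k <= m)%N -> low (b k) < up (b k).
  move=> hk; have [|_] := @break_nth k; rewrite ?sz // /brk => h.
  by rewrite /low /up /corner ltrD2r ltr_pM2l ?ltz_nat.
have up_le k : (k <= m)%N -> up (b k) <= (al * be)%N%:Z.
  move=> hk; have [|h _] := @break_nth k; rewrite ?sz //.
  have : psi (b k).+1 <= psi al by apply: staircase_mono.
  rewrite psi_al -(@ler_pM2l _ al%:Z) ?ltz_nat // /up PoszM => h'.
  have : 0 <= (b k)%:Z * be%:Z by []; lia.
exists m; split.
- by rewrite !size_map.
- by rewrite eI // breaks0.
- split.
  + move=> k /andP[k0 hk]; rewrite eI //; split; first exact: low_ge0.
    rewrite -[low _]subr0 -low0; have [|h h'] := @break_nth k; rewrite ?sz //.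
    by apply: low_gap => // e; have := bpos k; rewrite e k0 hk => /(_ isT).
  + move=> k /andP[k0 hk]; rewrite eJ ?(ltnW hk) //; split.
      by apply: le_trans (low_ge0 _ (ltnW hk)) (ltW (lowup _ (ltnW hk))).
    have [|h h'] := @break_nth m; rewrite ?sz //.
    apply: (up_gap _ _ h h'); first by apply: bpos; rewrite k0 ltnW.
    by rewrite breaks_mono ?sz // ltnS ltnW.
  + by rewrite eJ //; apply: up_le.
  by rewrite eJ //; apply: up_le.
- split.
  + move=> k hk; rewrite eI // eJ //; split; last exact: lowup.
    apply/eqP; rewrite eqz_mod_dvd; apply/dvdzP.
    by exists (psi (b k) - psi (b k).+1); rewrite /low /up /corner; ring.
  + move=> k hk; rewrite eI // eJ ?(ltnW hk) // /up psi_next ?sz //.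
    have : (b k < b k.+1)%N by rewrite breaks_mono ?sz // ltnS ltnW.
    move=> hb; split.
      apply/eqP; rewrite eqz_mod_dvd; apply/dvdzP.
      by exists ((b k.+1)%:Z - (b k)%:Z); rewrite /low /corner; ring.
    by rewrite /low /corner ltrD2l ltrN2 ltr_pM2r ?ltz_nat.
  rewrite eI // eJ // breaks0 low0 /up (psi_last sz).
  have [|h _] := @break_nth m; rewrite ?sz //; split.
    apply/eqP; rewrite eqz_mod_dvd; apply/dvdzP.
    by exists (al%:Z - (b m)%:Z); rewrite subr0; ring.
  by rewrite subr_ge0 ler_pM2r ?ltz_nat // lez_nat ltnW.
move=> k l k0 kl lm; rewrite !eI //; last by lia.
split; first exact: normr_ge0.
have hkl : (b k < b l)%N by rewrite breaks_mono ?sz //; lia.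
have [|h1 h2] := @break_nth k; rewrite ?sz //; first by lia.
have [|h3 h4] := @break_nth l; rewrite ?sz //.
case: ger0P => h; first by apply: low_gap => //; lia.
by rewrite opprB; apply: low_gap => //; lia.
Qed.

(** Where psi does not jump, up k and low k coincide. *)
Lemma breaks_sum (F : int -> int) :
  \sum_(k <- iota 0 al) (F (up k) - F (low k)) =
  \sum_(j <- map up breaks) F j - \sum_(i <- map low breaks) F i.
Proof.
rewrite !big_map -sumrB big_filter [RHS]big_mkcond /=; apply: eq_bigr => k _.
rewrite /brk; case: ifP => // /negbT; rewrite -leNgt => h.
have e : psi k.+1 = psi k by apply/eqP; rewrite eq_le h (st.1 _).
by rewrite /up e subrr.
Qed.

End Normalized.

Lemma sum_rotate (f : nat -> int) k0 : (forall k, f (k + al)%N = f k) ->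
  \sum_(k <- iota 0 al) f (k0 + k)%N = \sum_(k <- iota 0 al) f k.
Proof.
move=> per; have e g : \sum_(k <- iota 0 al) g k = \sum_(0 <= k < al) g k :> int.
  by rewrite /index_iota subn0.
rewrite !e; elim: k0 => [//|k0 <-].
rewrite -(prednK al0) [LHS]big_nat_recr // [RHS]big_nat_recl //= addrC.
rewrite addn0 addSnnS prednK // per; congr (_ + _).
by apply: eq_bigr => k _; rewrite addSnnS.
Qed.

(** Rotate the staircase so that it starts at its least corner and subtract the
    value of that corner: then all the corners are nonnegative and the first one
    is 0, as the definition of a couple requires. *)
Lemma staircase_sum_ge0 H : (forall I J, fundamental_couple al be I J ->
    forall n, \sum_(i <- I) H (i + n) <= \sum_(j <- J) H (j + n)) ->
  forall psi, staircase psi -> forall n,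
    0 <= \sum_(k <- iota 0 al) dif be H (n + corner psi k).
Proof.
move=> hd psi st n.
have [k0 kmin] : exists k0, forall k, corner psi k0 <= corner psi k.
  have [k0 _ hk0] := @arg_minP _ _ _ (Ordinal al0) xpredT (fun k : 'I_al => corner psi k) isT.
  exists k0 => k; rewrite -(corner_modn k st).
  exact: (hk0 (Ordinal (ltn_pmod k al0))).
pose phi k := psi (k0 + k)%N - psi k0.
have stp : staircase phi.
  split=> k; rewrite /phi; first by rewrite addnS lerD2r st.1.
  by rewrite addnA st.2 addrAC.
have phi0 : phi 0%N = 0 by rewrite /phi addn0 subrr.
have cphi k : corner phi k = corner psi (k0 + k)%N - corner psi k0.
  by rewrite /corner /phi PoszD; ring.
have phic k : (k < al)%N -> 0 <= corner phi k.
  by move=> _; rewrite cphi subr_ge0.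
pose n' := n + corner psi k0 - be%:Z.
have := hd _ _ (breaks_couple stp phi0 phic) n'.
rewrite -subr_ge0 -(breaks_sum stp (fun z => H (z + n'))) => h.
suff -> : \sum_(k <- iota 0 al) dif be H (n + corner psi k) =
  \sum_(k <- iota 0 al) (H (al%:Z * phi k.+1 - k%:Z * be%:Z + n') - H (corner phi k + n')) by [].
rewrite /dif !sumrB; congr (_ - _).
  rewrite -(@sum_rotate (fun k => H (n + corner psi k)) k0.+1).
    apply: eq_bigr => k _; congr H; rewrite /n' /corner /phi addSnnS -addSnnS PoszD.
    by rewrite -[k0.+1]addn1 PoszD addn1 addSnnS; ring.
  by move=> k; rewrite corner_per.
rewrite -(@sum_rotate (fun k => H (n + corner psi k - be%:Z)) k0).
  by apply: eq_bigr => k _; congr H; rewrite cphi /n'; ring.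
by move=> k; rewrite corner_per.
Qed.

End StaircaseToCouple.

(** * Mass of lower sets *)

Section LowerSets.
Variables (al be : nat).
Hypotheses (al0 : (0 < al)%N) (be0 : (0 < be)%N) (co : coprime al be).
Implicit Types (L : int -> Prop) (P F : int -> int) (lo n : int).

Definition lower L : Prop :=
  (forall n, L n -> L (n - al%:Z)) /\ (forall n, L n -> L (n - be%:Z)).

Definition mass lo (N : nat) L P : int :=
  \sum_(0 <= v < N) P (lo + v%:Z) * `[< L (lo + v%:Z) >]%:Z.

Lemma lower_sub L n i j : lower L -> L n -> L (n - al%:Z * i%:Z - be%:Z * j%:Z).
Proof.
move=> [h1 h2] Ln; elim: j => [|j IH].
  rewrite mulr0 subr0; elim: i => [|i IH]; first by rewrite mulr0 subr0.
  by have := h1 _ IH; congr L; rewrite -addn1 PoszD; ring.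
by have := h2 _ IH; congr L; rewrite -addn1 PoszD; ring.
Qed.

Lemma int_max (S : int -> Prop) (u0 M : int) : S u0 -> (forall u, S u -> u <= M) ->
  exists2 u, S u & forall v, S v -> v <= u.
Proof.
move=> S0 hM; pose T d := `[< S (u0 + d%:Z) >].
have ex : exists d, T d by exists 0%N; apply/asboolP; rewrite addr0.
have bd d : T d -> (d <= `|(M - u0)%R|)%N by move=> /asboolP/hM; lia.
case: (ex_maxnP ex bd) => d /asboolP Sd dmax; exists (u0 + d%:Z) => // v Sv.
case: (lerP v u0) => h; first by lia.
have := dmax `|(v - u0)%R|%N; rewrite /T.
have -> : u0 + `|(v - u0)%R|%N%:Z = v by lia.
by move=> /(_ (asboolT Sv)); lia.
Qed.

Lemma sum_shift (E : int -> int) lo (N c : nat) :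
  (forall n, n < lo -> E n = 0) -> (forall n, lo + N%:Z - c%:Z <= n -> E n = 0) ->
  \sum_(0 <= v < N) E (lo + v%:Z - c%:Z) = \sum_(0 <= v < N) E (lo + v%:Z).
Proof.
move=> h1 h2; case: (ltnP N c) => hc.
  rewrite !big_nat big1 => [|v /andP[_ hv]]; last by apply: h1; lia.
  by rewrite big1 // => v /andP[_ hv]; apply: h2; lia.
rewrite (big_cat_nat (leq0n c) hc) /= big_nat big1 => [|v /andP[_ hv]]; last by apply: h1; lia.
rewrite add0r -{1}[c]add0n big_addn [RHS](big_cat_nat (leq0n (N - c)) (leq_subr c N)) /=.
rewrite [X in _ + X]big_nat [X in _ + X]big1 => [|v /andP[hv hv']]; last by apply: h2; lia.
by rewrite addr0; apply: eq_bigr => v _; congr E; lia.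
Qed.

(** The greatest elements of a nonempty bounded lower set in the residue classes
    modulo alpha, read in steps of - beta, form a staircase. *)
Lemma lower_staircase L M l0 : lower L -> (forall n, L n -> n < M) -> L l0 ->
  exists2 psi, staircase al be psi & forall n,
    L n /\ ~ L (n + al%:Z) <-> exists2 k, (k < al)%N & n = corner al be psi k.
Proof.
move=> lL hM L0.
have co' : coprime be al by rewrite coprime_sym.
have ex k : exists u : int, L (al%:Z * u - k%:Z * be%:Z) /\
    forall v, L (al%:Z * v - k%:Z * be%:Z) -> v <= u.
  have [i [j [_ e]]] := coprime_decomposition al0 co' (l0 + k%:Z * be%:Z).
  have [||u hu hmax] := @int_max (fun u => L (al%:Z * u - k%:Z * be%:Z)) j `|(M + k%:Z * be%:Z)%R|%N%:Z.
  - have -> : al%:Z * j - k%:Z * be%:Z = l0 - al%:Z * 0%:Z - be%:Z * i%:Z by lia.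
    exact: lower_sub.
  - move=> u /hM h; case: (lerP u 0) => u0; first by lia.
    have : 1 * u <= al%:Z * u by rewrite ler_pM2r //; lia.
    lia.
  by exists u.
have [psi hpsi] := choice ex.
have mx k v : L (al%:Z * v - k%:Z * be%:Z) -> v <= psi k by have [_ h] := hpsi k; apply: h.
have inL k : L (corner al be psi k) by have [h _] := hpsi k.
exists psi; first split.
- move=> k; apply: mx; have := lL.2 _ (inL k); congr L; rewrite /corner -addn1 PoszD; ring.
- move=> k; apply/eqP; rewrite eq_le; apply/andP; split.
    have : psi (k + al)%N - be%:Z <= psi k; last by lia.
    apply: mx; have := inL (k + al)%N; congr L; rewrite /corner PoszD; ring.
  apply: mx; have := inL k; congr L; rewrite /corner PoszD; ring.
move=> n; split=> [[Ln nL]|[k hk ->]]; last first.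
  split=> // h; have : psi k + 1 <= psi k; last by lia.
  by apply: mx; move: h; congr L; rewrite /corner; ring.
have [i [j [hi e]]] := coprime_decomposition al0 co' (- n).
exists i => //.
have en : n = al%:Z * (- j) - i%:Z * be%:Z by lia.
have h1 : - j <= psi i by apply: mx; rewrite -en.
suff e2 : psi i = - j by rewrite en /corner e2.
apply/eqP; rewrite eq_le h1 andbT leNgt; apply/negP => h2; apply: nL.
have := lower_sub `|(psi i + j - 1)%R|%N 0 lL (inL i); congr L.
rewrite /corner en gez0_abs; last by lia.
ring.
Qed.

(** Summation by parts against (1 - t^beta) H leaves the values at those elements n
    of L for which n + alpha is not in L, the corners of a staircase. *)
Lemma lower_mass_ge0 H lo N L : (forall n, n < lo -> H n = 0) -> lower L ->
  (forall psi, staircase al be psi ->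
     forall n, 0 <= \sum_(k <- iota 0 al) dif be H (n + corner al be psi k)) ->
  0 <= mass lo N L (delta al be H).
Proof.
move=> hlo lL0 hst.
(* truncation at the end of the range makes the lower set bounded *)
pose L' n := L n /\ n < lo + N%:Z.
have -> : mass lo N L (delta al be H) = mass lo N L' (delta al be H).
  rewrite /mass !big_nat; apply: eq_bigr => v /andP[_ hv]; congr (_ * (nat_of_bool _)%:Z).
  by apply: asbool_equiv_eq; split=> [h|[]//]; split=> //; lia.
have lL : lower L' by case: lL0 => h1 h2; split=> n [Ln hn]; split; auto; lia.
have hL' n : L' n -> n < lo + N%:Z by case.
move: L' lL hL' => {lL0}{}L lL hL.
case: (pselect (exists l, L l)) => [[l Ll]|nL]; last first.
  by rewrite /mass big1 // => v _; rewrite asboolF ?mulr0 // => h; apply: nL; eexists; exact: h.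
have [psi st hpsi] := lower_staircase lL hL Ll.
pose g := dif be H.
have glo n : n < lo -> g n = 0 by move=> h; rewrite /g /dif !hlo //; lia.
have -> : mass lo N L (delta al be H) =
  \sum_(0 <= v < N) g (lo + v%:Z) * `[< L (lo + v%:Z) /\ ~ L (lo + v%:Z + al%:Z) >]%:Z.
  pose E n := g n * `[< L (n + al%:Z) >]%:Z.
  have -> : mass lo N L (delta al be H) =
     \sum_(0 <= v < N) g (lo + v%:Z) * `[< L (lo + v%:Z) >]%:Z - \sum_(0 <= v < N) E (lo + v%:Z - al%:Z).
    rewrite -sumrB; apply: eq_bigr => v _.
    by rewrite /E subrK -mulrBl.
  rewrite sum_shift /E; last 2 first.
  - by move=> n h; rewrite glo ?mul0r.
  - by move=> n h; rewrite asboolF ?mulr0 // => /hL; lia.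
  rewrite -sumrB; apply: eq_bigr => v _; rewrite -mulrBr; congr (_ * _).
  set n := lo + _; case: (asboolP (L (n + _))) => h.
    have Ln : L n by have := lL.1 _ h; rewrite addrK.
    by rewrite (asboolT Ln) (asboolF (P := _ /\ _)) // => -[].
  case: (asboolP (L n)) => h'; first by rewrite asboolT.
  by rewrite asboolF // => -[].
have := hst psi st 0; congr (_ <= _).
pose r1 := [seq lo + v%:Z | v <- iota 0 N & `[< L (lo + v%:Z) /\ ~ L (lo + v%:Z + al%:Z) >]].
pose r2 := [seq corner al be psi k | k <- iota 0 al & lo <= corner al be psi k].
transitivity (\sum_(n <- r2) g n).
  rewrite big_map big_filter [RHS]big_mkcond /=; apply: eq_bigr => k _.
  by rewrite add0r; case: lerP => // /glo.
transitivity (\sum_(n <- r1) g n); last first.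
  rewrite big_map big_filter big_mkcond /index_iota subn0 /=.
  by apply: eq_bigr => v _; case: ifP => _; rewrite ?mulr1 ?mulr0.
apply: perm_big; apply: uniq_perm.
- rewrite map_inj_in_uniq ?filter_uniq ?iota_uniq // => k k'.
  rewrite !mem_filter !mem_iota /= => /andP[_ hk] /andP[_ hk'] e.
  by apply: (@corner_mod_inj al be al0 be0 co psi k k' 0) => //; rewrite mulr0 addr0.
- by rewrite map_inj_uniq ?filter_uniq ?iota_uniq // => v w; lia.
move=> n; apply/mapP/mapP => [[k]|[v]].
  rewrite mem_filter mem_iota /= => /andP[h1 hk] ->.
  have /hpsi h2 : exists2 k', (k' < al)%N & corner al be psi k = corner al be psi k' by exists k.
  have hlt := hL _ h2.1.
  exists `|(corner al be psi k - lo)%R|%N; last by lia.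
  rewrite mem_filter mem_iota /= asboolT /=; first by lia.
  by have -> : lo + `|(corner al be psi k - lo)%R|%N%:Z = corner al be psi k by lia.
rewrite mem_filter => /andP[/asboolP/hpsi[k hk e] _] ->.
by exists k; rewrite // mem_filter mem_iota /= hk -e; lia.
Qed.

End LowerSets.

(** * The decomposition of a series with nonnegative masses *)

Section Decomposition.
Variables (K : fieldType) (al be : nat).
Hypotheses (al0 : (0 < al)%N) (be0 : (0 < be)%N).
Implicit Types (L : int -> Prop) (H P : int -> int) (lo a n : int).
Notation lower := (lower al be).
Notation realizable := (realizable K al be).

(** The Hilbert series of K[X](-a), of K[Y](-a) and of R(-c). *)
Definition serX a : int -> int := fun n => `[< exists k : nat, n = a + (al * k)%N%:Z >]%:Z.
Definition serY a : int -> int := fun n => `[< exists k : nat, n = a + (be * k)%N%:Z >]%:Z.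
Definition serR c : int -> int := fun n => (size (monomials al be (n - c)))%:Z.

Lemma dif_progression (d : nat) a n : (0 < d)%N ->
  dif d (fun n => `[< exists k : nat, n = a + (d * k)%N%:Z >]%:Z) n = (n == a)%:Z.
Proof.
move=> d0; rewrite /dif; case: asboolP => [[k ek]|h1]; case: asboolP => [[l el]|h2].
- case: eqP => // e; nia.
- case: eqP => // e; case: h2; exists k.-1; case: k ek => [|k] ek; last by rewrite ek /= mulnS; lia.
  by case: e; rewrite ek muln0 addr0.
- by case: h1; exists l.+1; rewrite mulnS; lia.
case: eqP => // e; case: h1; exists 0%N; rewrite muln0; lia.
Qed.

Lemma progression_laurent (d : nat) a :
  is_laurent (fun n => `[< exists k : nat, n = a + (d * k)%N%:Z >]%:Z : int).
Proof. by exists a => n hn; rewrite asboolF // => -[k e]; lia. Qed.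

Lemma deltaC F n : delta al be F n = dif be (dif al F) n.
Proof.
rewrite /delta /dif opprB addrACA [n - al%:Z - _]addrAC; ring.
Qed.

Lemma delta_serX a n : delta al be (serX a) n = (n == a)%:Z - (n == a + be%:Z)%:Z.
Proof.
have e m : dif al (serX a) m = (m == a)%:Z by exact: dif_progression.
by rewrite deltaC {1}/dif !e subr_eq.
Qed.

Lemma delta_serY a n : delta al be (serY a) n = (n == a)%:Z - (n == a + al%:Z)%:Z.
Proof.
have e m : dif be (serY a) m = (m == a)%:Z by exact: dif_progression.
by rewrite /delta {1}/dif !e subr_eq.
Qed.

Lemma delta_serR c n : delta al be (serR c) n = (n == c)%:Z.
Proof.
rewrite -subr_eq0 -(delta_monomials al0 be0 (n - c)) /serR.
have := delta_shiftD al be (fun m => (size (monomials al be m))%:Z) (fun=> 0) c n.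
under eq_fun do rewrite addr0; move=> ->.
by rewrite [X in _ + X]/delta /dif !subrr addr0.
Qed.

Lemma serR_laurent c : is_laurent (serR c).
Proof. by exists c => n hn; rewrite /serR; have : n - c < 0 by [lia]; case: (n - c). Qed.

(** The number N only serves to bound the support from above, so that the mass of
    an infinite lower set is a finite sum; [mass_widen] lets it grow. *)
Definition nonneg_masses lo P : Prop := exists N : nat,
  [/\ forall n, n < lo -> P n = 0, forall n, lo + N%:Z <= n -> P n = 0 &
      forall L, lower L -> 0 <= mass lo N L P].

Lemma mass_widen lo (N N' : nat) L P : (N <= N')%N ->
  (forall n, lo + N%:Z <= n -> P n = 0) -> mass lo N' L P = mass lo N L P.
Proof.
move=> le h; rewrite /mass (big_cat_nat (leq0n N) le) /=.
rewrite [X in _ + X]big_nat [X in _ + X]big1 ?addr0 // => v /andP[hv _].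
by rewrite h ?mul0r //; lia.
Qed.

Lemma nonneg_masses_widen lo P (N0 : nat) : nonneg_masses lo P -> exists N : nat,
  [/\ (N0 <= N)%N, forall n, lo + N%:Z <= n -> P n = 0 &
      forall L, lower L -> 0 <= mass lo N L P].
Proof.
case=> N [_ h2 h3]; exists (N + N0)%N; split; first exact: leq_addl.
  by move=> n hn; apply: h2; lia.
by move=> L /h3; rewrite (@mass_widen lo N) // leq_addr.
Qed.

Lemma mass_indicator lo N L a : lo <= a < lo + N%:Z ->
  mass lo N L (fun n => (n == a)%:Z) = `[< L a >]%:Z.
Proof.
move=> ha; rewrite /mass /index_iota subn0.
rewrite (bigD1_seq `|(a - lo)%R|%N) ?iota_uniq ?mem_iota //=; last by lia.
have -> : lo + `|(a - lo)%R|%N%:Z = a by lia.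
rewrite eqxx mul1r big1 ?addr0 // => v /eqP hv.
by case: eqP => [e|_]; rewrite ?mul0r //; case: hv; lia.
Qed.

Lemma massD lo N L P Q : mass lo N L (fun n => P n + Q n) = mass lo N L P + mass lo N L Q.
Proof. by rewrite /mass -big_split; apply: eq_bigr => v _; rewrite /= mulrDl. Qed.

Lemma massN lo N L P : mass lo N L (fun n => - P n) = - mass lo N L P.
Proof. by rewrite /mass -sumrN; apply: eq_bigr => v _; rewrite /= mulNr. Qed.

(** If a unit at position lo can be moved neither to lo + beta nor to lo + alpha,
    there are lower sets L1 and L2 of mass zero that contain lo, the first without
    lo + beta, the second without lo + alpha. By additivity of the mass their
    intersection has mass zero too, and it remains lower without lo, which has
    positive mass. *)
Lemma move_unit lo P : nonneg_masses lo P -> 0 < P lo ->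
  nonneg_masses lo (fun n => P n - ((n == lo)%:Z - (n == lo + be%:Z)%:Z)) \/
  nonneg_masses lo (fun n => P n - ((n == lo)%:Z - (n == lo + al%:Z)%:Z)).
Proof.
move=> hP Plo; have [_ [Plt _ _]] := hP.
have [N [hN Pge Pm]] := nonneg_masses_widen (al + be).+1 hP.
have mE d L : (0 < d < N)%N ->
  mass lo N L (fun n => P n - ((n == lo)%:Z - (n == lo + d%:Z)%:Z)) =
  mass lo N L P - (`[< L lo >]%:Z - `[< L (lo + d%:Z) >]%:Z).
  move=> /andP[d0 hd]; rewrite massD massN massD massN !mass_indicator //; lia.
have good d : (0 < d < N)%N ->
    nonneg_masses lo (fun n => P n - ((n == lo)%:Z - (n == lo + d%:Z)%:Z)) \/
    exists L, [/\ lower L, mass lo N L P = 0, L lo & ~ L (lo + d%:Z)].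
  move=> hd; case: (pselect (exists L, [/\ lower L, mass lo N L P = 0, L lo & ~ L (lo + d%:Z)])) => h.
    by right.
  left; exists N; split=> [n hn|n hn|L hL].
  - by rewrite Plt //; do 2!(case: eqP => [e|_]; first by lia).
  - by rewrite Pge //; do 2!(case: eqP => [e|_]; first by lia).
  rewrite mE //; have h0 := Pm L hL.
  case: (asboolP (L lo)) => h1; case: (asboolP (L _)) => h2; try lia.
  case: (eqVneq (mass lo N L P) 0) => [e|ne]; last by lia.
  by case: h; exists L.
have [hbe hal] : (0 < be < N)%N /\ (0 < al < N)%N by lia.
have [hb|[L1 [l1 m1 in1 out1]]] := good be hbe; first by left.
have [ha|[L2 [l2 m2 in2 out2]]] := good al hal; first by right.
pose U n := L1 n \/ L2 n; pose I n := L1 n /\ L2 n; pose I' n := I n /\ n <> lo.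
have lU : lower U.
  split=> n [h|h]; [left; exact: l1.1|right; exact: l2.1|left; exact: l1.2|right; exact: l2.2].
have lI' : lower I'.
  split=> n [[h1 h2] h3]; split; first by split; [exact: l1.1|exact: l2.1].
  - by move=> e; apply: out2; rewrite -e subrK.
  - by split; [exact: l1.2|exact: l2.2].
  by move=> e; apply: out1; rewrite -e subrK.
have e1 : mass lo N U P + mass lo N I P = mass lo N L1 P + mass lo N L2 P.
  rewrite /mass -!big_split; apply: eq_bigr => v _ /=; rewrite -!mulrDr; congr (_ * _).
  rewrite /U /I; case: (asboolP (L1 _)) => h1; case: (asboolP (L2 _)) => h2;
    case: asboolP => h3; case: asboolP => h4 //; tauto.
have e2 : mass lo N I P = mass lo N I' P + P lo.
  rewrite /mass (bigD1_seq 0%N) ?iota_uniq ?mem_index_iota //=; last by lia.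
  rewrite [X in _ = X + _](bigD1_seq 0%N) ?iota_uniq ?mem_index_iota //=; last by lia.
  rewrite addr0 asboolT // (asboolF (P := I' lo)) => [|[_ []] //].
  rewrite mulr1 mulr0 add0r addrC; congr (_ + _); apply: eq_bigr => v v0; congr (_ * (nat_of_bool _)%:Z).
  by apply: asbool_equiv_eq; split=> [h|[]//]; split=> //; lia.
have := Pm _ lU; have := Pm _ lI'; lia.
Qed.

(** The integers up to lo form a lower set. *)
Lemma nonneg_masses_first lo P : nonneg_masses lo P -> 0 <= P lo.
Proof.
move=> hP; have [N [N1 _ h]] := nonneg_masses_widen 1 hP.
have := h (fun n => n <= lo); rewrite /mass.
rewrite (bigD1_seq 0%N) ?iota_uniq ?mem_index_iota //= addr0 asboolT // mulr1.
rewrite big1 ?addr0 => [|v v0]; last by rewrite asboolF ?mulr0 //; lia.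
by apply; split=> n; lia.
Qed.

Lemma nonneg_masses_next lo P : nonneg_masses lo P -> P lo = 0 ->
  nonneg_masses (lo + 1) P.
Proof.
move=> hP P0; have [N [N1 h2 h3]] := nonneg_masses_widen 1 hP.
have [_ [h1 _ _]] := hP; exists N.-1; split=> [n hn|n hn|L /h3].
- by case: (ltrP n lo) => [/h1 //|hn']; have -> : n = lo by lia.
- by apply: h2; lia.
rewrite /mass -(prednK N1) big_nat_recl //= addr0 P0 mul0r add0r.
by congr (_ <= _); apply: eq_bigr => v _; rewrite -addrA -PoszD add1n.
Qed.

Lemma realizable_sub H G : realizable G -> realizable (fun n => H n - G n) -> realizable H.
Proof.
move=> hG hH; have := realizable_add al0 be0 hH hG.
by congr realizable; apply: funext => n; rewrite subrK.
Qed.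

(** Each unit of the product by (1 - t^alpha)(1 - t^beta) is the contribution of a
    shifted copy of the ring; induction on the number of units. *)
Lemma realizable_nonneg H lo (N : nat) : is_laurent H ->
  (forall n, 0 <= delta al be H n) -> (forall n, n < lo -> delta al be H n = 0) ->
  (forall n, lo + N%:Z <= n -> delta al be H n = 0) -> realizable H.
Proof.
have zero F : is_laurent F -> (forall n, 0 <= delta al be F n) ->
    ~ (exists c, 0 < delta al be F c) -> realizable F.
  move=> lF F0 nc; have -> : F = fun=> 0; last exact: realizable0.
  apply: funext; apply: (delta_inj al0 be0) => // [|n]; first by exists 0.
  have -> : delta al be (fun=> 0) n = 0 by rewrite /delta /dif !subrr.
  apply/eqP; rewrite eq_le F0 andbT leNgt; apply/negP => h.
  by apply: nc; exists n.
move=> lH; have [t et] : exists t : nat, \sum_(0 <= v < N) delta al be H (lo + v%:Z) <= t%:Z.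
  by exists `|(\sum_(0 <= v < N) delta al be H (lo + v%:Z))%R|%N; lia.
elim: t H lH et => [|t IH] H lH et P0 Plt Pge;
    case: (pselect (exists c, 0 < delta al be H c)) => [[c hc]|nc]; try exact: zero.
  have hc2 : lo <= c < lo + N%:Z.
    apply/andP; split; first by rewrite leNgt; apply/negP => h; rewrite Plt in hc.
    by rewrite ltNge; apply/negP => h; rewrite Pge in hc.
  have : delta al be H c <= \sum_(0 <= v < N) delta al be H (lo + v%:Z).
    rewrite /index_iota subn0 (bigD1_seq `|(c - lo)%R|%N) ?iota_uniq ?mem_iota //=; last by lia.
    have -> : lo + `|(c - lo)%R|%N%:Z = c by lia.
    by rewrite lerDl sumr_ge0.
  lia.
have hc2 : lo <= c < lo + N%:Z.
  apply/andP; split; first by rewrite leNgt; apply/negP => h; rewrite Plt in hc.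
  by rewrite ltNge; apply/negP => h; rewrite Pge in hc.
apply: (realizable_sub (realizable_R K al0 be0 c)); apply: IH.
- exact: laurentB (serR_laurent c).
- under eq_bigr do rewrite deltaB delta_serR.
  rewrite sumrB; suff -> : \sum_(0 <= v < N) (lo + v%:Z == c)%:Z = 1 :> int.
    by rewrite lerBlDr -PoszD addn1.
  have := @mass_indicator lo N (fun=> True) c hc2; rewrite asboolT // => <-.
  by apply: eq_bigr => v _; rewrite asboolT ?mulr1.
- move=> n; rewrite deltaB delta_serR; have := P0 n; case: eqP => [->|_]; lia.
- by move=> n hn; rewrite deltaB delta_serR Plt //; case: eqP => [e|_]; lia.
by move=> n hn; rewrite deltaB delta_serR Pge //; case: eqP => [e|_]; lia.
Qed.

(** The units at the lowest position lo are moved upwards one by one, each move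
    subtracting from H the Hilbert series of K[X](-lo) or of K[Y](-lo). After N
    positions have been cleared only nonnegative coefficients remain. *)
Lemma realizable_nonneg_masses H lo (N : nat) : is_laurent H ->
  nonneg_masses lo (delta al be H) -> (forall n, lo + N%:Z <= n -> 0 <= delta al be H n) ->
  realizable H.
Proof.
elim: N lo H => [|N IHN] lo H lH hm hge.
  have [M [h1 h2 _]] := hm.
  apply: (realizable_nonneg lH _ h1 h2) => n.
  by case: (ltrP n lo) => [/h1 -> //|h]; apply: hge; lia.
have [p ep] : exists p : nat, delta al be H lo = p%:Z.
  by have := nonneg_masses_first hm; exists `|(delta al be H lo)%R|%N; lia.
elim: p H lH hm hge ep => [|p IHp] H lH hm hge ep.
  apply: (IHN (lo + 1)) => //; first exact: nonneg_masses_next.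
  by move=> n hn; apply: hge; lia.
have step (G : int -> int) (d : nat) : (0 < d)%N -> is_laurent G -> realizable G ->
    (forall n, delta al be G n = (n == lo)%:Z - (n == lo + d%:Z)%:Z) ->
    nonneg_masses lo (fun n => delta al be H n - ((n == lo)%:Z - (n == lo + d%:Z)%:Z)) ->
    realizable H.
  move=> d0 lG rG dG hm'; apply: (realizable_sub rG); apply: IHp.
  - exact: laurentB.
  - by move: hm'; congr nonneg_masses; apply: funext => n; rewrite deltaB dG.
  - move=> n hn; rewrite deltaB dG; have := hge n hn.
    by case: eqP => [e|_]; [lia|case: eqP; lia].
  rewrite deltaB dG eqxx ep; case: eqP => [e|_]; lia.
have [|hX|hY] := move_unit hm; first by rewrite ep.
  apply: (step (serX lo) be) => //; [exact: progression_laurent|exact: realizable_X|exact: delta_serX].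
apply: (step (serY lo) al) => //; [exact: progression_laurent|exact: realizable_Y|exact: delta_serY].
Qed.

End Decomposition.

Theorem theorem6p1 (K : fieldType) (alpha beta : nat)
    (alpha_gt0 : (0 < alpha)%N) (beta_gt0 : (0 < beta)%N)
    (co_ab : coprime alpha beta)
    (H : int -> int) (H_laurent : is_laurent H)
    (H_hilb : exists M : gmodR K alpha beta, fin_gen M /\ hilbR M = H) :
  [<-> (* (a) *)
       (0 < hilbert_depth K alpha beta H)%E;
       (* (b) *)
       forall N : gmodS K alpha beta, fin_gen N -> torsionfree N ->
         ldiv_ge0 (lmul H (hilbS N)) (hilb_polyR K alpha beta);
       (* (c) *)
       forall N : gmodS K alpha beta, fin_gen N -> torsionfree N ->
         has_rank N 1%N ->
         ldiv_ge0 (lmul H (hilbS N)) (hilb_polyR K alpha beta);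
       (* (d) *)
       forall I J : seq int, fundamental_couple alpha beta I J ->
         forall n : int, \sum_(i <- I) H (i + n) <= \sum_(j <- J) H (j + n)].
Proof.
have [M [fgM eH]] := H_hilb; tfae.
- exact: positive_depth_ldiv_ge0.
- by move=> hb N fgN tfN _; apply: hb.
- move=> hc I J /(couple_sum alpha_gt0 beta_gt0 co_ab H_laurent)[psi st e] n.
  by rewrite -subr_ge0 -e; apply: (staircase_inequality alpha_gt0 beta_gt0 co_ab H_laurent hc).
move=> hd; apply: realizable_depth.
have [lo hlo] := H_laurent.
have [hi] := delta_hilb_finite alpha_gt0 beta_gt0 (monomial_gradingR K alpha beta) fgM.
rewrite -/(hilbR M) eH => hhi.
pose N := `|(hi - lo + 1)%R|%N.
have dge n : lo + N%:Z <= n -> delta alpha beta H n = 0 by move=> hn; apply: hhi; lia.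
apply: (@realizable_nonneg_masses K alpha beta alpha_gt0 beta_gt0 H lo N H_laurent).
  exists N; split=> // [n hn|L lL]; first by rewrite /delta /dif !hlo //; lia.
  apply: (lower_mass_ge0 alpha_gt0 beta_gt0 co_ab _ hlo lL) => psi st.
  exact: (staircase_sum_ge0 alpha_gt0 beta_gt0 co_ab hd st).
by move=> n /dge ->.
Qed.
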